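(* Let $o,p\in\mathbb{O}_{\lambda\mu}$ be $\lambda\mu$-objects. Then $o\simeq_\tau p$ if and only if $\mathcal P(o)\simeq\mathcal P(p)$.
   Context: **$\lambda\mu$-objects.** Fix countably infinite sets of variables $x,y,\dots$ and names $\alpha,\beta,\dots$. $\lambda\mu$-terms $t::=x\mid t\,t\mid\lambda x.t\mid\mu\alpha.c$; $\lambda\mu$-commands $c::=[\alpha]t$; $\mathbb{O}_{\lambda\mu}$ is the set of $\lambda\mu$-terms and $\lambda\mu$-commands, modulo $\alpha$-conversion. **The relation $\simeq_\tau$.** $\simeq_\tau$ is the least congruence on $\mathbb{O}_{\lambda\mu}$ containing: 1. $(\lambda y.\lambda x.t)v\simeq\lambda x.(\lambda y.t)v$, if $x\notin v$; 2. $(\lambda x.t\,v)u\simeq(\lambda x.t)\,u\,v$, if $x\notin v$; 3. $(\lambda x.\mu\alpha.[\beta]t)u\simeq\mu\alpha.[\beta](\lambda x.t)u$, if $\alpha\notin u$; 4. $[\alpha'](\mu\alpha.[\beta'](\mu\beta.c)v)u\simeq[\beta'](\mu\beta.[\alpha'](\mu\alpha.c)u)v$, if $\alpha\notin v,\beta\notin u,\beta\ne\alpha',\alpha\ne\beta'$; 5. $[\alpha'](\mu\alpha.[\beta']\lambda y.\mu\beta.c)u\simeq[\beta']\lambda y.\mu\beta.[\alpha'](\mu\alpha.c)u$, if $y\notin u,\beta\notin u,\beta\ne\alpha',\alpha\ne\beta'$; 6. $[\alpha']\lambda x.\mu\alpha.[\beta']\lambda y.\mu\beta.c\simeq[\beta']\lambda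 y.\mu\beta.[\alpha']\lambda x.\mu\alpha.c$, if $\beta\ne\alpha',\alpha\ne\beta'$; 7. $\mu\alpha.[\alpha]t\simeq t$, if $\alpha\notin t$; 8. $[\alpha']\mu\alpha.[\beta']\mu\beta.c\simeq[\beta']\mu\beta.[\alpha']\mu\alpha.c$, if $\beta\ne\alpha',\alpha\ne\beta'$; 9. $[\alpha']\mu\alpha.[\beta']\lambda y.\mu\beta.c\simeq[\beta']\lambda y.\mu\beta.[\alpha']\mu\alpha.c$, if $\beta\ne\alpha',\alpha\ne\beta'$; 10. $[\alpha']\mu\alpha.[\beta'](\mu\beta.c)v\simeq[\beta'](\mu\beta.[\alpha']\mu\alpha.c)v$, if $\alpha\notin v,\beta\ne\alpha',\alpha\ne\beta'$. **$\Lambda M$-objects.** Terms $t,u,v::=x\mid t\,t\mid\lambda x.t\mid\mu\alpha.c\mid t[x\backslash t]$; commands $c::=[\alpha]t\mid c[\![\alpha\backslash^{\alpha'}s]\!]$; non-empty stacks $s::=t\mid t\cdot s$. $\mathbb{O}_{\Lambda M}$ consists of all terms, commands and stacks (a term is also a one-element stack); $\mathbb{O}_{\lambda\mu}\subseteq\mathbb{O}_{\Lambda M}$. Binding: $\lambda x.t$ binds $x$ in $t$; $\mu\alpha.c$ binds $\alpha$ in $c$; $t[x\backslash u]$ binds $x$ in $t$ (not in $u$); $c[\![\alpha\backslash^{\alpha'}s]\!]$ binds $\alpha$ in $c$ (not in $s$), and the displayed $\alpha'$ is a free occurrence. Objects are taken modulo $\alpha$-conversion. $x\notin o$ (resp.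 $\alpha\notin o$) means that the variable (resp. name) occurs neither free nor bound in $o$; same for contexts. $(t_0\cdot\ldots\cdot t_n)\cdot s'=t_0\cdot\ldots\cdot t_n\cdot s'$; for $s=t_0\cdot\ldots\cdot t_n$, $u::s$ is the term $u\,t_0\ldots t_n$. **Contexts.** $\mathtt T::=\Box\mid\mathtt T\,t\mid t\,\mathtt T\mid\lambda x.\mathtt T\mid\mu\alpha.\mathtt C\mid\mathtt T[x\backslash t]\mid t[x\backslash\mathtt T]$; $\mathtt C::=\boxdot\mid[\alpha]\mathtt T\mid\mathtt C[\![\alpha\backslash^{\alpha'}s]\!]\mid c[\![\alpha\backslash^{\alpha'}\mathtt S]\!]$; $\mathtt S::=\mathtt T\mid\mathtt T\cdot s\mid t\cdot\mathtt S$; $\mathtt O::=\mathtt T\mid\mathtt C\mid\mathtt S$. The hole $\Box$ is filled by terms, $\boxdot$ by commands. $\mathtt L::=\Box\mid\mathtt L[x\backslash t]$. Linear contexts: $\mathtt{LTT}::=\Box\mid\mathtt{LTT}\,t\mid\lambda x.\mathtt{LTT}\mid\mu\alpha.\mathtt{LCT}\mid\mathtt{LTT}[x\backslash t]$; $\mathtt{LTC}::=\mathtt{LTC}\,t\mid\lambda x.\mathtt{LTC}\mid\mu\alpha.\mathtt{LCC}\mid\mathtt{LTC}[x\backslash t]$; $\mathtt{LCC}::=\boxdot\mid[\alpha]\mathtt{LTC}\mid\mathtt{LCC}[\![\alpha\backslash^{\alpha'}s]\!]$; $\mathtt{LCT}::=[\alpha]\mathtt{LTT}\mid\mathtt{LCT}[\![\alpha\backslash^{\alpha'}s]\!]$.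 $\mathsf{fc}(o,\mathtt O)$ means that no free variable or name of $o$ is captured by binders of $\mathtt O$ in $\mathtt O\langle o\rangle$; similarly for a name. **Plain reduction.** $\to_{\mathcal P}$ is the closure under all contexts $\mathtt O$ of: - (dB) $\mathtt L\langle\lambda x.t\rangle\,u\mapsto\mathtt L\langle t[x\backslash u]\rangle$, if $\mathsf{fc}(u,\mathtt L)$; - (dM) $\mathtt L\langle\mu\alpha.c\rangle\,u\mapsto\mathtt L\langle\mu\alpha'.c[\![\alpha\backslash^{\alpha'}u]\!]\rangle$, if $\mathsf{fc}(u,\mathtt L)$ and $\alpha'$ is fresh; - (N) $\mathtt{LCC}\langle[\alpha]t\rangle[\![\alpha\backslash^{\alpha'}s]\!]\mapsto\mathtt{LCC}\langle[\alpha'](t::s)\rangle$, if $\alpha\notin\mathtt{LCC}$, $\alpha\notin t$; - (C) $\mathtt{LCC}\langle c'[\![\beta\backslash^{\alpha}s']\!]\rangle[\![\alpha\backslash^{\alpha'}s]\!]\mapsto\mathtt{LCC}\langle c'[\![\beta\backslash^{\alpha'}s'\cdot s]\!]\rangle$, if $\alpha\notin\mathtt{LCC}$, $\alpha\notin c'$, $\alpha\notin s'$; where in (N), (C) bound variables and names are chosen (by $\alpha$-conversion) so that $\alpha'$ and the free variables and names of $s$ are not captured on the right-hand side. $\to_{\mathcal P}$ is terminating and confluent; $\mathcal P(o)$ is the unique $\to_{\mathcal P}$-normal form of $o$. A plain form is an object in $\to_{\mathcal P}$-normal form. **Structural equivalence.** $\simeq$ is the least congruence (equivalence relation closed under contexts)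 over plain forms generated by (all objects involved being plain forms): - $\mathtt{LTT}\langle t\rangle[x\backslash u]\simeq\mathtt{LTT}\langle t[x\backslash u]\rangle$, if $x\notin\mathtt{LTT}$, $\mathsf{fc}(u,\mathtt{LTT})$; - $\mathtt{LCC}\langle c\rangle[\![\alpha\backslash^{\alpha'}s]\!]\simeq\mathtt{LCC}\langle c[\![\alpha\backslash^{\alpha'}s]\!]\rangle$, if $\alpha\notin\mathtt{LCC}$, $\mathsf{fc}(\alpha',\mathtt{LCC})$, $\mathsf{fc}(s,\mathtt{LCC})$; - $[\beta]\mu\alpha.\mathtt{LCC}\langle c\rangle\simeq\mathtt{LCC}\langle[\beta]\mu\alpha.c\rangle$, if $\alpha\notin\mathtt{LCC}$, $\mathsf{fc}(\beta,\mathtt{LCC})$; - $[\alpha']\lambda x.\mu\alpha.[\beta']\lambda y.\mu\beta.c\simeq[\beta']\lambda y.\mu\beta.[\alpha']\lambda x.\mu\alpha.c$, if $\beta\ne\alpha'$, $\alpha\ne\beta'$; - $\mu\alpha.[\alpha]t\simeq t$, if $\alpha\notin t$. *)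

(* Defs.v *)
From Stdlib Require Import Arith Relations ClassicalEpsilon.

Set Implicit Arguments.
Unset Strict Implicit.
Unset Printing Implicit Defensive.

(* Objects modulo alpha-conversion are de Bruijn expressions.  There are two
   independent index spaces, one for variables and one for names; an index
   counts only the enclosing binders of its own kind, and an index beyond those
   is free.  Comments use named syntax, with a, a', b, b' for names. *)

Inductive sort := Tm | Cm | St.

Inductive expr : sort -> Type :=
| Var : nat -> expr Tm
| App : expr Tm -> expr Tm -> expr Tm
| Lam : expr Tm -> expr Tm                        (* binds a variable *)
| Mu : expr Cm -> expr Tm                         (* binds a name *)
| ESub : expr Tm -> expr Tm -> expr Tm            (* t[x\u]; binds a variable in t *)
| Nam : nat -> expr Tm -> expr Cm                 (* [a]t *)
| Rep : expr Cm -> nat -> expr St -> expr Cm      (* c[[a\^a' s]]; binds a name in c,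
                                                     but not in a' nor in s *)
| One : expr Tm -> expr St
| Push : expr Tm -> expr St -> expr St.

Inductive object := Obj (s : sort) (o : expr s).
Coercion Obj : expr >-> object.

Fixpoint lambda_mu_expr {s} (o : expr s) : Prop :=
  match o with
  | Var _ => True
  | App t u => lambda_mu_expr t /\ lambda_mu_expr u
  | Lam t => lambda_mu_expr t
  | Mu c => lambda_mu_expr c
  | Nam _ t => lambda_mu_expr t
  | ESub _ _ | Rep _ _ _ | One _ | Push _ _ => False
  end.

Definition lambda_mu (o : object) : Prop :=
  match o with Obj e => lambda_mu_expr e end.

(* s' . s *)
Fixpoint stack_cat {k} (s' : expr k) (s : expr St) : expr St :=
  match s' with
  | One t => Push t s
  | Push t s'' => Push t (stack_cat s'' s)
  | _ => s
  end.

(* t :: s, the application of t to all the terms of s *)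
Fixpoint app_stack {k} (t : expr Tm) (s : expr k) : expr Tm :=
  match s with
  | One u => App t u
  | Push u s' => app_stack (App t u) s'
  | _ => t
  end.

Definition id_ (i : nat) : nat := i.

Definition up (f : nat -> nat) (i : nat) : nat :=
  match i with 0 => 0 | S j => S (f j) end.

(* [ren f g o] renames the free variables of [o] by [f], its free names by [g]. *)
Fixpoint ren (f g : nat -> nat) {s} (o : expr s) : expr s :=
  match o with
  | Var i => Var (f i)
  | App t u => App (ren f g t) (ren f g u)
  | Lam t => Lam (ren (up f) g t)
  | Mu c => Mu (ren f (up g) c)
  | ESub t u => ESub (ren (up f) g t) (ren f g u)
  | Nam a t => Nam (g a) (ren f g t)
  | Rep c a s => Rep (ren f (up g) c) (g a) (ren f g s)
  | One t => One (ren f g t)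
  | Push t s => Push (ren f g t) (ren f g s)
  end.

(* [ctx h r]: contexts whose hole has sort [h] and whose result has sort [r].
   There is no hole of sort [St]. *)
Inductive ctx : sort -> sort -> Type :=
| CTHole : ctx Tm Tm
| CCHole : ctx Cm Cm
| CAppL h : ctx h Tm -> expr Tm -> ctx h Tm
| CAppR h : expr Tm -> ctx h Tm -> ctx h Tm
| CLam h : ctx h Tm -> ctx h Tm
| CMu h : ctx h Cm -> ctx h Tm
| CESubL h : ctx h Tm -> expr Tm -> ctx h Tm
| CESubR h : expr Tm -> ctx h Tm -> ctx h Tm
| CNam h : nat -> ctx h Tm -> ctx h Cm
| CRepL h : ctx h Cm -> nat -> expr St -> ctx h Cm
| CRepR h : expr Cm -> nat -> ctx h St -> ctx h Cm
| COne h : ctx h Tm -> ctx h St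
| CPushL h : ctx h Tm -> expr St -> ctx h St
| CPushR h : expr Tm -> ctx h St -> ctx h St.

(* Filling a hole captures: index [i] of the filler refers to the [i]-th binder
   above the hole if there is one. *)
Fixpoint plug {h r} (K : ctx h r) : expr h -> expr r :=
  match K in ctx h r return expr h -> expr r with
  | CTHole => fun o => o
  | CCHole => fun o => o
  | CAppL K u => fun o => App (plug K o) u
  | CAppR t K => fun o => App t (plug K o)
  | CLam K => fun o => Lam (plug K o)
  | CMu K => fun o => Mu (plug K o)
  | CESubL K u => fun o => ESub (plug K o) u
  | CESubR t K => fun o => ESub t (plug K o)
  | CNam a K => fun o => Nam a (plug K o)
  | CRepL K a s => fun o => Rep (plug K o) a s
  | CRepR c a K => fun o => Rep c a (plug K o)
  | COne K => fun o => One (plug K o)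
  | CPushL K s => fun o => Push (plug K o) s
  | CPushR t K => fun o => Push t (plug K o)
  end.

Fixpoint cren (f g : nat -> nat) {h r} (K : ctx h r) : ctx h r :=
  match K in ctx h r return ctx h r with
  | CTHole => CTHole
  | CCHole => CCHole
  | CAppL K u => CAppL (cren f g K) (ren f g u)
  | CAppR t K => CAppR (ren f g t) (cren f g K)
  | CLam K => CLam (cren (up f) g K)
  | CMu K => CMu (cren f (up g) K)
  | CESubL K u => CESubL (cren (up f) g K) (ren f g u)
  | CESubR t K => CESubR (ren (up f) g t) (cren f g K)
  | CNam a K => CNam (g a) (cren f g K)
  | CRepL K a s => CRepL (cren f (up g) K) (g a) (ren f g s)
  | CRepR c a K => CRepR (ren f (up g) c) (g a) (cren f g K)
  | COne K => COne (cren f g K)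
  | CPushL K s => CPushL (cren f g K) (ren f g s)
  | CPushR t K => CPushR (ren f g t) (cren f g K)
  end.

(* Number of variables bound above the hole. *)
Fixpoint nvar {h r} (K : ctx h r) : nat :=
  match K with
  | CTHole | CCHole => 0
  | CLam K | CESubL K _ => S (nvar K)
  | CAppL K _ | CAppR _ K | CMu K | CESubR _ K | CNam _ K | CRepL K _ _
  | CRepR _ _ K | COne K | CPushL K _ | CPushR _ K => nvar K
  end.

(* Number of names bound above the hole. *)
Fixpoint nnam {h r} (K : ctx h r) : nat :=
  match K with
  | CTHole | CCHole => 0
  | CMu K | CRepL K _ _ => S (nnam K)
  | CAppL K _ | CAppR _ K | CLam K | CESubL K _ | CESubR _ K | CNam _ K
  | CRepR _ _ K | COne K | CPushL K _ | CPushR _ K => nnam K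
  end.

(* The contexts L. *)
Fixpoint subst_ctx {h r} (K : ctx h r) : Prop :=
  match K with
  | CTHole => True
  | CESubL K _ => subst_ctx K
  | _ => False
  end.

(* With this predicate, LTT, LTC, LCT, LCC are the linear contexts of type
   [ctx Tm Tm], [ctx Cm Tm], [ctx Tm Cm], [ctx Cm Cm] respectively. *)
Fixpoint linear {h r} (K : ctx h r) : Prop :=
  match K with
  | CTHole | CCHole => True
  | CAppL K _ | CLam K | CMu K | CESubL K _ | CNam _ K | CRepL K _ _ => linear K
  | _ => False
  end.

(* Side conditions.  In a rule below, every metavariable lives in the scope of
   one of the two sides, and occurs renamed on the other side:
   - "x does not occur in o" : [o] lives outside the binder of x, and occurs
     under it as [ren S id_ o]; likewise with [ren id_ S] for a name, and
     [cren] for a context;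
   - "fc (o, K)" : [o] lives outside [K], and occurs in the hole of [K] as
     [under K o]; a name [a] occurs there as [nnam K + a];
   - if a binder stands outside a context binding [n] indices, it has index [n]
     in the hole, and an expression in the hole not mentioning it occurs as
     renamed by [skip n];
   - if a binder moves from just inside the hole to just outside the context,
     the body is renamed by [rot n]: the binder gets index [n] instead of 0. *)
Definition under {h r} (K : ctx h r) {s} (o : expr s) : expr s :=
  ren (fun i => nvar K + i) (fun i => nnam K + i) o.

Definition skip (n i : nat) : nat := if i <? n then i else S i.

Definition rot (n i : nat) : nat :=
  match i with 0 => n | S j => skip n j end.

(* Exchange of the two innermost binders. *)
Definition swap (i : nat) : nat :=
  match i with 0 => 1 | 1 => 0 | _ => i end.

(* Least equivalence relation over the objects satisfying [D] which contains
   [R] and is closed under contexts; all the objects involved satisfy [D]. *)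
Inductive congruence_on (D : object -> Prop) (R : object -> object -> Prop) :
    object -> object -> Prop :=
| cong_rule (o p : object) : D o -> D p -> R o p -> congruence_on D R o p
| cong_refl (o : object) : D o -> congruence_on D R o o
| cong_sym (o p : object) : congruence_on D R o p -> congruence_on D R p o
| cong_trans (o p q : object) :
    congruence_on D R o p -> congruence_on D R p q -> congruence_on D R o q
| cong_ctx h r (K : ctx h r) (o p : expr h) :
    congruence_on D R o p -> D (plug K o) -> D (plug K p) ->
    congruence_on D R (plug K o) (plug K p).

Inductive tau_rule : object -> object -> Prop :=
(* (\y.\x.t) v ~ \x.(\y.t) v *)
| tau_lam_lam (t v : expr Tm) :
    tau_rule (App (Lam (Lam t)) v)
             (Lam (App (Lam (ren swap id_ t)) (ren S id_ v)))
(* (\x.t v) u ~ (\x.t) u v *)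
| tau_app_lam (t v u : expr Tm) :
    tau_rule (App (Lam (App t (ren S id_ v))) u)
             (App (App (Lam t) u) v)
(* (\x.mu a.[b]t) u ~ mu a.[b](\x.t) u; b may be a *)
| tau_lam_mu (b : nat) (t u : expr Tm) :
    tau_rule (App (Lam (Mu (Nam b t))) u)
             (Mu (Nam b (App (Lam t) (ren id_ S u))))
(* [a'](mu a.[b'](mu b.c) v) u ~ [b'](mu b.[a'](mu a.c) u) v *)
| tau_app_app (a' b' : nat) (c : expr Cm) (u v : expr Tm) :
    tau_rule (Nam a' (App (Mu (Nam (S b') (App (Mu c) (ren id_ S v)))) u))
             (Nam b' (App (Mu (Nam (S a') (App (Mu (ren id_ swap c))
                                               (ren id_ S u)))) v))
(* [a'](mu a.[b']\y.mu b.c) u ~ [b']\y.mu b.[a'](mu a.c) u *)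
| tau_app_pop (a' b' : nat) (c : expr Cm) (u : expr Tm) :
    tau_rule (Nam a' (App (Mu (Nam (S b') (Lam (Mu c)))) u))
             (Nam b' (Lam (Mu (Nam (S a') (App (Mu (ren id_ swap c))
                                               (ren S S u))))))
(* [a']\x.mu a.[b']\y.mu b.c ~ [b']\y.mu b.[a']\x.mu a.c *)
| tau_pop_pop (a' b' : nat) (c : expr Cm) :
    tau_rule (Nam a' (Lam (Mu (Nam (S b') (Lam (Mu c))))))
             (Nam b' (Lam (Mu (Nam (S a') (Lam (Mu (ren swap swap c)))))))
(* mu a.[a]t ~ t *)
| tau_theta (t : expr Tm) :
    tau_rule (Mu (Nam 0 (ren id_ S t))) t
(* [a']mu a.[b']mu b.c ~ [b']mu b.[a']mu a.c *)
| tau_mu_mu (a' b' : nat) (c : expr Cm) :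
    tau_rule (Nam a' (Mu (Nam (S b') (Mu c))))
             (Nam b' (Mu (Nam (S a') (Mu (ren id_ swap c)))))
(* [a']mu a.[b']\y.mu b.c ~ [b']\y.mu b.[a']mu a.c *)
| tau_mu_pop (a' b' : nat) (c : expr Cm) :
    tau_rule (Nam a' (Mu (Nam (S b') (Lam (Mu c)))))
             (Nam b' (Lam (Mu (Nam (S a') (Mu (ren id_ swap c))))))
(* [a']mu a.[b'](mu b.c) v ~ [b'](mu b.[a']mu a.c) v *)
| tau_mu_app (a' b' : nat) (c : expr Cm) (v : expr Tm) :
    tau_rule (Nam a' (Mu (Nam (S b') (App (Mu c) (ren id_ S v)))))
             (Nam b' (App (Mu (Nam (S a') (Mu (ren id_ swap c)))) v)).

Definition tau_equiv : object -> object -> Prop :=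
  congruence_on lambda_mu tau_rule.

Inductive plain_rule : object -> object -> Prop :=
(* L<\x.t> u -> L<t[x\u]> *)
| rule_dB (L : ctx Tm Tm) (t u : expr Tm) :
    subst_ctx L ->
    plain_rule (App (plug L (Lam t)) u)
               (plug L (ESub t (under L u)))
(* L<mu a.c> u -> L<mu a'.c[[a\^a' u]]>; on the right, c is under a' and a *)
| rule_dM (L : ctx Tm Tm) (c : expr Cm) (u : expr Tm) :
    subst_ctx L ->
    plain_rule (App (plug L (Mu c)) u)
               (plug L (Mu (Rep (ren id_ (up S) c) 0
                                (One (ren id_ S (under L u))))))
(* K<[a]t>[[a\^a' s]] -> K<[a'](t::s)> *)
| rule_N (K : ctx Cm Cm) (t : expr Tm) (a' : nat) (s : expr St) :
    linear K ->
    plain_rule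
      (Rep (plug (cren id_ S K) (Nam (nnam K) (ren id_ (skip (nnam K)) t))) a' s)
      (plug K (Nam (nnam K + a') (app_stack t (under K s))))
(* K<c[[b\^a s']]>[[a\^a' s]] -> K<c[[b\^a' s'.s]]> *)
| rule_C (K : ctx Cm Cm) (c : expr Cm) (s' : expr St) (a' : nat) (s : expr St) :
    linear K ->
    plain_rule
      (Rep (plug (cren id_ S K)
                 (Rep (ren id_ (up (skip (nnam K))) c) (nnam K)
                      (ren id_ (skip (nnam K)) s'))) a' s)
      (plug K (Rep c (nnam K + a') (stack_cat s' (under K s)))).

Inductive plain_step : object -> object -> Prop :=
| plain_step_ctx h r (K : ctx h r) (o p : expr h) :
    plain_rule o p -> plain_step (plug K o) (plug K p).

Definition plain_form (o : object) : Prop := forall p, ~ plain_step o p.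

Definition plain_nf_of (o p : object) : Prop :=
  clos_refl_trans object plain_step o p /\ plain_form p.

(* The normal form of [o]: it exists and is unique because plain reduction is
   terminating and confluent. *)
Definition plain_nf (o : object) : object :=
  epsilon (inhabits o) (plain_nf_of o).

Inductive struct_rule : object -> object -> Prop :=
(* K<t>[x\u] ~ K<t[x\u]> *)
| struct_sub (K : ctx Tm Tm) (t u : expr Tm) :
    linear K ->
    struct_rule (ESub (plug (cren S id_ K) (ren (rot (nvar K)) id_ t)) u)
                (plug K (ESub t (under K u)))
(* K<c>[[a\^a' s]] ~ K<c[[a\^a' s]]> *)
| struct_rep (K : ctx Cm Cm) (c : expr Cm) (a' : nat) (s : expr St) :
    linear K ->
    struct_rule (Rep (plug (cren id_ S K) (ren id_ (rot (nnam K)) c)) a' s)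
                (plug K (Rep c (nnam K + a') (under K s)))
(* [b]mu a.K<c> ~ K<[b]mu a.c> *)
| struct_mu (K : ctx Cm Cm) (b : nat) (c : expr Cm) :
    linear K ->
    struct_rule (Nam b (Mu (plug (cren id_ S K) (ren id_ (rot (nnam K)) c))))
                (plug K (Nam (nnam K + b) (Mu c)))
(* [a']\x.mu a.[b']\y.mu b.c ~ [b']\y.mu b.[a']\x.mu a.c *)
| struct_pop_pop (a' b' : nat) (c : expr Cm) :
    struct_rule (Nam a' (Lam (Mu (Nam (S b') (Lam (Mu c))))))
                (Nam b' (Lam (Mu (Nam (S a') (Lam (Mu (ren swap swap c)))))))
(* mu a.[a]t ~ t *)
| struct_theta (t : expr Tm) :
    struct_rule (Mu (Nam 0 (ren id_ S t))) t.

Definition struct_equiv : object -> object -> Prop :=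
  congruence_on plain_form struct_rule.

(* Main.v *)
(* Expanding [t[x\u]] to [(\x.t) u] and [c[[a\a' s]]] to [[a'](mu a.c) :: s] turns
   plain steps and structural rules into tau-equivalences and fixes the lambda-mu
   objects, so structurally equivalent normal forms come from tau-equivalent
   objects.

   Conversely, every object has a spine leading to its head variable, and plain
   reduction neither duplicates nor erases names, nor moves them between the spine
   and the arguments.  Whether a replacement [c[[a\a' s]]] will be contracted is
   thus known in advance: this happens if and only if [a] occurs exactly once in
   [c], on the spine.  Hence plain forms are computed by a compositional evaluator,
   whose environment stores the arguments awaiting the names.  Call two objects
   equivalent if their values in all environments are structurally equivalent: by
   construction this is a congruence, it contains the structural rules without
   restriction to plain forms and the plain rules, and therefore the tau rules.
   Since a plain form is structurally equivalent to its value, all normal forms of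
   tau-equivalent objects are structurally equivalent; confluence is not needed. *)

Require Import Defs.
From Stdlib Require Import Arith Lia List Bool Wf_nat Relations.
From Stdlib Require Import FunctionalExtensionality ClassicalEpsilon.
Import ListNotations.

(** The structural rules pass to values because a linear context [K] evaluates to a linear context
    [K'] that is the same for both sides of a rule: it depends on the filler only through
    occurrences of names bound by [K]. Comparing occurrences is therefore part of the equivalence
    [approx]. The values then either coincide, when the moved replacement is contracted, or are
    related by the same rule for [K'], except that [[b]mu a.K<c>] may leave a blocked replacement
    that has to be moved as well. The exchange of two abstractions is the exception: if an argument
    awaits the outer name, the abstraction turns into a substitution and the values are no longer an
    instance of the rule. This argument lives in the target scope, so it is first written back into
    the source; a derived law for substitutions then applies. For expansions, the obstacle is that
    the tau rules move a [mu] with at most one argument, whereas a replacement carries a whole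
    stack. Theta names the intermediate applications, so that the arguments cross one after the
    other. *)

Ltac fext := apply functional_extensionality; intros [|]; reflexivity.

(** * Renaming calculus *)

Lemma up_id : up id_ = id_.
Proof. fext. Qed.

Lemma up_comp f g : (fun i => up f (up g i)) = up (fun i => f (g i)).
Proof. fext. Qed.

Lemma ren_id s (o : expr s) : ren id_ id_ o = o.
Proof. induction o; simpl; rewrite ?up_id; f_equal; auto. Qed.

Lemma ren_ren s (o : expr s) f g f' g' :
  ren f g (ren f' g' o) = ren (fun i => f (f' i)) (fun i => g (g' i)) o.
Proof.
  revert f g f' g'; induction o; intros; simpl;
  rewrite ?IHo, ?IHo1, ?IHo2, ?up_comp; reflexivity.
Qed.

Lemma ren_ext s (o : expr s) f g f' g' :
  (forall i, f i = f' i) -> (forall i, g i = g' i) -> ren f g o = ren f' g' o.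
Proof.
  intros Hf Hg. apply functional_extensionality in Hf, Hg. now subst.
Qed.

Lemma map_ren_ren f g f' g' (l : list (expr Tm)) :
  map (ren f g) (map (ren f' g') l) = map (ren (fun i => f (f' i)) (fun i => g (g' i))) l.
Proof. rewrite map_map. apply map_ext. intro; apply ren_ren. Qed.

Lemma map_ren_ext f g f' g' (l : list (expr Tm)) :
  (forall i, f i = f' i) -> (forall i, g i = g' i) -> map (ren f g) l = map (ren f' g') l.
Proof.
  intros Hf Hg. apply functional_extensionality in Hf, Hg. now subst.
Qed.

Lemma map_ren_id (l : list (expr Tm)) : map (ren id_ id_) l = l.
Proof. rewrite <- (map_id l) at 2. apply map_ext. intro; apply ren_id. Qed.

(** The [n]-fold iterate of [up] in closed form: the renaming seen below [n] binders of one kind. *)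
Definition upn (n : nat) (f : nat -> nat) (i : nat) : nat :=
  if i <? n then i else n + f (i - n).

Lemma upn_0 f : upn 0 f = f.
Proof. apply functional_extensionality; intro i; unfold upn; simpl; f_equal; lia. Qed.

Lemma upn_S n f : upn (S n) f = upn n (up f).
Proof.
  apply functional_extensionality; intro i; unfold upn.
  destruct (Nat.ltb_spec i (S n)), (Nat.ltb_spec i n); try lia.
  - replace (i - n) with 0 by lia. simpl; lia.
  - replace (i - n) with (S (i - S n)) by lia. simpl; lia.
Qed.

Lemma upn_id n : upn n id_ = id_.
Proof.
  apply functional_extensionality; intro i; unfold upn, id_.
  destruct (Nat.ltb_spec i n); lia.
Qed.

Lemma skip_upn n : skip n = upn n S.
Proof.
  apply functional_extensionality; intro i; unfold upn, skip.
  destruct (Nat.ltb_spec i n); lia.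
Qed.

Lemma upn_add n f i : upn n f (n + i) = n + f i.
Proof.
  unfold upn. destruct (Nat.ltb_spec (n + i) n); [lia|]. do 2 f_equal; lia.
Qed.

Lemma rot_0 : rot 0 = id_.
Proof. fext. Qed.

Lemma rot_1 : rot 1 = swap.
Proof. apply functional_extensionality; intros [|[|i]]; reflexivity. Qed.

Lemma ren_plug f g h r (K : ctx h r) (o : expr h) :
  ren f g (plug K o) = plug (cren f g K) (ren (upn (nvar K) f) (upn (nnam K) g) o).
Proof.
  revert f g; induction K; intros; simpl; rewrite ?upn_0, ?upn_S; f_equal; auto.
Qed.

Lemma cren_id h r (K : ctx h r) : cren id_ id_ K = K.
Proof.
  induction K; simpl; rewrite ?up_id, ?ren_id; f_equal; auto.
Qed.

Lemma cren_cren h r (K : ctx h r) f g f' g' :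
  cren f g (cren f' g' K) = cren (fun i => f (f' i)) (fun i => g (g' i)) K.
Proof.
  revert f g f' g'; induction K; intros; simpl; rewrite ?IHK, ?ren_ren, ?up_comp; reflexivity.
Qed.

Lemma nvar_cren h r (K : ctx h r) f g : nvar (cren f g K) = nvar K.
Proof. revert f g; induction K; intros; simpl; auto. Qed.

Lemma nnam_cren h r (K : ctx h r) f g : nnam (cren f g K) = nnam K.
Proof. revert f g; induction K; intros; simpl; auto. Qed.

Lemma linear_cren h r (K : ctx h r) f g : linear K -> linear (cren f g K).
Proof. revert f g; induction K; intros; simpl in *; auto. Qed.

(** * Weighted occurrences of names *)

(** Weights below a name binder: the bound name gets 0, so that only free names count. *)
Definition zcons (W : nat -> nat) (n : nat) : nat := match n with 0 => 0 | S j => W j end.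

(* Free names on the spine (the path to the head variable) are weighted by [W],
   the others by [V], with a factor at least 2.  With [W = V = delta n], the weight
   is thus 0 if and only if [n] is fresh, and 1 if and only if [n] occurs once
   and in linear position, as in the redexes N and C. *)
Fixpoint weight (W V : nat -> nat) {s} (o : expr s) : nat :=
  match o with
  | Var _ => 0
  | App t u => weight W V t + 2 * weight V V u
  | Lam t => weight W V t
  | Mu c => weight (zcons W) (zcons V) c
  | ESub t u => weight W V t + 2 * weight V V u
  | Nam a t => W a + weight W V t
  | Rep c a s => weight (zcons W) (zcons V) c + W a + 2 * weight V V s
  | One t => weight V V t
  | Push t s => weight V V t + weight V V s
  end.

Definition delta (n k : nat) : nat := if k =? n then 1 else 0.
Definition occ (n : nat) {s} (o : expr s) : nat := weight (delta n) (delta n) o.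

Lemma zcons_dl n : zcons (delta n) = delta (S n).
Proof. fext. Qed.

Lemma zcons_up W g : (fun i => zcons W (up g i)) = zcons (fun i => W (g i)).
Proof. fext. Qed.

Lemma weight_ren W V f g s (o : expr s) :
  weight W V (ren f g o) = weight (fun i => W (g i)) (fun i => V (g i)) o.
Proof.
  revert W V f g; induction o; intros; simpl; rewrite ?IHo, ?IHo1, ?IHo2, ?zcons_up; reflexivity.
Qed.

Lemma weight_ext W V W' V' s (o : expr s) :
  (forall i, W i = W' i) -> (forall i, V i = V' i) -> weight W V o = weight W' V' o.
Proof.
  intros HW HV. apply functional_extensionality in HW, HV. now subst.
Qed.

Lemma weight_0 W V s (o : expr s) : (forall i, W i = 0) -> (forall i, V i = 0) -> weight W V o = 0.
Proof.
  assert (Hz : forall W, (forall i, W i = 0) -> forall i, zcons W i = 0)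
    by (intros ? H [|i]; simpl; auto).
  revert W V; induction o; intros; simpl; rewrite ?IHo, ?IHo1, ?IHo2 by auto; rewrite ?H; auto.
Qed.

Lemma weight_add W V W' V' s (o : expr s) :
  weight (fun i => W i + W' i) (fun i => V i + V' i) o = weight W V o + weight W' V' o.
Proof.
  assert (Hz : forall W W', zcons (fun i => W i + W' i) = fun i => zcons W i + zcons W' i)
    by (intros; fext).
  revert W V W' V'; induction o; intros; simpl; rewrite ?Hz, ?IHo, ?IHo1, ?IHo2; lia.
Qed.

Lemma occ_ren_up f g c : occ 0 (@ren f (up g) Cm c) = occ 0 c.
Proof. unfold occ. rewrite weight_ren. apply weight_ext; intros [|i]; reflexivity. Qed.

Lemma occ_S n f s (o : expr s) : occ (S n) (ren f S o) = occ n o.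
Proof. unfold occ. now rewrite weight_ren. Qed.

Lemma occ_0_S f s (o : expr s) : occ 0 (ren f S o) = 0.
Proof. unfold occ. rewrite weight_ren. apply weight_0; reflexivity. Qed.

Lemma zcons_mul x W : zcons (fun i => x * W i) = fun i => x * zcons W i.
Proof. apply functional_extensionality; intros [|i]; simpl; lia. Qed.

Lemma weight_mul_0 x y W V s (o : expr s) :
  weight W V o = 0 -> weight (fun i => x * W i) (fun i => y * V i) o = 0.
Proof.
  revert x y W V; induction o; intros x y W V H; simpl in *; rewrite ?zcons_mul;
  rewrite ?IHo, ?IHo1, ?IHo2 by lia; try lia.
Qed.

(** A total of 1 leaves no room for the factor 2 that arguments receive, so the whole weight comes
    from [W] on the spine and scales with [x] alone. Stacks are excluded because their terms are
    weighted by [V] with factor 1. *)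
Lemma weight_mul_1 x y W V s (o : expr s) :
  s <> St -> weight W V o = 1 -> weight (fun i => x * W i) (fun i => y * V i) o = x.
Proof.
  revert x y W V; induction o; intros x y W V Hs H; simpl in *; rewrite ?zcons_mul;
  try congruence.
  - rewrite IHo1, weight_mul_0 by (congruence || lia). lia.
  - apply IHo; congruence.
  - apply IHo; congruence.
  - rewrite IHo1, weight_mul_0 by (congruence || lia). lia.
  - destruct (W n) as [|[|]] eqn:E; [|rewrite weight_mul_0 by lia|]; try lia.
    rewrite IHo by (congruence || lia). lia.
  - rewrite (weight_mul_0 _ _ _ _ _ o2) by lia.
    destruct (W n) as [|[|]] eqn:E; [|rewrite weight_mul_0 by lia|]; try lia.
    rewrite IHo1 by (congruence || lia). lia.
Qed.

(** * Evaluation to plain forms *)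

Definition env := nat -> nat * list (expr Tm).

Definition pren (F G : nat -> nat) (p : nat * list (expr Tm)) : nat * list (expr Tm) :=
  (G (fst p), map (ren F G) (snd p)).

Definition env_cons (p : nat * list (expr Tm)) (g : env) : env :=
  fun n => match n with 0 => p | S j => g j end.
Definition env_S_var (g : env) : env := fun n => pren S id_ (g n).
Definition env_S_nam (g : env) : env := fun n => pren id_ S (g n).
(** Environment for arguments and stacks. [eval] stores a non-empty list only for a name that occurs
    once, on the spine, so no stored argument is lost here. *)
Definition drop (g : env) : env := fun n => (fst (g n), []).
Definition env_id : env := fun n => (n, []).

Fixpoint apps (t : expr Tm) (l : list (expr Tm)) : expr Tm :=
  match l with
  | [] => t
  | u :: l' => apps (App t u) l'
  end.

Fixpoint stl {s} (o : expr s) : list (expr Tm) :=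
  match o with
  | One t => [t]
  | Push t s => t :: stl s
  | _ => []
  end.

(* Stacks are non-empty: the value at [[]] is a closed dummy. *)
Fixpoint mkst (l : list (expr Tm)) : expr St :=
  match l with
  | [] => One (Lam (Var 0))
  | u :: l' => match l' with [] => One u | _ => Push u (mkst l') end
  end.

Definition isnil {A} (l : list A) : bool := match l with [] => true | _ => false end.
Definition lin0 (c : expr Cm) : bool := occ 0 c =? 1.

(* [eval o f g l] is a plain form of [o] applied to the list [l], in which the
   free variables are renamed by [f], every free name [n] is renamed to
   [fst (g n)], and moreover every [[n]t] on the spine becomes
   [[fst (g n)] (t :: snd (g n))]. *)
Fixpoint eval {s} (o : expr s) (f : nat -> nat) (g : env) (l : list (expr Tm)) : expr s :=
  match o in expr s return expr s with
  | Var i => apps (Var (f i)) l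
  | App t u => eval t f g (eval u f (drop g) [] :: l)
  | Lam t =>
      match l with
      | [] => Lam (eval t (up f) (env_S_var g) [])
      | u :: l' => ESub (eval t (up f) (env_S_var g) (map (ren S id_) l')) u
      end
  | Mu c =>
      if isnil l || lin0 c then Mu (eval c f (env_cons (0, map (ren id_ S) l) (env_S_nam g)) [])
      else Mu (Rep (eval c f (env_cons (0, []) (env_S_nam (env_S_nam g))) []) 0 (mkst (map (ren id_ S) l)))
  | ESub t u => ESub (eval t (up f) (env_S_var g) (map (ren S id_) l)) (eval u f (drop g) [])
  | Nam a t => Nam (fst (g a)) (eval t f g (snd (g a)))
  | Rep c a s =>
      let l' := stl (eval s f (drop g) []) ++ snd (g a) in
      if lin0 c then eval c f (env_cons (fst (g a), l') g) []
      else Rep (eval c f (env_cons (0, []) (env_S_nam g)) []) (fst (g a)) (mkst l')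
  | One t => One (eval t f (drop g) [])
  | Push t s => Push (eval t f (drop g) []) (eval s f (drop g) [])
  end.

Lemma lin0_ren_up f g c : lin0 (ren f (up g) c) = lin0 c.
Proof. unfold lin0. now rewrite occ_ren_up. Qed.

Lemma pren_ext F G F' G' p :
  (forall i, F i = F' i) -> (forall i, G i = G' i) -> pren F G p = pren F' G' p.
Proof. intros HF HG. apply functional_extensionality in HF, HG. now subst. Qed.

Lemma pren_pren F G F' G' p :
  pren F G (pren F' G' p) = pren (fun i => F (F' i)) (fun i => G (G' i)) p.
Proof. unfold pren; simpl. now rewrite map_ren_ren. Qed.

Lemma pren_id p : pren id_ id_ p = p.
Proof. unfold pren; rewrite map_ren_id. now destruct p. Qed.

Lemma eval_ext s (o : expr s) f g l f' g' l' :
  (forall i, f i = f' i) -> (forall i, g i = g' i) -> l = l' -> eval o f g l = eval o f' g' l'.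
Proof. intros HF HG ->. apply functional_extensionality in HF, HG. now subst. Qed.

Lemma eval_cm s (o : expr s) f g l : s <> Tm -> eval o f g l = eval o f g [].
Proof. destruct o; intros; congruence || reflexivity. Qed.

Lemma eval_ren s (o : expr s) p q f g l :
  eval (ren p q o) f g l = eval o (fun i => f (p i)) (fun i => g (q i)) l.
Proof.
  assert (Hc : forall x (g : env) q, (fun i => env_cons x g (up q i)) = env_cons x (fun i => g (q i)))
    by (intros; fext).
  revert p q f g l; induction o; intros; simpl; rewrite ?lin0_ren_up, ?IHo, ?IHo1, ?IHo2, ?up_comp, ?Hc;
    try reflexivity.
  destruct l; rewrite ?IHo, ?up_comp; reflexivity.
Qed.

Lemma map_ren_up p q (l : list (expr Tm)) :
  map (ren (up p) q) (map (ren S id_) l) = map (ren S id_) (map (ren p q) l).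
Proof. rewrite !map_ren_ren. reflexivity. Qed.

Lemma map_ren_up' p q (l : list (expr Tm)) :
  map (ren p (up q)) (map (ren id_ S) l) = map (ren id_ S) (map (ren p q) l).
Proof. rewrite !map_ren_ren. reflexivity. Qed.

Lemma ren_apps p q t l : ren p q (apps t l) = apps (ren p q t) (map (ren p q) l).
Proof. revert t; induction l; intros; simpl; [|rewrite IHl]; reflexivity. Qed.

Lemma ren_mkst p q l : ren p q (mkst l) = mkst (map (ren p q) l).
Proof. induction l as [|u [|v l] IH]; simpl in *; congruence. Qed.

Lemma stl_ren p q s (o : expr s) : stl (ren p q o) = map (ren p q) (stl o).
Proof. induction o; simpl; congruence. Qed.

Lemma isnil_map {A B} (h : A -> B) l : isnil (map h l) = isnil l.
Proof. now destruct l. Qed.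

Lemma env_S_var_up p q g : (fun i => pren (up p) q (env_S_var g i)) = env_S_var (fun i => pren p q (g i)).
Proof. apply functional_extensionality; intro. unfold env_S_var. now rewrite !pren_pren. Qed.

Lemma env_S_nam_up p q g : (fun i => pren p (up q) (env_S_nam g i)) = env_S_nam (fun i => pren p q (g i)).
Proof. apply functional_extensionality; intro. unfold env_S_nam. now rewrite !pren_pren. Qed.

Lemma env_cons_pren p q x g : (fun i => pren p q (env_cons x g i)) = env_cons (pren p q x) (fun i => pren p q (g i)).
Proof. fext. Qed.

(** Dual to [eval_ren], and again an equality: the branches of [eval] test only the source and the
    emptiness of [l], neither of which changes when the target is renamed. *)
Lemma ren_eval s (o : expr s) p q f g l :
  ren p q (eval o f g l) =
  eval o (fun i => p (f i)) (fun i => pren p q (g i)) (map (ren p q) l).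
Proof.
  assert (Hd : forall p q g, (fun i => pren p q (drop g i)) = drop (fun i => pren p q (g i)))
    by reflexivity.
  revert p q f g l; induction o; intros; simpl.
  - apply ren_apps.
  - now rewrite IHo1; simpl; rewrite IHo2.
  - destruct l; simpl; rewrite IHo, env_S_var_up, up_comp, ?map_ren_up; reflexivity.
  - rewrite isnil_map. destruct (isnil l || lin0 o); simpl;
      rewrite IHo, env_cons_pren, !env_S_nam_up, ?ren_mkst; unfold pren at 1; simpl; rewrite ?map_ren_up'; reflexivity.
  - now rewrite IHo1, IHo2, env_S_var_up, up_comp, map_ren_up.
  - now rewrite IHo.
  - destruct (lin0 o1); simpl; rewrite IHo1, env_cons_pren, ?env_S_nam_up, ?ren_mkst;
      unfold pren at 1; simpl; rewrite map_app, <- stl_ren, IHo2; reflexivity.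
  - now rewrite IHo.
  - now rewrite IHo1, IHo2.
Qed.

Definition occ_sum (m : nat) (l : list (expr Tm)) : nat := list_sum (map (occ m) l).

Lemma occ_sum_nil m : occ_sum m [] = 0.
Proof. reflexivity. Qed.

Lemma occ_sum_cons m u l : occ_sum m (u :: l) = occ m u + occ_sum m l.
Proof. reflexivity. Qed.

Lemma occ_sum_app m l l' : occ_sum m (l ++ l') = occ_sum m l + occ_sum m l'.
Proof. unfold occ_sum. now rewrite map_app, list_sum_app. Qed.

Lemma occ_sum_S m f l : occ_sum (S m) (map (ren f S) l) = occ_sum m l.
Proof. unfold occ_sum. rewrite map_map. f_equal. apply map_ext. intro; apply occ_S. Qed.

Lemma occ_sum_ren_id m f l : occ_sum m (map (ren f id_) l) = occ_sum m l.
Proof. unfold occ_sum. rewrite map_map. f_equal. apply map_ext. intro; unfold occ; now rewrite weight_ren. Qed.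

Lemma weight_apps W V t l : weight W V (apps t l) = weight W V t + 2 * list_sum (map (weight V V) l).
Proof. revert t; induction l; intros; simpl; rewrite ?IHl; simpl; lia. Qed.

Lemma weight_mkst W V l : weight W V (mkst l) = list_sum (map (weight V V) l).
Proof. revert W; induction l as [|u [|v l] IH]; intros; simpl in *; rewrite ?IH; lia. Qed.

Lemma weight_stl W V s (o : expr s) : s = St -> weight W V o = list_sum (map (weight V V) (stl o)).
Proof. revert W V; induction o; intros; simpl; try congruence; rewrite ?IHo2; auto. Qed.

Definition ncons (x : nat) (W : nat -> nat) (n : nat) : nat :=
  match n with 0 => x | S j => W j end.

(** Name 0 occurs once, on the spine, so the entry it receives counts once, with its spine weight
    [x]. This computes weights in an environment extended at a contracted binder. *)
Lemma weight_ncons x y W V s (o : expr s) :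
  s <> St -> occ 0 o = 1 -> weight (ncons x W) (ncons y V) o = x + weight (zcons W) (zcons V) o.
Proof.
  intros Hs H.
  transitivity (weight (fun i => x * delta 0 i) (fun i => y * delta 0 i) o + weight (zcons W) (zcons V) o).
  - rewrite <- weight_add. apply weight_ext; intros [|i]; unfold delta; simpl; lia.
  - now rewrite weight_mul_1.
Qed.

Lemma occ_App m t u : occ m (App t u) = occ m t + 2 * occ m u.
Proof. reflexivity. Qed.
Lemma occ_Lam m t : occ m (Lam t) = occ m t.
Proof. reflexivity. Qed.
Lemma occ_Mu m c : occ m (Mu c) = occ (S m) c.
Proof. unfold occ; simpl. now rewrite zcons_dl. Qed.
Lemma occ_ESub m t u : occ m (ESub t u) = occ m t + 2 * occ m u.
Proof. reflexivity. Qed.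
Lemma occ_Nam m a t : occ m (Nam a t) = delta m a + occ m t.
Proof. reflexivity. Qed.
Lemma occ_Rep m c a s : occ m (Rep c a s) = occ (S m) c + delta m a + 2 * occ m s.
Proof. unfold occ; simpl. now rewrite zcons_dl. Qed.
Lemma occ_One m t : occ m (One t) = occ m t.
Proof. reflexivity. Qed.
Lemma occ_Push m t s : occ m (Push t s) = occ m t + occ m s.
Proof. reflexivity. Qed.
Lemma occ_mkst m l : occ m (mkst l) = occ_sum m l.
Proof. apply weight_mkst. Qed.

(** Each spine occurrence of a name receives the whole list awaiting it, as arguments or as part of
    a stack, whence the factor 2; other occurrences are only renamed. The main use is [occ_0_eval]:
    the contraction test gives the same answer before and after evaluation. *)
Lemma occ_eval m s (o : expr s) f g l :
  occ m (eval o f g l) =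
  weight (fun k => delta m (fst (g k)) + 2 * occ_sum m (snd (g k))) (fun k => delta m (fst (g k))) o
  + match s with Tm => 2 * occ_sum m l | _ => 0 end.
Proof.
  assert (HD : forall s (o : expr s) m g,
    weight (fun k => delta m (fst (drop g k)) + 2 * occ_sum m (snd (drop g k))) (fun k => delta m (fst (drop g k))) o
    = weight (fun k => delta m (fst (g k))) (fun k => delta m (fst (g k))) o)
    by (intros; apply weight_ext; intro; unfold drop, occ_sum; simpl; lia).
  assert (HV : forall s (o : expr s) m g,
    weight (fun k => delta m (fst (env_S_var g k)) + 2 * occ_sum m (snd (env_S_var g k))) (fun k => delta m (fst (env_S_var g k))) o
    = weight (fun k => delta m (fst (g k)) + 2 * occ_sum m (snd (g k))) (fun k => delta m (fst (g k))) o)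
    by (intros; apply weight_ext; intro; unfold env_S_var, pren; simpl; rewrite ?occ_sum_ren_id; reflexivity).
  assert (HN : forall s (o : expr s) x m g,
    weight (fun k => delta (S m) (fst (env_cons x (env_S_nam g) k)) + 2 * occ_sum (S m) (snd (env_cons x (env_S_nam g) k)))
      (fun k => delta (S m) (fst (env_cons x (env_S_nam g) k))) o
    = weight (ncons (delta (S m) (fst x) + 2 * occ_sum (S m) (snd x)) (fun k => delta m (fst (g k)) + 2 * occ_sum m (snd (g k))))
        (ncons (delta (S m) (fst x)) (fun k => delta m (fst (g k)))) o)
    by (intros; apply weight_ext; intros [|]; unfold env_S_nam, pren; simpl; rewrite ?occ_sum_S; reflexivity).
  assert (Hz : forall W, ncons 0 W = zcons W) by reflexivity.
  revert m f g l; induction o; intros; cbn [eval].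
  - unfold occ. now rewrite weight_apps.
  - rewrite IHo1, occ_sum_cons, IHo2, HD, occ_sum_nil. cbn [weight]. lia.
  - destruct l; rewrite ?occ_Lam, ?occ_ESub, IHo, HV, ?occ_sum_ren_id, ?occ_sum_cons; cbn [weight]; lia.
  - destruct (isnil l) eqn:E; [|destruct (lin0 o) eqn:E']; cbn [orb]; rewrite ?occ_Mu.
    + destruct l; [|discriminate]. cbn [map].
      rewrite IHo, HN. cbn [fst snd]. rewrite !occ_sum_nil. cbn [weight]. rewrite <- !Hz. f_equal.
    + rewrite IHo, HN, weight_ncons. cbn [fst snd weight]. rewrite occ_sum_S. unfold delta at 1; simpl. lia.
      discriminate. now apply Nat.eqb_eq.
    + rewrite occ_Rep, occ_mkst, occ_sum_S, IHo, HN.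
      cbn [fst snd weight].
      match goal with |- _ = weight ?W ?V _ + ?x =>
        transitivity (weight W V o + 0 + delta (S m) 0 + x); [|change (delta (S m) 0) with 0; lia] end.
      do 3 (apply f_equal2; [|reflexivity]).
      apply weight_ext; intros [|]; unfold env_S_nam, pren; simpl; rewrite ?occ_sum_S; reflexivity.
  - rewrite occ_ESub, IHo1, IHo2, HV, HD, occ_sum_ren_id, occ_sum_nil. cbn [weight]. lia.
  - rewrite occ_Nam, IHo. cbn [weight]. lia.
  - set (S0 := stl (eval o2 f (drop g) [])).
    assert (HS : occ_sum m S0 = weight (fun k => delta m (fst (g k))) (fun k => delta m (fst (g k))) o2).
    { rewrite <- HD, <- (Nat.add_0_r (weight _ _ o2)), <- (IHo2 m f (drop g) []).
      unfold occ at 1. now rewrite weight_stl. }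
    cbv zeta. cbn [weight]. destruct (lin0 o1) eqn:E.
    + rewrite IHo1.
      match goal with |- weight ?W ?V _ + _ = _ =>
        assert (HW : W = ncons (delta m (fst (g n)) + 2 * occ_sum m (S0 ++ snd (g n)))
           (fun k => delta m (fst (g k)) + 2 * occ_sum m (snd (g k)))) by fext;
        assert (HV' : V = ncons (delta m (fst (g n))) (fun k => delta m (fst (g k)))) by fext
      end.
      rewrite HW, HV', weight_ncons, occ_sum_app, HS; [lia|discriminate|now apply Nat.eqb_eq].
    + rewrite occ_Rep, occ_mkst, IHo1, HN, occ_sum_app, HS. cbn [fst snd]. rewrite occ_sum_nil.
      change (delta (S m) 0) with 0. change (0 + 2 * 0) with 0; change zcons with (ncons 0); cbn [weight]; change zcons with (ncons 0).
lia.
  - rewrite occ_One, IHo, HD, occ_sum_nil. cbn [weight]. lia.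
  - rewrite occ_Push, IHo1, IHo2, HD, HD, occ_sum_nil. cbn [weight]. lia.
Qed.

Lemma occ_0_eval c f g :
  occ 0 (eval c f (env_cons (0, []) (env_S_nam g)) []) = occ 0 (c : expr Cm).
Proof.
  rewrite occ_eval, Nat.add_0_r. apply weight_ext; intros [|i]; try reflexivity.
  unfold occ_sum, env_S_nam, pren; simpl. rewrite map_map.
  replace (map _ _) with (map (fun _ : expr Tm => 0) (snd (g i)))
    by (apply map_ext; intro; now rewrite occ_0_S).
  induction (snd (g i)); simpl; auto.
Qed.

(** * Plain forms *)

(** False exactly on [L<\x.t>] and [L<mu a.c>], the function parts of dB and dM redexes. *)
Fixpoint neutral {s} (o : expr s) : bool :=
  match o with
  | Lam _ | Mu _ => false
  | ESub t _ => neutral t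
  | _ => true
  end.

(** Syntactic description of normal forms: [neutral] excludes dB and dM redexes, [lin0 c = false]
    excludes N and C redexes. Agreement with [plain_form] is [plain_form_isplain]. *)
Fixpoint isplain {s} (o : expr s) : Prop :=
  match o with
  | Var _ => True
  | App t u => isplain t /\ isplain u /\ neutral t = true
  | Lam t => isplain t
  | Mu c => isplain c
  | ESub t u => isplain t /\ isplain u
  | Nam _ t => isplain t
  | Rep c _ s => isplain c /\ isplain s /\ lin0 c = false
  | One t => isplain t
  | Push t s => isplain t /\ isplain s
  end.

Lemma neutral_ren p q s (o : expr s) : neutral (ren p q o) = neutral o.
Proof. revert p q; induction o; intros; simpl; auto. Qed.

Lemma isplain_ren p q s (o : expr s) : isplain o -> isplain (ren p q o).
Proof.
  revert p q; induction o; intros p q H; simpl in *; rewrite ?lin0_ren_up, ?neutral_ren; intuition.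
Qed.

Lemma plains_ren p q (l : list (expr Tm)) : Forall isplain l -> Forall isplain (map (ren p q) l).
Proof. induction 1; simpl; auto using isplain_ren. Qed.

Lemma isplain_apps t l :
  isplain t -> neutral t = true -> Forall isplain l -> isplain (apps t l).
Proof. intros Ht Hn Hl; revert t Ht Hn; induction Hl; intros; simpl; auto. apply IHHl; simpl; auto. Qed.

Lemma isplain_mkst l : Forall isplain l -> isplain (mkst l).
Proof. induction 1 as [|u [|v l] ? ? IH]; simpl in *; auto. Qed.

Lemma plains_stl s (o : expr s) : isplain o -> Forall isplain (stl o).
Proof. induction o; simpl; intuition. Qed.

Definition plain_env (g : env) : Prop := forall n, Forall isplain (snd (g n)).

Lemma plain_env_drop g : plain_env (drop g).
Proof. intro; constructor. Qed.
Lemma plain_env_id : plain_env env_id.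
Proof. intro; constructor. Qed.
Lemma plain_env_S_var g : plain_env g -> plain_env (env_S_var g).
Proof. intros H n. apply plains_ren, H. Qed.
Lemma plain_env_S_nam g : plain_env g -> plain_env (env_S_nam g).
Proof. intros H n. apply plains_ren, H. Qed.
Lemma plain_env_cons n l g : Forall isplain l -> plain_env g -> plain_env (env_cons (n, l) g).
Proof. intros Hp H [|k]; [exact Hp|exact (H k)]. Qed.

#[local] Hint Resolve plain_env_drop plain_env_id plain_env_S_var plain_env_S_nam plain_env_cons
  plains_ren plains_stl isplain_ren isplain_mkst : plain.

(** Arguments reach a variable, become a substitution at a [Lam], or are handed to a name or to a
    replacement at a [Mu], so no dB or dM redex is built. A replacement is kept only if its name is
    not linear, and evaluation of its body preserves this. *)
Lemma plain_eval s (o : expr s) f g l :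
  plain_env g -> Forall isplain l -> isplain (eval o f g l).
Proof.
  revert f g l; induction o; intros f g l Hg Hl; simpl.
  - apply isplain_apps; simpl; auto.
  - auto with plain.
  - destruct Hl; simpl; auto with plain.
  - destruct (isnil l); [|destruct (lin0 o) eqn:E]; cbn [orb isplain]; auto 6 with plain.
    unfold lin0 in *. rewrite occ_0_eval. auto 6 with plain.
  - auto with plain.
  - auto with plain.
  - assert (Forall isplain (stl (eval o2 f (drop g) []) ++ snd (g n)))
      by (apply Forall_app; auto with plain).
    destruct (lin0 o1) eqn:E; cbn [isplain]; auto with plain.
    unfold lin0 in *. rewrite occ_0_eval. auto 6 with plain.
  - auto with plain.
  - auto with plain.
Qed.

(** * Structural equivalence and evaluation *)

Definition isplainO (o : object) : Prop := match o with Obj e => isplain e end.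
(** Structural equivalence with the inductive [isplain] in place of [plain_form]; the two domains
    are identified only at the end. *)
Definition eqv (o p : object) : Prop := congruence_on isplainO struct_rule o p.
Definition eqvl : list (expr Tm) -> list (expr Tm) -> Prop := Forall2 (fun t u : expr Tm => eqv t u).

(* Contexts have no hole of sort [St], so stacks are compared term by term. *)
Definition beq (o p : object) : Prop :=
  match o, p with
  | @Obj s a, @Obj s' b =>
      s = s' /\ match s with St => eqvl (stl a) (stl b) | _ => eqv a b end
  end.

Lemma upn_upn n f g i : upn n f (upn n g i) = upn n (fun i => f (g i)) i.
Proof.
  unfold upn at 2 3. destruct (Nat.ltb_spec i n) as [H|H].
  - unfold upn. now destruct (Nat.ltb_spec i n); [|lia].
  - apply upn_add.
Qed.

Lemma upn_rot n f i : upn n (up f) (rot n i) = rot n (up (upn n f) i).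
Proof.
  destruct i as [|i]; simpl; rewrite ?skip_upn, ?upn_upn; [|reflexivity].
  rewrite <- (Nat.add_0_r n) at 2. rewrite upn_add. simpl; lia.
Qed.

Lemma upn_swap f i : up (up f) (swap i) = swap (up (up f) i).
Proof. now destruct i as [|[|i]]. Qed.

Lemma ren_under f g h r (K : ctx h r) s (o : expr s) :
  ren (upn (nvar K) f) (upn (nnam K) g) (under K o) = under (cren f g K) (ren f g o).
Proof.
  unfold under. rewrite !ren_ren, nvar_cren, nnam_cren. apply ren_ext; intro; apply upn_add.
Qed.

Lemma cren_ext h r (K : ctx h r) f g f' g' :
  (forall i, f i = f' i) -> (forall i, g i = g' i) -> cren f g K = cren f' g' K.
Proof.
  intros Hf Hg. apply functional_extensionality in Hf, Hg. now subst.
Qed.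

Lemma rule_conv s (R : object -> object -> Prop) (o p o' p' : expr s) :
  R o' p' -> o = o' -> p = p' -> R o p.
Proof. now intros ? -> ->. Qed.

Definition renO (f g : nat -> nat) (o : object) : object :=
  match o with Obj e => Obj (ren f g e) end.

Lemma struct_rule_ren f g o p :
  struct_rule o p -> struct_rule (renO f g o) (renO f g p).
Proof.
  destruct 1 as [K t u HK|K c a s HK|K b c HK| |]; cbn [renO].
  - eapply rule_conv; [apply (@struct_sub (cren f g K)
      (ren (up (upn (nvar K) f)) (upn (nnam K) g) t) (ren f g u)); now apply linear_cren| |].
    + simpl. rewrite ren_plug, nvar_cren, !cren_cren, !ren_ren. f_equal. f_equal.
      rewrite ?nvar_cren, ?nnam_cren. apply ren_ext; intro; [apply upn_rot|reflexivity].
    + rewrite ren_plug. simpl. now rewrite ren_under.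
  - eapply rule_conv; [apply (@struct_rep (cren f g K)
      (ren (upn (nvar K) f) (up (upn (nnam K) g)) c) (g a) (ren f g s)); now apply linear_cren| |].
    + simpl. rewrite ren_plug, nnam_cren, !cren_cren, !ren_ren. f_equal. f_equal.
      rewrite ?nvar_cren, ?nnam_cren. apply ren_ext; intro; [reflexivity|apply upn_rot].
    + rewrite ren_plug. simpl. now rewrite ren_under, upn_add, nnam_cren.
  - eapply rule_conv; [apply (@struct_mu (cren f g K) (g b)
      (ren (upn (nvar K) f) (up (upn (nnam K) g)) c)); now apply linear_cren| |].
    + simpl. rewrite ren_plug, nnam_cren, !cren_cren, !ren_ren. do 3 f_equal.
      rewrite ?nvar_cren, ?nnam_cren. apply ren_ext; intro; [reflexivity|apply upn_rot].
    + rewrite ren_plug. simpl. now rewrite upn_add, nnam_cren.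
  - eapply rule_conv; [apply (@struct_pop_pop (g a') (g b') (ren (up (up f)) (up (up g)) c))| |].
    + reflexivity.
    + simpl. rewrite !ren_ren. do 6 f_equal. apply ren_ext; apply upn_swap.
  - eapply rule_conv; [apply (@struct_theta (ren f g t))| |].
    + simpl. rewrite !ren_ren. reflexivity.
    + reflexivity.
Qed.

Lemma eqv_plain o p : eqv o p -> isplainO o /\ isplainO p.
Proof. induction 1; tauto. Qed.

Lemma eqv_refl s (o : expr s) : isplain o -> eqv o o.
Proof. exact (@cong_refl isplainO struct_rule (Obj o)). Qed.

Lemma eqv_sym o p : eqv o p -> eqv p o.
Proof. apply cong_sym. Qed.

Lemma eqv_trans o p q : eqv o p -> eqv p q -> eqv o q.
Proof. apply cong_trans. Qed.

Lemma eqv_ctx h r (K : ctx h r) (o p : expr h) :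
  eqv o p -> isplain (plug K o) -> isplain (plug K p) -> eqv (plug K o) (plug K p).
Proof. intros; apply cong_ctx; auto. Qed.

Lemma eqv_rule s (o p : expr s) : struct_rule o p -> isplain o -> isplain p -> eqv o p.
Proof. intros; apply cong_rule; auto. Qed.

Lemma eqv_ren f g o p : eqv o p -> eqv (renO f g o) (renO f g p).
Proof.
  assert (HD : forall f g o, isplainO o -> isplainO (renO f g o)).
  { intros ? ? [s e]. apply isplain_ren. }
  intro H; revert f g; induction H; intros f g.
  - apply cong_rule; auto using struct_rule_ren.
  - apply cong_refl; auto.
  - apply eqv_sym; apply IHcongruence_on.
  - eapply eqv_trans; eauto.
  - pose proof (HD f g _ H0). pose proof (HD f g _ H1). simpl in *.
    rewrite !ren_plug in *. apply eqv_ctx; auto.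
Qed.

Lemma eqvl_ren f g l l' : eqvl l l' -> eqvl (map (ren f g) l) (map (ren f g) l').
Proof. induction 1; constructor; auto. now apply (eqv_ren f g) in H. Qed.

Lemma eqvl_refl l : Forall isplain l -> eqvl l l.
Proof. induction 1; constructor; auto using eqv_refl. Qed.

Lemma eqvl_app l1 l2 l1' l2' : eqvl l1 l1' -> eqvl l2 l2' -> eqvl (l1 ++ l2) (l1' ++ l2').
Proof. apply Forall2_app. Qed.

Lemma eqvl_plain l l' : eqvl l l' -> Forall isplain l /\ Forall isplain l'.
Proof. induction 1; split; constructor; try apply IHForall2; now apply eqv_plain in H. Qed.

Lemma eqvl_trans l1 l2 l3 : eqvl l1 l2 -> eqvl l2 l3 -> eqvl l1 l3.
Proof.
  intro H; revert l3; induction H; intros l3 H'; inversion H'; subst; constructor; eauto.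
  - eapply eqv_trans; eauto.
  - now apply IHForall2.
Qed.

Lemma eqvl_sym l1 l2 : eqvl l1 l2 -> eqvl l2 l1.
Proof. induction 1; constructor; auto using eqv_sym. Qed.

Lemma eqv_Lam (t t' : expr Tm) : eqv t t' -> eqv (Lam t) (Lam t').
Proof. intro H; destruct (eqv_plain _ _ H); now apply (eqv_ctx _ _ (CLam CTHole)). Qed.

Lemma eqv_Mu (c c' : expr Cm) : eqv c c' -> eqv (Mu c) (Mu c').
Proof. intro H; destruct (eqv_plain _ _ H); now apply (eqv_ctx _ _ (CMu CCHole)). Qed.

Lemma eqv_Nam a (t t' : expr Tm) : eqv t t' -> eqv (Nam a t) (Nam a t').
Proof. intro H; destruct (eqv_plain _ _ H); now apply (eqv_ctx _ _ (CNam a CTHole)). Qed.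

Lemma eqv_ESub (t t' u u' : expr Tm) : eqv t t' -> eqv u u' -> eqv (ESub t u) (ESub t' u').
Proof.
  intros H H'; destruct (eqv_plain _ _ H), (eqv_plain _ _ H'); apply eqv_trans with (ESub t' u).
  - now apply (eqv_ctx _ _ (CESubL CTHole u)).
  - now apply (eqv_ctx _ _ (CESubR t' CTHole)).
Qed.

Lemma eqv_App (t t' u u' : expr Tm) :
  neutral t = true -> neutral t' = true -> eqv t t' -> eqv u u' -> eqv (App t u) (App t' u').
Proof.
  intros ? ? H H'; destruct (eqv_plain _ _ H), (eqv_plain _ _ H'); apply eqv_trans with (App t' u).
  - now apply (eqv_ctx _ _ (CAppL CTHole u)).
  - now apply (eqv_ctx _ _ (CAppR t' CTHole)).
Qed.

(* The terms of the stack are replaced one at a time, [F] being a context around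
   the remaining ones. *)
Lemma eqv_mkst (F : expr St -> expr Cm) l l' :
  (forall K : ctx Tm St, exists K' : ctx Tm Cm, forall t, F (plug K t) = plug K' t) ->
  (forall s, isplain s -> isplain (F s)) ->
  eqvl l l' -> eqv (F (mkst l)) (F (mkst l')).
Proof.
  intros HF HD H. revert F HF HD. induction H as [|t u l l' Htu Hl IH]; intros.
  - apply eqv_refl, HD. simpl; auto.
  - destruct (eqv_plain _ _ Htu) as [Ht Hu], (eqvl_plain _ _ Hl) as [H1 H2].
    simpl in Ht, Hu.
    destruct Hl as [|v v' l l' Hv Hl].
    + destruct (HF (COne CTHole)) as [K' HK']. simpl in *.
      rewrite !HK'. apply eqv_ctx; auto; rewrite <- HK'; apply HD; auto.
    + set (r := mkst (v :: l)) in *. set (r' := mkst (v' :: l')) in *.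
      assert (isplain r) by now apply isplain_mkst.
      change (eqv (F (Push t r)) (F (Push u r'))).
      apply eqv_trans with (F (Push u r)).
      * destruct (HF (CPushL CTHole r)) as [K' HK']. simpl in *.
        rewrite !HK'. apply eqv_ctx; auto; rewrite <- HK'; apply HD; simpl; auto.
      * apply (IH (fun s => F (Push u s))).
        -- intro K. destruct (HF (CPushR u K)) as [K' HK']. now exists K'.
        -- intros; apply HD; simpl; auto.
Qed.

Lemma eqv_Rep (c c' : expr Cm) a s s' :
  lin0 c = false -> lin0 c' = false -> eqv c c' -> eqvl s s' ->
  eqv (Rep c a (mkst s)) (Rep c' a (mkst s')).
Proof.
  intros ? ? H H'; destruct (eqv_plain _ _ H), (eqvl_plain _ _ H').
  apply eqv_trans with (Rep c' a (mkst s)).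
  - apply (eqv_ctx _ _ (CRepL CCHole a (mkst s))); simpl; auto using isplain_mkst.
  - apply (eqv_mkst (Rep c' a)); simpl; auto.
    intro K; now exists (CRepR c' a K).
Qed.

Lemma eqv_apps (t t' : expr Tm) l l' :
  neutral t = true -> neutral t' = true -> eqv t t' -> eqvl l l' -> eqv (apps t l) (apps t' l').
Proof.
  intros Hn Hn' Ht H; revert t t' Hn Hn' Ht; induction H; intros; simpl; auto.
  apply IHForall2; auto using eqv_App.
Qed.

Lemma mkst_stl (s : expr St) : s = mkst (stl s).
Proof.
  (* The sort is generalised to make induction possible; non-emptiness is carried along because
     [mkst] treats the last term differently. *)
  enough (H : forall k (s : expr k),
    match k return expr k -> Prop with
    | St => fun s => s = mkst (stl s) /\ stl s <> []
    | _ => fun _ => True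
    end s) by apply (H St s).
  induction s0; auto; split; try discriminate; [reflexivity|].
  destruct IHs0_2 as [E H]. simpl. destruct (stl s0_2); congruence.
Qed.

Lemma beq_refl s (o : expr s) : isplain o -> beq o o.
Proof. split; [reflexivity|]. destruct s; auto using eqv_refl, eqvl_refl, plains_stl. Qed.

Lemma beq_sym o p : beq o p -> beq p o.
Proof.
  destruct o as [s o], p as [s' p]; intros [<- H]; split; auto.
  destruct s; auto using eqv_sym, eqvl_sym.
Qed.

Lemma beq_trans o p q : beq o p -> beq p q -> beq o q.
Proof.
  destruct o as [s o], p as [s' p], q as [s'' q]; intros [<- H] [<- H']; split; auto.
  destruct s; eauto using eqv_trans, eqvl_trans.
Qed.

Definition eqve (g g' : env) : Prop :=
  forall n, fst (g n) = fst (g' n) /\ eqvl (snd (g n)) (snd (g' n)).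

Lemma eqve_refl g : plain_env g -> eqve g g.
Proof. intros H n; auto using eqvl_refl. Qed.

Lemma eqve_S_var g g' : eqve g g' -> eqve (env_S_var g) (env_S_var g').
Proof. intros H n; destruct (H n) as [E E']; simpl. now rewrite E; auto using eqvl_ren. Qed.

Lemma eqve_S_nam g g' : eqve g g' -> eqve (env_S_nam g) (env_S_nam g').
Proof. intros H n; destruct (H n) as [E E']; simpl. now rewrite E; auto using eqvl_ren. Qed.

Lemma eqve_cons n l l' g g' : eqvl l l' -> eqve g g' -> eqve (env_cons (n, l) g) (env_cons (n, l') g').
Proof. intros Hl H [|k]; [simpl; auto|apply H]. Qed.

Lemma eqve_drop g g' : eqve g g' -> drop g = drop g'.
Proof.
  intro H; apply functional_extensionality; intro n; unfold drop.
  now destruct (H n) as [-> _].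
Qed.

Lemma lin0_eval c f g : lin0 (eval c f (env_cons (0, []) (env_S_nam g)) []) = lin0 c.
Proof. unfold lin0. now rewrite occ_0_eval. Qed.

(** Equivalent environments have the same names and equivalent lists the same length, so both
    evaluations take the same branches. Arguments even have equal values, since [drop] discards the
    lists. *)
Lemma eval_eqv s (o : expr s) f g g' l l' :
  eqve g g' -> eqvl l l' -> beq (eval o f g l) (eval o f g' l').
Proof.
  revert f g g' l l'; induction o; intros f g g' l l' Hg Hl; cbn [eval];
    try rewrite <- (eqve_drop _ _ Hg); try (split; [reflexivity|]).
  - apply eqv_apps; auto; apply eqv_refl; simpl; auto.
  - apply IHo1; auto. constructor; auto. apply eqv_refl, plain_eval; auto with plain.
  - destruct Hl; [apply eqv_Lam|apply eqv_ESub]; auto; apply IHo; auto using eqve_S_var, eqvl_ren.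
    constructor.
  - assert (Hn : isnil l = isnil l') by now destruct Hl.
    rewrite <- Hn. destruct (isnil l || lin0 o) eqn:E; apply eqv_Mu.
    + apply IHo; [|constructor]. auto using eqve_cons, eqve_S_nam, eqvl_ren.
    + apply orb_false_elim in E. apply eqv_Rep; rewrite ?lin0_eval; try tauto.
      * apply IHo; [|constructor]. apply eqve_cons; auto using eqve_S_nam. constructor.
      * auto using eqvl_ren.
  - apply eqv_ESub; [apply IHo1; auto using eqve_S_var, eqvl_ren|].
    apply eqv_refl, plain_eval; auto with plain.
  - destruct (Hg n) as [<- H]. apply eqv_Nam, IHo; auto.
  - destruct (Hg n) as [<- H].
    assert (Hs : eqvl (stl (eval o2 f (drop g) []) ++ snd (g n)) (stl (eval o2 f (drop g) []) ++ snd (g' n))).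
    { apply eqvl_app; auto. apply eqvl_refl, plains_stl, plain_eval; auto with plain. }
    cbv zeta. destruct (lin0 o1) eqn:E.
    + apply IHo1; [|constructor]. apply eqve_cons; auto.
    + apply eqv_Rep; rewrite ?lin0_eval; auto.
      apply IHo1; [|constructor]. apply eqve_cons; auto using eqve_S_nam. constructor.
  - apply eqvl_refl, plains_stl. simpl. apply plain_eval; auto with plain.
  - apply eqvl_refl, plains_stl. simpl. split; apply plain_eval; auto with plain.
Qed.

(** The clause on occurrences keeps the tests [lin0] of enclosing binders in agreement, so that
    [approx] is closed under contexts. *)
Definition approx (o p : object) : Prop :=
  match o, p with
  | Obj a, Obj b =>
      (forall n, occ n a = occ n b) /\
      forall f g l, plain_env g -> Forall isplain l -> beq (eval a f g l) (eval b f g l)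
  end.

Lemma approx_refl o : approx o o.
Proof. destruct o; split; auto. intros; apply beq_refl, plain_eval; auto. Qed.

Lemma approx_sym o p : approx o p -> approx p o.
Proof. destruct o, p; intros [H H']; split; auto using beq_sym. Qed.

Lemma approx_trans o p q : approx o p -> approx p q -> approx o q.
Proof.
  destruct o, p, q; intros [H1 H2] [H3 H4]; split; intros; [congruence|].
  eapply beq_trans; eauto.
Qed.

(** On the spine, the hypothesis is used in the environment reached at the hole. If the hole lies in
    an argument or in a stack, the two evaluations differ only in the lists they pass on, and
    [eval_eqv] propagates this. *)
Lemma approx_ctx h r (K : ctx h r) (a b : expr h) : approx a b -> approx (plug K a) (plug K b).
Proof.
  intros H; induction K; try exact H; destruct (IHK _ _ H) as [Hst He]; clear IHK H;
    cbn [plug]; split; intros; rewrite ?occ_App, ?occ_Lam, ?occ_Mu, ?occ_ESub, ?occ_Nam, ?occ_Rep, ?occ_One, ?occ_Push;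
    rewrite ?Hst; try reflexivity; cbn [eval].
  - apply He; auto. constructor; auto. apply plain_eval; auto with plain.
  - apply eval_eqv; [now apply eqve_refl|]. constructor; [|now apply eqvl_refl].
    apply He; auto with plain.
  - split; [reflexivity|]. destruct H0; [apply eqv_Lam|apply eqv_ESub]; try apply He; auto with plain.
    now apply eqv_refl.
  - split; [reflexivity|]. unfold lin0; rewrite <- Hst; fold (lin0 (plug K a)).
    destruct (isnil l || lin0 (plug K a)) eqn:E; apply eqv_Mu.
    + apply He; auto with plain.
    + apply orb_false_elim in E. apply eqv_Rep; rewrite ?lin0_eval; try tauto.
      * unfold lin0; rewrite <- Hst; apply E.
      * apply He; auto with plain.
      * apply eqvl_refl; auto with plain.
  - split; [reflexivity|]. apply eqv_ESub; [apply He; auto with plain|].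
    apply eqv_refl, plain_eval; auto with plain.
  - split; [reflexivity|]. apply eqv_ESub; [|apply He; auto with plain].
    apply eqv_refl, plain_eval; auto with plain.
  - split; [reflexivity|]. apply eqv_Nam, He; auto.
  - unfold lin0; rewrite <- Hst; fold (lin0 (plug K a)).
    assert (Hs : Forall isplain (stl (eval e f (drop g) []) ++ snd (g n))).
    { apply Forall_app; split; auto. apply plains_stl, plain_eval; auto with plain. }
    destruct (lin0 (plug K a)) eqn:E.
    + apply He; auto with plain.
    + split; [reflexivity|]. apply eqv_Rep; rewrite ?lin0_eval; auto using eqvl_refl.
      * unfold lin0; rewrite <- Hst; apply E.
      * apply He; auto with plain.
  - destruct (He f (drop g) [] (plain_env_drop g) (Forall_nil _)) as [_ Hs].
    assert (Hs' : eqvl (stl (eval (plug K a) f (drop g) []) ++ snd (g n))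
                       (stl (eval (plug K b) f (drop g) []) ++ snd (g n))).
    { apply eqvl_app; auto. apply eqvl_refl; auto. }
    destruct (lin0 e) eqn:E.
    + apply eval_eqv; [|constructor]. apply eqve_cons; auto using eqve_refl.
    + split; [reflexivity|]. apply eqv_Rep; rewrite ?lin0_eval; auto.
      apply eqv_refl, plain_eval; auto with plain.
  - split; [reflexivity|]. constructor; [|constructor]. apply He; auto with plain.
  - split; [reflexivity|]. simpl. constructor; [apply He; auto with plain|].
    apply eqvl_refl, plains_stl, plain_eval; auto with plain.
  - split; [reflexivity|]. simpl. constructor; [|apply He; auto with plain].
    apply eqv_refl, plain_eval; auto with plain.
Qed.

(** * Evaluation of plain forms *)

Definition appsG (l : list (expr Tm)) {s} : expr s -> expr s :=
  match s return expr s -> expr s with Tm => fun t => apps t l | _ => fun o => o end.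

Lemma under_0 h r (K : ctx h r) s (o : expr s) : nvar K = 0 -> nnam K = 0 -> under K o = o.
Proof. unfold under. intros -> ->. apply ren_id. Qed.

(** Each application crosses the substitution by [struct_sub] with context [CAppL CTHole v]. This
    accounts for the difference between a plain form and its value. *)
Lemma eqv_ESub_apps t u l :
  isplain t -> isplain u -> Forall isplain l -> neutral t = true \/ l = [] ->
  eqv (ESub (apps t (map (ren S id_) l)) u) (apps (ESub t u) l).
Proof.
  intros Ht Hu Hl Hn; revert t Ht Hn; induction Hl as [|v l Hv Hl IH]; intros; simpl.
  - apply eqv_refl; simpl; auto.
  - destruct Hn as [Hn|]; [|discriminate].
    apply eqv_trans with (apps (ESub (App t (ren S id_ v)) u) l).
    + apply IH; simpl; auto with plain.
    + apply eqv_apps; auto; [|now apply eqvl_refl].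
      apply eqv_rule; simpl; auto 6 with plain.
      eapply rule_conv; [apply (@struct_sub (CAppL CTHole v) t u); exact I| |]; simpl.
      * now rewrite rot_0, ren_id.
      * now rewrite under_0.
Qed.

Lemma env_id_drop : drop env_id = env_id.
Proof. reflexivity. Qed.
Lemma env_id_gv : env_S_var env_id = env_id.
Proof. reflexivity. Qed.
Lemma env_id_gn : env_cons (0, []) (env_S_nam env_id) = env_id.
Proof. fext. Qed.

(** In the identity environment no replacement is contracted; only the arguments in [l] move, below
    substitutions. The disjunction makes [appsG l o] plain: only a neutral term may receive
    arguments. *)
Lemma eval_plain s (o : expr s) l :
  isplain o -> Forall isplain l -> neutral o = true \/ l = [] ->
  beq (eval o id_ env_id l) (appsG l o).
Proof.
  revert l; induction o; intros l H Hl Hn; cbn [eval appsG neutral isplain] in *;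
    rewrite ?env_id_drop, ?up_id, ?env_id_gv, ?env_id_gn.
  - apply beq_refl. apply isplain_apps; simpl; auto.
  - split; [reflexivity|]. destruct H as (H1 & H2 & H3).
    assert (Ht : isplain (eval o2 id_ env_id [])) by (apply plain_eval; auto with plain).
    eapply eqv_trans; [apply IHo1; auto|].
    apply (eqv_apps o1 o1 _ (o2 :: l)); auto using eqv_refl.
    constructor; [|now apply eqvl_refl]. apply IHo2; auto.
  - destruct Hn as [Hn|Hn]; [discriminate|subst l]. split; [reflexivity|]. apply eqv_Lam, IHo; auto.
  - destruct Hn as [Hn|Hn]; [discriminate|subst l]. split; [reflexivity|]. simpl.
    rewrite env_id_gn. apply eqv_Mu, IHo; auto.
  - split; [reflexivity|]. destruct H as (H1 & H2).
    eapply eqv_trans; [|apply eqv_ESub_apps; auto].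
    apply eqv_ESub; [apply IHo1; auto with plain|apply IHo2; auto].
    destruct Hn as [Hn|Hn]; try subst l; auto.
  - split; [reflexivity|]. simpl. apply eqv_Nam, IHo; auto.
  - destruct H as (H1 & H2 & H3). rewrite H3. split; [reflexivity|]. cbn [env_id fst snd].
    destruct (IHo2 [] H2 (Forall_nil _) (or_intror eq_refl)) as [_ Hs].
    rewrite app_nil_r.
    rewrite (mkst_stl o2) at 2. apply eqv_Rep; rewrite ?env_id_gn; auto.
    + unfold lin0 in *. now rewrite <- env_id_gn, occ_0_eval.
    + apply IHo1; auto.
  - split; [reflexivity|]. constructor; [|constructor]. apply IHo; auto.
  - split; [reflexivity|]. destruct H as [H1 H2]. constructor; [apply IHo1|apply IHo2]; auto.
Qed.

(** * Evaluation under a linear context *)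

(** The share of the context in the weight of a filled linear context; the default 0 covers the
    holes and the constructors excluded by [linear]. *)
Fixpoint ctx_weight (W V : nat -> nat) {h r} (K : ctx h r) : nat :=
  match K with
  | CAppL K u => ctx_weight W V K + 2 * weight V V u
  | CLam K => ctx_weight W V K
  | CMu K => ctx_weight (zcons W) (zcons V) K
  | CESubL K u => ctx_weight W V K + 2 * weight V V u
  | CNam a K => W a + ctx_weight W V K
  | CRepL K a s => ctx_weight (zcons W) (zcons V) K + W a + 2 * weight V V s
  | _ => 0
  end.

(** The [n]-fold iterate of [zcons] in closed form. *)
Definition pad (n : nat) (W : nat -> nat) (i : nat) : nat := if i <? n then 0 else W (i - n).

Lemma pad_0 W : pad 0 W = W.
Proof. apply functional_extensionality; intro i; unfold pad; simpl. now rewrite Nat.sub_0_r. Qed.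

Lemma pad_S n W : pad (S n) W = pad n (zcons W).
Proof.
  apply functional_extensionality; intro i; unfold pad.
  destruct (Nat.ltb_spec i (S n)), (Nat.ltb_spec i n); try lia; auto.
  - now replace (i - n) with 0 by lia.
  - now replace (i - n) with (S (i - S n)) by lia.
Qed.

Lemma pad_dl m n : pad m (delta n) = delta (m + n).
Proof.
  apply functional_extensionality; intro i; unfold pad, delta.
  destruct (Nat.ltb_spec i m), (Nat.eqb_spec i (m + n)), (Nat.eqb_spec (i - m) n); lia.
Qed.

Lemma weight_plug h r (K : ctx h r) W V X :
  linear K -> weight W V (plug K X) = ctx_weight W V K + weight (pad (nnam K) W) (pad (nnam K) V) X.
Proof.
  revert W V; induction K; intros W V H; try contradiction H; cbn [plug weight ctx_weight nnam];
    rewrite ?pad_0, ?pad_S, ?IHK by assumption; lia.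
Qed.

Lemma ctx_weight_cren h r (K : ctx h r) W V f g :
  ctx_weight W V (cren f g K) = ctx_weight (fun i => W (g i)) (fun i => V (g i)) K.
Proof.
  revert W V f g; induction K; intros; simpl; rewrite ?IHK, ?weight_ren, ?zcons_up; reflexivity.
Qed.

Lemma ctx_weight_0 h r (K : ctx h r) W V : (forall i, W i = 0) -> (forall i, V i = 0) -> ctx_weight W V K = 0.
Proof.
  assert (Hz : forall W, (forall i, W i = 0) -> forall i, zcons W i = 0)
    by (intros ? H [|i]; simpl; auto).
  revert W V; induction K; intros; simpl; rewrite ?IHK, ?weight_0, ?H by auto; auto.
Qed.

Lemma ctx_weight_ext h r (K : ctx h r) W V W' V' :
  (forall i, W i = W' i) -> (forall i, V i = V' i) -> ctx_weight W V K = ctx_weight W' V' K.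
Proof.
  intros HW HV. apply functional_extensionality in HW, HV. now subst.
Qed.

Lemma occ_plug h r (K : ctx h r) n X :
  linear K -> occ n (plug K X) = ctx_weight (delta n) (delta n) K + occ (nnam K + n) X.
Proof. intro H. unfold occ at 1. now rewrite weight_plug, pad_dl. Qed.

Lemma delta_add m n i : delta (m + n) (m + i) = delta n i.
Proof. unfold delta. destruct (Nat.eqb_spec (m + i) (m + n)), (Nat.eqb_spec i n); lia. Qed.

Lemma delta_lt m n i : n < m -> delta n (m + i) = 0.
Proof. unfold delta. intro; destruct (Nat.eqb_spec (m + i) n); lia. Qed.

Lemma occ_under h r (K : ctx h r) n s (o : expr s) : occ (nnam K + n) (under K o) = occ n o.
Proof. unfold occ, under. rewrite weight_ren. apply weight_ext; intro; apply delta_add. Qed.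

Lemma occ_under_lt h r (K : ctx h r) n s (o : expr s) : n < nnam K -> occ n (under K o) = 0.
Proof. intro. unfold occ, under. rewrite weight_ren. apply weight_0; intro; now apply delta_lt. Qed.

Ltac eqb_lia :=
  unfold delta, skip;
  repeat match goal with
  | |- context[?a <? ?b] => destruct (Nat.ltb_spec a b)
  | |- context[?a =? ?b] => destruct (Nat.eqb_spec a b)
  end; lia.

Lemma delta_rot_S m n i : delta (m + S n) (rot m i) = delta (S (m + n)) i.
Proof. destruct i; cbn [rot]; eqb_lia. Qed.

Lemma delta_rot m i : delta m (rot m i) = delta 0 i.
Proof. destruct i; cbn [rot]; eqb_lia. Qed.

Lemma delta_rot_lt m n i : n < m -> delta n (rot m i) = delta (S n) i.
Proof. destruct i; cbn [rot]; eqb_lia. Qed.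

Lemma occ_plug_S h r (K : ctx h r) f n X :
  linear K -> occ (S n) (plug (cren f S K) X) = ctx_weight (delta n) (delta n) K + occ (nnam K + S n) X.
Proof. intro H. rewrite occ_plug, ctx_weight_cren, nnam_cren by now apply linear_cren. reflexivity. Qed.

Lemma occ_plug_0_S h r (K : ctx h r) f X :
  linear K -> occ 0 (plug (cren f S K) X) = occ (nnam K) X.
Proof.
  intro H. rewrite occ_plug, ctx_weight_cren, nnam_cren, ctx_weight_0 by (reflexivity || now apply linear_cren).
  now rewrite Nat.add_0_r.
Qed.

Lemma occ_plug_rot h r (K : ctx h r) f n (c : expr h) :
  linear K ->
  occ (S n) (plug (cren f S K) (ren id_ (rot (nnam K)) c)) =
  ctx_weight (delta n) (delta n) K + occ (S (nnam K + n)) c.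
Proof.
  intro H. rewrite occ_plug_S by assumption. f_equal. unfold occ. rewrite weight_ren.
  apply weight_ext; apply delta_rot_S.
Qed.

Lemma lin0_plug_rot (K : ctx Cm Cm) f (c : expr Cm) :
  linear K -> lin0 (plug (cren f S K) (ren id_ (rot (nnam K)) c)) = lin0 c.
Proof.
  intro H. unfold lin0. rewrite occ_plug_0_S by assumption. unfold occ. rewrite weight_ren.
  do 2 f_equal. apply functional_extensionality; apply delta_rot.
  apply functional_extensionality; apply delta_rot.
Qed.

Lemma eval_arg_ren s (u : expr s) p q P Q f1 f2 g1 g2 :
  (forall i, f2 (p i) = P (f1 i)) -> (forall i, g2 (q i) = pren P Q (g1 i)) ->
  eval (ren p q u) f2 (drop g2) [] = ren P Q (eval u f1 (drop g1) []).
Proof.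
  intros Hf Hg. rewrite eval_ren, ren_eval. apply eval_ext; auto.
  intro i. unfold drop, pren; simpl. now rewrite Hg.
Qed.

(** Makes the two copies of a context in [eval_linear] take the same branch at every name binder. *)
Lemma lin0_plug h (K : ctx h Cm) p q X1 X2 :
  linear K -> occ (nnam K) X1 = occ (nnam K) X2 ->
  lin0 (plug (cren p (up q) K) X2) = lin0 (plug K X1).
Proof.
  intros HK H. unfold lin0.
  rewrite !occ_plug, ctx_weight_cren, nnam_cren, Nat.add_0_r, H by auto using linear_cren.
  rewrite (ctx_weight_ext _ _ _ _ _ (delta 0) (delta 0)); [reflexivity| |]; intros [|]; reflexivity.
Qed.

Lemma lift_up n f f' :
  (forall i, f' (n + i) = n + up f i) -> forall i, f' (S n + i) = S n + f i.
Proof. intros H i. replace (S n + i) with (n + S i) by lia. rewrite H. simpl; lia. Qed.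

Lemma lift_S_var m n k (g g' : env) :
  (forall i, g' (m + i) = pren (Nat.add n) (Nat.add k) (env_S_var g i)) ->
  forall i, g' (m + i) = pren (Nat.add (S n)) (Nat.add k) (g i).
Proof.
  intros H i. rewrite H. unfold env_S_var. rewrite pren_pren. apply pren_ext; intro; unfold id_; lia.
Qed.

Lemma lift_S_nam m n k x (g g' : env) :
  (forall i, g' (m + i) = pren (Nat.add n) (Nat.add k) (env_cons x (env_S_nam g) i)) ->
  forall i, g' (S m + i) = pren (Nat.add n) (Nat.add (S k)) (g i).
Proof.
  intros H i. replace (S m + i) with (m + S i) by lia. rewrite H. simpl. unfold env_S_nam.
  rewrite pren_pren. apply pren_ext; intro; unfold id_; lia.
Qed.

(** A [Mu] whose arguments stay blocked evaluates to two name binders. The numbers of names bound by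
    the source context, [m], and by its value, [k], are therefore kept apart. *)
Lemma lift_S_nam2 m n k x (g g' : env) :
  (forall i, g' (m + i) = pren (Nat.add n) (Nat.add k) (env_cons x (env_S_nam (env_S_nam g)) i)) ->
  forall i, g' (S m + i) = pren (Nat.add n) (Nat.add (S (S k))) (g i).
Proof.
  intros H i. rewrite (lift_S_nam _ _ _ _ _ _ H i). unfold env_S_nam.
  rewrite pren_pren. apply pren_ext; intro; unfold id_; lia.
Qed.

(* Evaluating [K<X>] yields [K'<X'>], where the linear context [K'] depends on [X]
   only through the occurrences of the names bound by [K].  The two copies, one
   of them renamed, are the two sides of the structural rules. *)
Lemma eval_linear h r (K : ctx h r) (X1 X2 : expr h) p q P Q f1 f2 g1 g2 l :
  linear K ->
  (forall k, k < nnam K -> occ k X1 = occ k X2) ->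
  (forall i, f2 (p i) = P (f1 i)) ->
  (forall i, g2 (q i) = pren P Q (g1 i)) ->
  exists (K' : ctx h r) f1' f2' g1' g2' l',
    linear K' /\ nvar K' = nvar K /\
    eval (plug K X1) f1 g1 l = plug K' (eval X1 f1' g1' l') /\
    eval (plug (cren p q K) X2) f2 g2 (map (ren P Q) l) =
      plug (cren P Q K')
        (eval X2 f2' g2' (map (ren (upn (nvar K) P) (upn (nnam K') Q)) l')) /\
    (forall i, f2' (upn (nvar K) p i) = upn (nvar K) P (f1' i)) /\
    (forall i, g2' (upn (nnam K) q i) = pren (upn (nvar K) P) (upn (nnam K') Q) (g1' i)) /\
    (forall i, f1' (nvar K + i) = nvar K + f1 i) /\
    (forall i, f2' (nvar K + i) = nvar K + f2 i) /\
    (forall i, g1' (nnam K + i) = pren (Nat.add (nvar K)) (Nat.add (nnam K')) (g1 i)) /\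
    (forall i, g2' (nnam K + i) = pren (Nat.add (nvar K)) (Nat.add (nnam K')) (g2 i)).
Proof.
  intros HK; revert p q P Q f1 f2 g1 g2 l.
  induction K; intros p q P Q f1 f2 g1 g2 l Hst Hf Hg; try contradiction HK;
    cbn [plug cren eval nvar nnam] in *.
  - exists CTHole, f1, f2, g1, g2, l. rewrite !upn_0.
    repeat split; auto; intro; symmetry; apply pren_id.
  - exists CCHole, f1, f2, g1, g2, l. rewrite !upn_0.
    repeat split; auto; intro; symmetry; apply pren_id.
  - rewrite (eval_arg_ren _ _ _ _ _ _ _ _ _ _ Hf Hg).
    apply (IHK X1 X2 HK p q P Q f1 f2 g1 g2 (_ :: l)); auto.
  - assert (Hf' : forall i, up f2 (up p i) = up P (up f1 i))
      by (intros [|i]; simpl; auto).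
    assert (Hg' : forall i, env_S_var g2 (q i) = pren (up P) Q (env_S_var g1 i)).
    { intro i; unfold env_S_var. now rewrite Hg, !pren_pren. }
    (* An abstraction stays one if no argument awaits it and otherwise becomes a substitution, which
       binds the same variable: hence [nvar K' = nvar K]. *)
    destruct l as [|u l]; cbn [map]; rewrite <- ?map_ren_up.
    + destruct (IHK X1 X2 HK _ _ _ _ _ _ _ _ [] Hst Hf' Hg')
        as (K' & f1' & f2' & g1' & g2' & l' & H1 & H2 & H3 & H4 & H5 & H6 & H7 & H8 & H9 & H10).
      exists (CLam K'), f1', f2', g1', g2', l'. cbn [plug cren nvar nnam linear].
      rewrite ?upn_S, H3, H2, <- H4. repeat split; auto.
      * intro i. exact (lift_up _ _ _ H7 i).
      * intro i. exact (lift_up _ _ _ H8 i).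
      * intro i. exact (lift_S_var _ _ _ _ _ H9 i).
      * intro i. exact (lift_S_var _ _ _ _ _ H10 i).
    + destruct (IHK X1 X2 HK _ _ _ _ _ _ _ _ (map (ren S id_) l) Hst Hf' Hg')
        as (K' & f1' & f2' & g1' & g2' & l' & H1 & H2 & H3 & H4 & H5 & H6 & H7 & H8 & H9 & H10).
      exists (CESubL K' u), f1', f2', g1', g2', l'. cbn [plug cren nvar nnam linear].
      rewrite ?upn_S, H3, H2, <- H4. repeat split; auto.
      * intro i. exact (lift_up _ _ _ H7 i).
      * intro i. exact (lift_up _ _ _ H8 i).
      * intro i. exact (lift_S_var _ _ _ _ _ H9 i).
      * intro i. exact (lift_S_var _ _ _ _ _ H10 i).
  - assert (Hl : lin0 (plug (cren p (up q) K) X2) = lin0 (plug K X1)).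
    { apply lin0_plug; auto. }
    rewrite Hl, isnil_map. destruct (isnil l || lin0 (plug K X1)).
    + assert (Hg' : forall i, env_cons (0, map (ren id_ S) (map (ren P Q) l)) (env_S_nam g2) (up q i)
        = pren P (up Q) (env_cons (0, map (ren id_ S) l) (env_S_nam g1) i)).
      { intros [|i]; simpl; [unfold pren; simpl; now rewrite map_ren_up'|].
        unfold env_S_nam. now rewrite Hg, !pren_pren. }
      destruct (IHK X1 X2 HK _ _ _ _ _ _ _ _ [] (fun k Hk => Hst k (Nat.lt_lt_succ_r _ _ Hk)) Hf Hg')
        as (K' & f1' & f2' & g1' & g2' & l' & H1 & H2 & H3 & H4 & H5 & H6 & H7 & H8 & H9 & H10).
      exists (CMu K'), f1', f2', g1', g2', l'. cbn [plug cren nvar nnam linear].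
      rewrite ?upn_S, H3, <- H4. repeat split; auto.
      * intro i. exact (lift_S_nam _ _ _ _ _ _ H9 i).
      * intro i. exact (lift_S_nam _ _ _ _ _ _ H10 i).
    + assert (Hg' : forall i, env_cons (0, []) (env_S_nam (env_S_nam g2)) (up q i)
        = pren P (up (up Q)) (env_cons (0, []) (env_S_nam (env_S_nam g1)) i)).
      { intros [|i]; simpl; [reflexivity|]. unfold env_S_nam. now rewrite Hg, !pren_pren. }
      destruct (IHK X1 X2 HK _ _ _ _ _ _ _ _ [] (fun k Hk => Hst k (Nat.lt_lt_succ_r _ _ Hk)) Hf Hg')
        as (K' & f1' & f2' & g1' & g2' & l' & H1 & H2 & H3 & H4 & H5 & H6 & H7 & H8 & H9 & H10).
      (* The blocked replacement is added below the new name, so two names are bound here where [K]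
         binds one. *)
      exists (CMu (CRepL K' 0 (mkst (map (ren id_ S) l)))), f1', f2', g1', g2', l'.
      cbn [plug cren nvar nnam linear].
      rewrite ?upn_S, H3, ren_mkst, map_ren_up', <- H4. repeat split; auto.
      * intro i. exact (lift_S_nam2 _ _ _ _ _ _ H9 i).
      * intro i. exact (lift_S_nam2 _ _ _ _ _ _ H10 i).
  - assert (Hf' : forall i, up f2 (up p i) = up P (up f1 i))
      by (intros [|i]; simpl; auto).
    assert (Hg' : forall i, env_S_var g2 (q i) = pren (up P) Q (env_S_var g1 i)).
    { intro i; unfold env_S_var. now rewrite Hg, !pren_pren. }
    rewrite (eval_arg_ren _ _ _ _ _ _ _ _ _ _ Hf Hg), <- map_ren_up.
    destruct (IHK X1 X2 HK _ _ _ _ _ _ _ _ (map (ren S id_) l) Hst Hf' Hg')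
      as (K' & f1' & f2' & g1' & g2' & l' & H1 & H2 & H3 & H4 & H5 & H6 & H7 & H8 & H9 & H10).
    exists (CESubL K' (eval e f1 (drop g1) [])), f1', f2', g1', g2', l'.
    cbn [plug cren nvar nnam linear].
    rewrite ?upn_S, H3, H2, <- H4. repeat split; auto.
    + intro i. exact (lift_up _ _ _ H7 i).
    + intro i. exact (lift_up _ _ _ H8 i).
    + intro i. exact (lift_S_var _ _ _ _ _ H9 i).
    + intro i. exact (lift_S_var _ _ _ _ _ H10 i).
  - destruct (IHK X1 X2 HK _ _ _ _ _ _ _ _ (snd (g1 n)) Hst Hf Hg)
      as (K' & f1' & f2' & g1' & g2' & l' & H1 & H2 & H3 & H4 & H5 & H6 & H7 & H8 & H9 & H10).
    exists (CNam (fst (g1 n)) K'), f1', f2', g1', g2', l'. cbn [plug cren nvar nnam linear].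
    rewrite H3, Hg, <- H4. repeat split; auto.
  - assert (Hl : lin0 (plug (cren p (up q) K) X2) = lin0 (plug K X1)).
    { apply lin0_plug; auto. }
    rewrite Hl. set (L := stl (eval e f1 (drop g1) []) ++ snd (g1 n)).
    replace (stl (eval (ren p q e) f2 (drop g2) []) ++ snd (g2 (q n))) with (map (ren P Q) L)
      by (unfold L; rewrite (eval_arg_ren _ _ _ _ _ _ _ _ _ _ Hf Hg), stl_ren, map_app, Hg; reflexivity).
    rewrite Hg. cbn [fst pren]. destruct (lin0 (plug K X1)).
    + assert (Hg' : forall i, env_cons (Q (fst (g1 n)), map (ren P Q) L) g2 (up q i)
        = pren P Q (env_cons (fst (g1 n), L) g1 i)) by (intros [|i]; simpl; auto).
      destruct (IHK X1 X2 HK _ _ _ _ _ _ _ _ [] (fun k Hk => Hst k (Nat.lt_lt_succ_r _ _ Hk)) Hf Hg')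
        as (K' & f1' & f2' & g1' & g2' & l' & H1 & H2 & H3 & H4 & H5 & H6 & H7 & H8 & H9 & H10).
      (* A contracted replacement leaves no layer in [K']; its arguments are kept in the environment
         entry of its name. *)
      exists K', f1', f2', g1', g2', l'.
      rewrite ?upn_S, H3, <- H4. repeat split; auto.
      * intro i. replace (S (nnam K) + i) with (nnam K + S i) by lia. apply H9.
      * intro i. replace (S (nnam K) + i) with (nnam K + S i) by lia. apply H10.
    + assert (Hg' : forall i, env_cons (0, []) (env_S_nam g2) (up q i)
        = pren P (up Q) (env_cons (0, []) (env_S_nam g1) i)).
      { intros [|i]; simpl; [reflexivity|]. unfold env_S_nam. now rewrite Hg, !pren_pren. }
      destruct (IHK X1 X2 HK _ _ _ _ _ _ _ _ [] (fun k Hk => Hst k (Nat.lt_lt_succ_r _ _ Hk)) Hf Hg')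
        as (K' & f1' & f2' & g1' & g2' & l' & H1 & H2 & H3 & H4 & H5 & H6 & H7 & H8 & H9 & H10).
      exists (CRepL K' (fst (g1 n)) (mkst L)), f1', f2', g1', g2', l'.
      cbn [plug cren nvar nnam linear].
      rewrite ?upn_S, H3, ren_mkst, <- H4. repeat split; auto.
      * intro i. exact (lift_S_nam _ _ _ _ _ _ H9 i).
      * intro i. exact (lift_S_nam _ _ _ _ _ _ H10 i).
Qed.

(** * Structural rules without plainness conditions *)

Lemma approx_eqv s (o p : expr s) :
  s <> St -> (forall n, occ n o = occ n p) ->
  (forall f g l, plain_env g -> Forall isplain l ->
     eval o f g l = eval p f g l \/ struct_rule (eval o f g l) (eval p f g l)) ->
  approx o p.
Proof.
  intros Hs Hst H. split; [exact Hst|]. intros f g l Hg Hl.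
  destruct (H f g l Hg Hl) as [E|R].
  - rewrite E. apply beq_refl, plain_eval; auto.
  - split; [reflexivity|]. destruct s; try congruence; apply eqv_rule; auto; apply plain_eval; auto.
Qed.

Lemma occ_ren_id n f s (o : expr s) : occ n (ren f id_ o) = occ n o.
Proof. unfold occ. now rewrite weight_ren. Qed.

(** [eval_linear] takes the right side as first copy and the body on the left, weakened by [S], as
    second. Names bound by [K] have the same weights in both fillers because [under K u] avoids
    them, so both values use the same [K']. *)
Lemma approx_sub (K : ctx Tm Tm) t u :
  linear K ->
  approx (ESub (plug (cren S id_ K) (ren (rot (nvar K)) id_ t)) u) (plug K (ESub t (under K u))).
Proof.
  intros HK. apply approx_eqv; [discriminate| |].
  - intro n. rewrite occ_ESub, !occ_plug, ctx_weight_cren, nnam_cren by auto using linear_cren.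
    rewrite occ_ESub, occ_under, occ_ren_id. change (fun i => delta n (id_ i)) with (delta n). lia.
  - intros f g l Hg Hl. right. cbn [eval].
    destruct (eval_linear _ _ K (ESub t (under K u)) (ren (rot (nvar K)) id_ t) S id_ S id_ f (up f) g (env_S_var g) l)
        as (K' & f1' & f2' & g1' & g2' & l' & H1 & H2 & H3 & H4 & H5 & H6 & H7 & H8 & H9 & H10); auto.
    { intros k Hk. rewrite occ_ESub, occ_under_lt, occ_ren_id by auto. lia. }
    rewrite H3, H4. cbn [eval].
    replace (eval (under K u) f1' (drop g1') []) with (under K' (eval u f (drop g) [])).
    2:{ unfold under. rewrite eval_ren, ren_eval, H2. apply eval_ext; auto. unfold drop. intro; now rewrite H9. }
    eapply rule_conv; [apply (@struct_sub K' (eval t (up f1') (env_S_var g1') (map (ren S id_) l'))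
      (eval u f (drop g) [])); exact H1| |]; [|reflexivity].
    f_equal. f_equal. rewrite eval_ren, ren_eval, H2. apply eval_ext.
    + intros [|i]; simpl.
      * rewrite <- (Nat.add_0_r (nvar K)) at 1. rewrite H8. simpl; lia.
      * rewrite skip_upn. apply H5.
    + intro i. unfold env_S_var at 1. specialize (H6 i). rewrite upn_id in H6. rewrite H6. unfold env_S_var. rewrite pren_pren, upn_id.
      apply pren_ext; [|reflexivity]. intro. now rewrite <- skip_upn.
    + rewrite map_ren_ren, upn_id. apply map_ren_ext; [|reflexivity]. intro; now rewrite <- skip_upn.
Qed.

Lemma rot_S n i : rot n (S i) = upn n S i.
Proof. simpl. now rewrite skip_upn. Qed.

(** The environment at the hole, read through [rot]: first the entry of the name that moves inwards,
    shifted over the evaluated context, then the entries of the other copy. *)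
Lemma eval_rep_hole m n n' (g2 g1' g2' : env) P Q x :
  (forall i, g2' (upn m S i) = pren (upn n P) (upn n' Q) (g1' i)) ->
  (forall i, g2' (m + i) = pren (Nat.add n) (Nat.add n') (g2 i)) ->
  g2 0 = x ->
  forall i, g2' (rot m i) =
    env_cons (pren (Nat.add n) (Nat.add n') x) (fun i => pren (upn n P) (upn n' Q) (g1' i)) i.
Proof.
  intros H6 H10 Hx [|i].
  - simpl. rewrite <- (Nat.add_0_r m) at 1. now rewrite H10, Hx.
  - simpl. rewrite skip_upn. apply H6.
Qed.

Lemma approx_rep (K : ctx Cm Cm) c a s :
  linear K ->
  approx (Rep (plug (cren id_ S K) (ren id_ (rot (nnam K)) c)) a s)
         (plug K (Rep c (nnam K + a) (under K s))).
Proof.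
  intros HK. apply approx_eqv; [discriminate| |].
  - intro n. rewrite occ_Rep, occ_plug_rot, occ_plug, occ_Rep, occ_under, delta_add by auto. lia.
  - intros f g l Hg Hl. cbn [eval]. rewrite lin0_plug_rot by auto.
    set (L := stl (eval s f (drop g) []) ++ snd (g a)). cbv zeta.
    assert (Hst : forall k, k < nnam K -> occ k (Rep c (nnam K + a) (under K s)) = occ k (ren id_ (rot (nnam K)) c)).
    { intros k Hk. rewrite occ_Rep, occ_under_lt, delta_lt by auto. unfold occ. rewrite weight_ren.
      rewrite !Nat.mul_0_r, !Nat.add_0_r. symmetry; apply weight_ext; intro; now apply delta_rot_lt. }
    assert (HL : forall (K' : ctx Cm Cm) f1' g1', nvar K' = nvar K ->
      (forall i, f1' (nvar K + i) = nvar K + f i) ->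
      (forall i, g1' (nnam K + i) = pren (Nat.add (nvar K)) (Nat.add (nnam K')) (g i)) ->
      stl (eval (under K s) f1' (drop g1') []) ++ snd (g1' (nnam K + a))
      = map (ren (Nat.add (nvar K)) (Nat.add (nnam K'))) L).
    { intros K' f1' g1' H2 H7 H9. unfold L. rewrite map_app, <- stl_ren, H9. simpl. f_equal.
      f_equal. unfold under. rewrite eval_ren, ren_eval. apply eval_ext; auto.
      unfold drop. intro; now rewrite H9. }
    destruct (lin0 c) eqn:E.
    (* The name is linear: both replacements are contracted and their arguments reach the same
       place, so the values are equal. *)
    + left.
      destruct (eval_linear _ _ K (Rep c (nnam K + a) (under K s)) (ren id_ (rot (nnam K)) c)
        id_ S id_ id_ f f g (env_cons (fst (g a), L) g) [])
        as (K' & f1' & f2' & g1' & g2' & l' & H1 & H2 & H3 & H4 & H5 & H6 & H7 & H8 & H9 & H10); auto.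
      { intro; symmetry; apply pren_id. }
      cbn [map] in H4. rewrite H4, (eval_cm _ _ f g l), H3 by discriminate. rewrite cren_id. f_equal.
      cbn [eval]. rewrite E. rewrite (HL K') by auto. rewrite eval_ren, eval_cm by discriminate.
      apply eval_ext; auto.
      * intro i. specialize (H5 i). now rewrite !upn_id in H5.
      * intro i. rewrite (eval_rep_hole _ _ _ _ _ _ _ _ _ H6 H10 eq_refl). destruct i; simpl.
        -- rewrite H9. reflexivity.
        -- rewrite !upn_id. apply pren_id.
    + right.
      destruct (eval_linear _ _ K (Rep c (nnam K + a) (under K s)) (ren id_ (rot (nnam K)) c)
        id_ S id_ S f f g (env_cons (0, []) (env_S_nam g)) [])
        as (K' & f1' & f2' & g1' & g2' & l' & H1 & H2 & H3 & H4 & H5 & H6 & H7 & H8 & H9 & H10); auto.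
      cbn [map] in H4. rewrite H4, (eval_cm _ _ f g l), H3 by discriminate.
      cbn [eval]. rewrite E, (HL K') by auto.
      rewrite H9. cbn [fst pren].
      eapply rule_conv; [apply (@struct_rep K' (eval c f1' (env_cons (0, []) (env_S_nam g1')) []) (fst (g a)) (mkst L)); exact H1| |].
      * do 2 f_equal. rewrite eval_ren, ren_eval, eval_cm by discriminate. apply eval_ext; auto.
        -- intro i. specialize (H5 i). now rewrite !upn_id in H5.
        -- intro i. rewrite (eval_rep_hole _ _ _ _ _ _ _ _ _ H6 H10 eq_refl). destruct i; simpl.
           ++ unfold pren; simpl. now rewrite Nat.add_0_r.
           ++ unfold env_S_nam. rewrite pren_pren, upn_id. apply pren_ext; [reflexivity|]. intro; now rewrite rot_S.
      * f_equal. f_equal. unfold under. now rewrite ren_mkst, H2.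
Qed.

(** The bound name occurs only at its displayed place, so the test [lin0] succeeds and all arguments
    are handed to [t]; the value is again a theta redex. *)
Lemma approx_theta t : approx (Mu (Nam 0 (ren id_ S t))) t.
Proof.
  apply approx_eqv; [discriminate| |].
  - intro n. now rewrite occ_Mu, occ_Nam, occ_S.
  - intros f g l Hg Hl. right. cbn [eval].
    replace (lin0 (Nam 0 (ren id_ S t))) with true
      by (unfold lin0; now rewrite occ_Nam, occ_0_S).
    rewrite orb_true_r, eval_ren. cbn [fst snd env_cons].
    eapply rule_conv; [apply (@struct_theta (eval t f g l))| |reflexivity].
    now rewrite ren_eval.
Qed.

Lemma isplain_plug h r (K : ctx h r) X : isplain (plug K X) -> isplain X.
Proof. induction K; simpl; intuition. Qed.

(** A command in the hole lies below a [Mu] or inside a component that [neutral] does not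
    inspect. *)
Lemma neutral_plug h r (K : ctx h r) p q X X' :
  h = Cm -> neutral (plug (cren p q K) X') = neutral (plug K X).
Proof.
  assert (HC : forall s (o : expr s), s = Cm -> neutral o = true) by (now destruct o).
  revert p q; induction K; intros; simpl; auto;
    first [apply neutral_ren | rewrite !HC; auto].
Qed.

Lemma isplain_plug_cren h r (K : ctx h r) p q X X' :
  h = Cm -> linear K -> isplain (plug K X) -> isplain X' ->
  (forall k, k < nnam K -> occ k X = occ k X') -> isplain (plug (cren p q K) X').
Proof.
  intros Hh; revert p q; induction K; intros p q HK H HX Hst; try contradiction HK;
    cbn [plug cren isplain nnam linear] in *; auto.
  - destruct H as (H1 & H2 & H3). rewrite (neutral_plug _ _ _ _ _ X) by assumption.
    repeat split; eauto using isplain_ren.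
  - eauto.
  - eauto with arith.
  - destruct H. split; eauto using isplain_ren.
  - eauto.
  - destruct H as (H1 & H2 & H3). rewrite (lin0_plug _ _ _ _ X) by auto.
    repeat split; eauto using isplain_ren with arith.
Qed.

(** If no argument is blocked at the moved name, one [struct_mu] relates the values. Otherwise the
    [mu] evaluates to a [mu] above a blocked replacement, which must enter the context by
    [struct_rep] before [struct_mu] applies. *)
Lemma approx_mu (K : ctx Cm Cm) b c :
  linear K ->
  approx (Nam b (Mu (plug (cren id_ S K) (ren id_ (rot (nnam K)) c))))
         (plug K (Nam (nnam K + b) (Mu c))).
Proof.
  intros HK. split.
  { intro n. rewrite occ_Nam, occ_Mu, occ_plug_rot, occ_plug, occ_Nam, occ_Mu, delta_add by auto. lia. }
  intros f g l Hg Hl. split; [reflexivity|].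
  match goal with |- eqv (Obj (eval ?A _ _ _)) (Obj (eval ?B _ _ _)) =>
    assert (HP1 : isplain (eval A f g l)) by (apply plain_eval; auto);
    assert (HP2 : isplain (eval B f g l)) by (apply plain_eval; auto) end.
  cbn [eval] in *. rewrite lin0_plug_rot in * by auto.
  destruct (g b) as [B lb] eqn:Eb; cbn [fst snd] in *.
  assert (Hst : forall k, k < nnam K -> occ k (Nam (nnam K + b) (Mu c)) = occ k (ren id_ (rot (nnam K)) c)).
  { intros k Hk. rewrite occ_Nam, occ_Mu, delta_lt by auto. unfold occ. rewrite weight_ren.
    symmetry; apply weight_ext; intro; now apply delta_rot_lt. }
  destruct (isnil lb || lin0 c) eqn:E.
  - destruct (eval_linear _ _ K (Nam (nnam K + b) (Mu c)) (ren id_ (rot (nnam K)) c)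
        id_ S id_ S f f g (env_cons (0, map (ren id_ S) lb) (env_S_nam g)) [])
        as (K' & f1' & f2' & g1' & g2' & l' & H1 & H2 & H3 & H4 & H5 & H6 & H7 & H8 & H9 & H10); auto.
    cbn [map] in H4. rewrite H4, (eval_cm _ _ f g l), H3 in * by discriminate.
    cbn [eval] in *. rewrite H9, Eb in *. cbn [fst snd pren] in *. rewrite isnil_map, E in *.
    apply eqv_rule; auto.
    eapply rule_conv; [eapply (@struct_mu K' B); exact H1| |reflexivity].
    do 3 f_equal. rewrite eval_ren, ren_eval, eval_cm by discriminate. apply eval_ext; auto.
    + intro i. specialize (H5 i). now rewrite !upn_id in H5.
    + intro i. rewrite (eval_rep_hole _ _ _ _ _ _ _ _ _ H6 H10 eq_refl). destruct i; simpl.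
      * unfold pren; simpl. rewrite Nat.add_0_r, !map_ren_ren. f_equal. apply map_ren_ext.
        -- reflexivity.
        -- intro i. rewrite rot_S. symmetry. apply upn_add.
      * unfold env_S_nam. rewrite pren_pren, upn_id. apply pren_ext; [reflexivity|]. intro; now rewrite rot_S.
  (* The target is shifted twice: the filler lies below the new name and below the blocked
     replacement. *)
  - destruct (eval_linear _ _ K (Nam (nnam K + b) (Mu c)) (ren id_ (rot (nnam K)) c)
        id_ S id_ (fun i => S (S i)) f f g (env_cons (0, []) (env_S_nam (env_S_nam g))) [])
        as (K' & f1' & f2' & g1' & g2' & l' & H1 & H2 & H3 & H4 & H5 & H6 & H7 & H8 & H9 & H10); auto.
    { intro i. cbn [env_cons]. unfold env_S_nam. now rewrite !pren_pren. }
    cbn [map] in H4. rewrite H4, (eval_cm _ _ f g l), H3 in * by discriminate.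
    cbn [eval] in *. rewrite H9, Eb in *. cbn [fst snd pren] in *. rewrite isnil_map, E in *.
    set (Xc := eval c f1' (env_cons (0, []) (env_S_nam (env_S_nam g1'))) []) in *.
    set (lb' := map (ren id_ S) (map (ren (Nat.add (nvar K)) (Nat.add (nnam K'))) lb)) in *.
    assert (HX : eval (ren id_ (rot (nnam K)) c) f2' g2' (map (ren (upn (nvar K) id_) (upn (nnam K') (fun i => S (S i)))) l')
      = ren id_ (rot (nnam K')) (ren id_ (up (rot (nnam K'))) Xc)).
    { unfold Xc. rewrite eval_ren, !ren_eval, eval_cm by discriminate. apply eval_ext; auto.
      - intro i. specialize (H5 i). now rewrite !upn_id in H5.
      - intro i. rewrite (eval_rep_hole _ _ _ _ _ _ _ _ _ H6 H10 eq_refl). destruct i; simpl.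
        + unfold pren; simpl. now rewrite Nat.add_0_r.
        + unfold env_S_nam. rewrite !pren_pren, upn_id. apply pren_ext; [reflexivity|].
          intro. cbn [up]. now rewrite !rot_S, upn_upn. }
    assert (Hl' : ren id_ (rot (nnam K')) (mkst lb') = under (cren id_ S K') (mkst (map (ren id_ S) lb))).
    { unfold under, lb'. rewrite !ren_mkst, !map_ren_ren, nvar_cren, nnam_cren, H2. f_equal.
      apply map_ren_ext; [reflexivity|]. intro i. rewrite rot_S. apply upn_add. }
    (* Structural steps relate plain forms only. Plainness of the intermediate object is read off
       the right-hand value, whose filler is exchanged for a plain one with the same weights of the
       bound names. *)
    assert (Hmid : isplain (plug (cren id_ S K') (ren id_ (rot (nnam K')) (Rep Xc 0 (mkst lb'))))).
    { eapply isplain_plug_cren; eauto.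
      - apply isplain_ren. apply isplain_plug in HP2. exact HP2.
      - intros k Hk. rewrite occ_Nam, delta_lt, occ_Mu by auto. unfold occ. rewrite weight_ren.
        symmetry; apply weight_ext; intro; now apply delta_rot_lt. }
    apply eqv_trans with (Nam B (Mu (plug (cren id_ S K') (ren id_ (rot (nnam K')) (Rep Xc 0 (mkst lb')))))).
    + apply eqv_Nam, eqv_Mu, eqv_rule; auto.
      eapply rule_conv; [apply (@struct_rep (cren id_ S K') (ren id_ (up (rot (nnam K'))) Xc) 0
        (mkst (map (ren id_ S) lb))); now apply linear_cren| |].
      * now rewrite HX, cren_cren, nnam_cren.
      * f_equal. simpl. now rewrite Hl', nnam_cren, Nat.add_0_r.
    + apply eqv_rule; auto. now apply struct_mu.
Qed.

(** * Exchange of two abstractions *)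

(** The substitution enters the context up to the inner [mu], the name [a] moves inwards by
    [approx_mu], and the substitution follows it. This is the exchange of abstractions after the
    outer one has met its argument. *)
Lemma approx_esub_pop a b c u :
  approx (Nam a (ESub (Mu (Nam (S b) (Lam (Mu c)))) u))
         (Nam b (Lam (Mu (Nam (S a) (ESub (Mu (ren swap swap c)) (ren S S u)))))).
Proof.
  assert (Hs : forall i, swap (swap i) = i) by (intros [|[|i]]; reflexivity).
  pose proof (approx_sub (CMu (CNam (S b) (CLam CTHole))) (Mu (ren swap id_ c)) u I) as H1.
  pose proof (approx_mu (CNam b (CLam (CESubL (CMu CCHole) (ren S id_ u)))) a (ren swap swap c) I) as H2.
  pose proof (approx_sub (CMu (CNam (S a) CTHole)) (Mu (ren swap swap c)) (ren S id_ u) I) as H3.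
  unfold under in *. cbn [plug cren nvar nnam] in *. rewrite rot_1, rot_0 in *.
  apply (approx_ctx _ _ (CNam a CTHole)) in H1.
  apply (approx_ctx _ _ (CNam b (CLam CTHole))) in H3. cbn [plug ren] in *.
  rewrite ?ren_ren in *. rewrite ?up_id in *.
  eapply approx_trans; [eapply approx_trans; [|exact H1]|eapply approx_trans; [|eapply approx_trans; [exact H3|]]].
  - match goal with |- approx (Obj ?x) (Obj ?y) => replace y with x; [apply approx_refl|] end.
    do 7 f_equal. rewrite <- (ren_id _ c) at 1. apply ren_ext; intro; [symmetry; apply Hs|reflexivity].
  - clear H1 H3. match type of H2 with approx (Obj ?x) (Obj ?y) =>
      match goal with |- approx (Obj ?x') (Obj ?y') => replace x' with x; [replace y' with y; [exact H2|]|] end end.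
    + reflexivity.
    + do 7 f_equal. apply functional_extensionality, Hs.
  - match goal with |- approx (Obj ?x) (Obj ?y) => replace y with x; [apply approx_refl|] end.
    do 6 f_equal.
Qed.

(** Codes a disjoint union of two scopes: even indices for the source, odd ones for the target. *)
Definition inter {A} (h h' : nat -> A) (n : nat) : A :=
  if Nat.even n then h (Nat.div2 n) else h' (Nat.div2 n).

Lemma inter_even {A} (h h' : nat -> A) i : inter h h' (2 * i) = h i.
Proof. unfold inter. rewrite Nat.even_mul, Nat.div2_double. reflexivity. Qed.

Lemma inter_odd {A} (h h' : nat -> A) i : inter h h' (S (2 * i)) = h' i.
Proof.
  unfold inter. rewrite Nat.div2_succ_double. rewrite Nat.even_succ, <- Nat.negb_even, Nat.even_mul. reflexivity.
Qed.

Lemma eval_rename s (o : expr s) P Q F G :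
  (forall i, F i = P i) -> (forall i, G i = (Q i, [])) ->
  eval o F G [] = ren P Q (eval o id_ env_id []).
Proof. intros HF HG. rewrite ren_eval. apply eval_ext; auto. Qed.

Lemma eval_Nam a t f g l : eval (Nam a t) f g l = Nam (fst (g a)) (eval t f g (snd (g a))).
Proof. reflexivity. Qed.
Lemma eval_Lam t f g u l :
  eval (Lam t) f g (u :: l) = ESub (eval t (up f) (env_S_var g) (map (ren S id_) l)) u.
Proof. reflexivity. Qed.
Lemma eval_ESub t u f g l :
  eval (ESub t u) f g l = ESub (eval t (up f) (env_S_var g) (map (ren S id_) l)) (eval u f (drop g) []).
Proof. reflexivity. Qed.

Lemma eval_Lam_nil t f g : eval (Lam t) f g [] = Lam (eval t (up f) (env_S_var g) []).
Proof. reflexivity. Qed.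
Lemma eval_Mu c f g l :
  eval (Mu c) f g l =
  if isnil l || lin0 c then Mu (eval c f (env_cons (0, map (ren id_ S) l) (env_S_nam g)) [])
  else Mu (Rep (eval c f (env_cons (0, []) (env_S_nam (env_S_nam g))) []) 0 (mkst (map (ren id_ S) l))).
Proof. reflexivity. Qed.

Section Reify.
Variables (f : nat -> nat) (g : env) (a b A : nat) (u : expr Tm) (la : list (expr Tm)).
Hypothesis Hg : plain_env g.
Hypothesis Ha : g a = (A, u :: la).

(* The term [u], which lives in the target scope of [f] and [g], is made part
   of the evaluated object by interleaving this scope with the source scope;
   the name 0 is mapped to [A] with the remaining terms [la]. *)
Let p (i : nat) := 2 * i.
Let q (i : nat) := S (2 * i).
Let u' := ren (fun i => S (2 * i)) (fun i => S (S (2 * i))) u.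
Let f1 := inter f id_.
Let g1 : env := env_cons (A, la) (inter g env_id).

Lemma reify_f i : f1 (p i) = f i.
Proof. apply inter_even. Qed.
Lemma reify_g i : g1 (q i) = g i.
Proof. apply inter_even. Qed.

(** Odd indices return to the target indices they code, with no awaiting arguments, so [u']
    evaluates like [u] in the identity environment up to renaming, and [eval_plain] recovers [u]. *)
Lemma reify_u P Q F G :
  (forall i, F (S i) = P (f1 i)) -> (forall i, G (S i) = pren P Q (g1 i)) ->
  eqv (eval (ren S S u') F (drop G) []) (ren P Q u).
Proof.
  intros HF HG.
  assert (Hu : isplain u) by (specialize (Hg a); rewrite Ha in Hg; now inversion Hg).
  unfold u'. rewrite ren_ren, eval_ren, (eval_rename _ _ P Q).
  - destruct (eval_plain _ u [] Hu (Forall_nil _) (or_intror eq_refl)) as [_ H].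
    exact (eqv_ren P Q _ _ H).
  - intro. rewrite HF. f_equal. apply inter_odd.
  - intro i. unfold drop. rewrite HG. unfold g1, env_cons. now rewrite inter_odd.
Qed.

Lemma plain_env_reify : plain_env g1.
Proof.
  pose proof (Hg a) as H. rewrite Ha in H. inversion H; subst.
  apply plain_env_cons; auto. intro i. unfold inter. destruct (Nat.even i); [apply Hg|constructor].
Qed.

(** Compares two ways of supplying [u] to the abstraction: through the environment at [a], or as a
    substitution written in the object. The bodies have equal values; the argument is recovered up
    to equivalence. *)
Lemma reify_pop P Q F F' G G' c :
  (forall i, F (S i) = P (f i)) -> (forall i, F' (S i) = P (f1 i)) -> F 0 = F' 0 ->
  (forall i, G (S i) = pren P Q (g i)) -> (forall i, G' (S i) = pren P Q (g1 i)) -> G 0 = G' 0 ->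
  plain_env G ->
  eqv (eval (Nam (S a) (Lam (Mu c))) F G [])
      (eval (Nam 1 (ESub (Mu (ren (up (up p)) (up (up q)) c)) (ren S S u'))) F' G' []).
Proof.
  intros HF HF' HF0 HG HG' HG0 HPG. rewrite !eval_Nam, HG, HG', Ha. cbn [pren g1 env_cons fst snd map].
  rewrite eval_Lam, eval_ESub.
  apply eqv_Nam, eqv_ESub.
  2:{ apply eqv_sym. now apply reify_u. }
  change (Mu (ren (up (up p)) (up (up q)) c)) with (ren (up (up p)) (up q) (Mu c)).
  rewrite eval_ren.
  replace (eval (Mu c) (up F) (env_S_var G)) with
    (eval (Mu c) (fun i => up F' (up (up p) i)) (fun i => env_S_var G' (up q i))).
  2:{ f_equal.
      - apply functional_extensionality; intros [|[|i]]; simpl; auto. rewrite HF, HF', reify_f. reflexivity.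
      - apply functional_extensionality; intros [|i]; unfold env_S_var; cbn [up]; [now rewrite HG0|].
        now rewrite HG, HG', reify_g. }
  apply eqv_refl, plain_eval.
  - intros [|i]; unfold env_S_var; cbn [up]; [rewrite <- HG0; apply plains_ren, HPG|].
    rewrite HG', reify_g, <- HG. apply plains_ren, HPG.
  - pose proof (HPG (S a)) as H. rewrite HG, Ha in H. inversion H; subst. now apply plains_ren.
Qed.

(** The argument [u] awaiting [a] turns the outer abstraction on the left, and the inner one on the
    right, into a substitution. With [u] written as [u'], the claim reduces to [approx_esub_pop]. *)
Lemma eqv_pop_pop c l :
  Forall isplain l ->
  eqv (eval (Nam a (Lam (Mu (Nam (S b) (Lam (Mu c)))))) f g l)
      (eval (Nam b (Lam (Mu (Nam (S a) (Lam (Mu (ren swap swap c))))))) f g l).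
Proof.
  intro Hl.
  set (c2 := ren (up (up p)) (up (up q)) c).
  assert (Hu : isplain u) by (pose proof (Hg a) as H; rewrite Ha in H; now inversion H).
  assert (Hla : Forall isplain la) by (pose proof (Hg a) as H; rewrite Ha in H; now inversion H).
  destruct (approx_esub_pop 0 (q b) c2 u') as [_ H].
  destruct (H f1 g1 l plain_env_reify Hl) as [_ H']. clear H.
  eapply eqv_trans; [|eapply eqv_trans; [exact H'|]]; clear H'.
  - rewrite !eval_Nam, Ha. cbn [g1 env_cons fst snd]. rewrite eval_Lam, eval_ESub. apply eqv_Nam.
    change (Mu (Nam (S (q b)) (Lam (Mu c2)))) with (ren (up p) q (Mu (Nam (S b) (Lam (Mu c))))).
    rewrite eval_ren. apply eqv_ESub.
    + replace (fun i => up f1 (up p i)) with (up f).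
      replace (fun i => env_S_var g1 (q i)) with (env_S_var g).
      * apply eqv_refl, plain_eval; auto with plain.
      * apply functional_extensionality; intro; unfold env_S_var. now rewrite reify_g.
      * apply functional_extensionality; intros [|i]; simpl; auto. now rewrite reify_f.
    + apply eqv_sym. rewrite <- (ren_id _ u') . 
      unfold u'. rewrite ren_ren, eval_ren, (eval_rename _ _ id_ id_).
      * rewrite ren_id. apply (eval_plain _ u []); auto.
      * intro; apply inter_odd.
      * intro i. unfold drop. cbn [g1 env_cons id_]. now rewrite inter_odd.
  - rewrite !eval_Nam, (reify_g b).
    set (Y := Nam (S a) (Lam (Mu (ren swap swap c)))).
    set (Y' := Nam 1 (ESub (Mu (ren swap swap c2)) (ren S S u'))).
    assert (HY : Y' = Nam 1 (ESub (Mu (ren (up (up p)) (up (up q)) (ren swap swap c))) (ren S S u'))).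
    { unfold Y', c2. rewrite !ren_ren. do 3 f_equal. apply ren_ext; intros [|[|i]]; reflexivity. }
    assert (HL : lin0 Y' = lin0 Y).
    { unfold Y, lin0. rewrite HY, !occ_Nam, occ_ESub, occ_0_S, occ_Lam, !occ_Mu. do 2 f_equal.
      unfold occ. rewrite !weight_ren. rewrite Nat.mul_0_r, Nat.add_0_r.
      apply weight_ext; intros [|[|i]]; reflexivity. }
    (* The other abstraction stays one or becomes a substitution, depending on the arguments
       awaiting [b]; by [HL], the [mu] below it takes the same branch on both sides. *)
    apply eqv_sym. apply eqv_Nam. pose proof (Hg b) as Hb. destruct (snd (g b)) as [|v l'].
    + rewrite !eval_Lam_nil, !eval_Mu. cbn [isnil orb map]. apply eqv_Lam, eqv_Mu. rewrite HY. apply (reify_pop S S); auto.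
      1,2: intro; unfold env_S_nam, env_S_var; cbn [env_cons]; now rewrite pren_pren.
      auto with plain.
    + inversion Hb; subst. rewrite !eval_Lam, !eval_Mu, HL. apply eqv_ESub; [|now apply eqv_refl].
      destruct (isnil (map (ren S id_) l') || lin0 Y) eqn:E; apply eqv_Mu.
      * rewrite HY. apply (reify_pop S S); auto.
        1,2: intro; unfold env_S_nam, env_S_var; cbn [env_cons]; now rewrite pren_pren.
        auto 6 with plain.
      * apply orb_false_elim in E. apply eqv_Rep; rewrite ?lin0_eval, ?HL; try tauto.
        -- rewrite HY. apply (reify_pop S (fun i => S (S i))); auto.
           1,2: intro; unfold env_S_nam, env_S_var; cbn [env_cons]; now rewrite !pren_pren.
           auto 6 with plain.
        -- apply eqvl_refl. auto with plain.
Qed.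
End Reify.

Lemma approx_pop_pop a b c :
  approx (Nam a (Lam (Mu (Nam (S b) (Lam (Mu c))))))
         (Nam b (Lam (Mu (Nam (S a) (Lam (Mu (ren swap swap c))))))).
Proof.
  assert (Hs : forall i, swap (swap i) = i) by (intros [|[|i]]; reflexivity).
  split.
  { intro n. rewrite !occ_Nam, !occ_Lam, !occ_Mu, !occ_Nam, !occ_Lam, !occ_Mu.
    replace (occ (S (S n)) (ren swap swap c)) with (occ (S (S n)) c);
      [change (delta (S n) (S a)) with (delta n a); change (delta (S n) (S b)) with (delta n b); lia|].
    unfold occ. rewrite weight_ren. apply weight_ext; intros [|[|i]]; reflexivity. }
  intros f g l Hg Hl. split; [reflexivity|].
  destruct (g a) as [A [|u la]] eqn:Ha.
  - destruct (g b) as [B [|u lb]] eqn:Hb.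
    + assert (HP1 := plain_eval _ (Nam a (Lam (Mu (Nam (S b) (Lam (Mu c)))))) f g l Hg Hl).
      assert (HP2 := plain_eval _ (Nam b (Lam (Mu (Nam (S a) (Lam (Mu (ren swap swap c))))))) f g l Hg Hl).
      cbn [eval] in *. rewrite Ha, Hb in *. cbn [fst snd isnil orb map env_cons] in *.
      unfold env_S_nam, env_S_var in *. rewrite Ha, Hb in *. cbn [pren fst snd map isnil orb] in *.
      apply eqv_rule; auto.
      eapply rule_conv; [apply (@struct_pop_pop A B)|reflexivity|].
      do 6 f_equal. rewrite eval_ren, ren_eval. apply eval_ext; [| |reflexivity].
      * intros [|[|i]]; reflexivity.
      * intros [|[|i]]; cbn [swap env_cons]; try reflexivity.
        rewrite !pren_pren. reflexivity.
    (* Only [b] has an argument: the claim is read from right to left, with [ren swap swap c] in the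
       role of [c]. *)
    + rewrite <- (ren_id _ c) at 1.
      replace (ren id_ id_ c) with (ren swap swap (ren swap swap c))
        by (rewrite ren_ren; apply ren_ext; intro; apply Hs).
      apply eqv_sym. eapply eqv_pop_pop; eauto.
  - eapply eqv_pop_pop; eauto.
Qed.

(** * Plain reduction and the tau rules preserve evaluation *)

Lemma subst_ctx_rect (P : ctx Tm Tm -> Prop) :
  P CTHole -> (forall K u, subst_ctx K -> P K -> P (CESubL K u)) ->
  forall K, subst_ctx K -> P K.
Proof.
  intros H1 H2 K.
  enough (H : forall h r (K : ctx h r), subst_ctx K ->
    match h, r return ctx h r -> Prop with Tm, Tm => P | _, _ => fun _ => True end K)
    by exact (H Tm Tm K).
  clear K. intros h r K; induction K; intros HK; try contradiction HK; auto.
  destruct h; auto.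
Qed.

Lemma approx_eval s (o p : expr s) :
  (forall n, occ n o = occ n p) -> (forall f g l, eval o f g l = eval p f g l) -> approx o p.
Proof.
  intros Hst He. split; [exact Hst|]. intros. rewrite He. now apply beq_refl, plain_eval.
Qed.

Lemma approx_beta t u : approx (App (Lam t) u) (ESub t u).
Proof. apply approx_eval; reflexivity. Qed.

(** The fresh name occurs once, as the target of the replacement, so the outer [mu] always passes
    its arguments on, and they join [u]. The values are equal. *)
Lemma approx_dM c u : approx (App (Mu c) u) (Mu (Rep (ren id_ (up S) c) 0 (One (ren id_ S u)))).
Proof.
  assert (H1 : forall n, occ (S (S n)) (ren id_ (up S) c) = occ (S n) c).
  { intro n. unfold occ. rewrite weight_ren. apply weight_ext; intros [|]; reflexivity. }
  apply approx_eval.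
  - intro n. rewrite occ_App, !occ_Mu, occ_Rep, occ_One, occ_S, H1. change (delta (S n) 0) with 0. lia.
  - intros f g l. rewrite eval_Mu. cbn [eval isnil orb].
    replace (lin0 (Rep (ren id_ (up S) c) 0 (One (ren id_ S u)))) with true.
    2:{ unfold lin0. rewrite occ_Rep, occ_One, occ_0_S.
        replace (occ 1 (ren id_ (up S) c)) with 0; [reflexivity|].
        unfold occ. rewrite weight_ren. symmetry; apply weight_0; intros [|]; reflexivity. }
    rewrite orb_true_r, lin0_ren_up. cbn [eval fst snd env_cons stl app map].
    match goal with |- context[eval (ren id_ S u) f ?G []] =>
      replace (eval (ren id_ S u) f G []) with (ren id_ S (eval u f (drop g) []))
        by (rewrite eval_ren, ren_eval; reflexivity) end.
    destruct (lin0 c); [f_equal|do 2 f_equal]; rewrite eval_ren;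
      apply eval_ext; try reflexivity; intros [|]; reflexivity.
Qed.

Lemma app_stack_apps k (s : expr k) t : app_stack t s = apps t (stl s).
Proof. revert t; induction s; intros; simpl; auto. Qed.

Lemma eval_apps l' t f g l :
  eval (apps t l') f g l = eval t f g (map (fun u => eval u f (drop g) []) l' ++ l).
Proof. revert t; induction l'; intros; simpl; [|rewrite IHl']; reflexivity. Qed.

Lemma stl_eval (s : expr St) f g :
  stl (eval s f (drop g) []) = map (fun u => eval u f (drop g) []) (stl s).
Proof.
  enough (H : forall k (s : expr k), k = St ->
    stl (eval s f (drop g) []) = map (fun u => eval u f (drop g) []) (stl s)) by auto.
  clear s. induction s; intros E; try discriminate E; simpl; [reflexivity|].
  f_equal. now apply IHs2.
Qed.

Lemma stl_stack_cat (s' s : expr St) : stl (stack_cat s' s) = stl s' ++ stl s.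
Proof.
  enough (H : forall k (s' : expr k), k = St -> stl (stack_cat s' s) = stl s' ++ stl s) by auto.
  clear s'. induction s'; intros E; try discriminate E; simpl; [reflexivity|].
  f_equal. now apply IHs'2.
Qed.

Lemma occ_stl n (s : expr St) : occ n s = occ_sum n (stl s).
Proof. now apply weight_stl. Qed.

Lemma approx_N t a s : approx (Rep (Nam 0 (ren id_ S t)) a s) (Nam a (app_stack t s)).
Proof.
  rewrite app_stack_apps. apply approx_eval.
  - intro n. rewrite occ_Rep, !occ_Nam, occ_S, occ_stl.
    replace (occ n (apps t (stl s))) with (occ n t + 2 * occ_sum n (stl s)) by (symmetry; apply weight_apps).
    change (delta (S n) 0) with 0. lia.
  - intros f g l. cbn [eval].
    replace (lin0 (Nam 0 (ren id_ S t))) with true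
      by (unfold lin0; now rewrite occ_Nam, occ_0_S).
    cbn [fst snd env_cons]. f_equal. rewrite eval_ren, eval_apps, stl_eval. reflexivity.
Qed.

Lemma approx_C c s' a s :
  approx (Rep (Rep (ren id_ (up S) c) 0 (ren id_ S s')) a s) (Rep c a (stack_cat s' s)).
Proof.
  assert (H1 : forall n, occ (S (S n)) (ren id_ (up S) c) = occ (S n) c).
  { intro n. unfold occ. rewrite weight_ren. apply weight_ext; intros [|]; reflexivity. }
  apply approx_eval.
  - intro n. rewrite !occ_Rep, occ_S, H1, !occ_stl, stl_stack_cat, occ_sum_app.
    change (delta (S n) 0) with 0. lia.
  - intros f g l. cbn [eval]. rewrite lin0_ren_up.
    replace (lin0 (Rep (ren id_ (up S) c) 0 (ren id_ S s'))) with true.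
    2:{ unfold lin0. rewrite occ_Rep, occ_0_S.
        replace (occ 1 (ren id_ (up S) c)) with 0; [reflexivity|].
        unfold occ. rewrite weight_ren. symmetry; apply weight_0; intros [|]; reflexivity. }
    cbn [fst snd env_cons].
    match goal with |- context[stl (eval (ren id_ S s') f ?G [])] =>
      replace (eval (ren id_ S s') f G []) with (eval s' f (drop g) []) end.
    2:{ rewrite eval_ren. reflexivity. }
    rewrite !stl_eval, stl_stack_cat, map_app, <- app_assoc.
    destruct (lin0 c); [|f_equal]; rewrite eval_ren; apply eval_ext; try reflexivity;
      intros [|]; reflexivity.
Qed.

(** The substitutions of [L] are crossed one at a time, by [approx_sub] read from right to left with
    an application as context. *)
Lemma approx_L (L : ctx Tm Tm) t u :
  subst_ctx L -> approx (App (plug L t) u) (plug L (App t (under L u))).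
Proof.
  intro HL; revert u; pattern L; revert L HL; apply subst_ctx_rect.
  - intro u. rewrite under_0; auto using approx_refl.
  - intros L v HL IH u. cbn [plug].
    eapply approx_trans; [apply approx_sym|].
    + pose proof (approx_sub (CAppL CTHole u) (plug L t) v I) as H.
      cbn [plug cren nvar] in H. rewrite rot_0, ren_id, under_0 in H by reflexivity. exact H.
    + specialize (IH (ren S id_ u)).
      replace (under (CESubL L v) u) with (under L (ren S id_ u)).
      * exact (approx_ctx _ _ (CESubL CTHole v) _ _ IH).
      * unfold under. rewrite ren_ren. apply ren_ext; intro; simpl; unfold id_; lia.
Qed.

(** Each rule is a permutation followed by a contraction in the hole: [approx_L] crosses the context
    of dB and dM, [approx_rep] that of N and C. *)
Lemma approx_plain_rule o p : plain_rule o p -> approx o p.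
Proof.
  destruct 1 as [L t u HL|L c u HL|K t a s HK|K c s' a s HK].
  - eapply approx_trans; [now apply approx_L|]. apply approx_ctx, approx_beta.
  - eapply approx_trans; [now apply approx_L|]. apply approx_ctx, approx_dM.
  - pose proof (approx_rep K (Nam 0 (ren id_ S t)) a s HK) as H. cbn [ren] in H.
    rewrite ren_ren in H. eapply approx_trans; [exact H|]. apply approx_ctx, approx_N.
  - pose proof (approx_rep K (Rep (ren id_ (up S) c) 0 (ren id_ S s')) a s HK) as H. cbn [ren] in H.
    rewrite !ren_ren, up_comp in H. eapply approx_trans; [exact H|]. apply approx_ctx, approx_C.
Qed.

Lemma approx_plain_step o p : clos_refl_trans object plain_step o p -> approx o p.
Proof.
  induction 1 as [? ? []| |]; eauto using approx_refl, approx_trans, approx_plain_rule.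
  now apply approx_ctx, approx_plain_rule.
Qed.

(** The redex becomes a substitution, which crosses [K]. Three choices of [K] give [tau_lam_lam],
    [tau_app_lam] and [tau_lam_mu]. *)
Lemma approx_lam_linear (K : ctx Tm Tm) t u :
  linear K ->
  approx (App (Lam (plug (cren S id_ K) (ren (rot (nvar K)) id_ t))) u)
         (plug K (App (Lam t) (under K u))).
Proof.
  intro HK. eapply approx_trans; [apply approx_beta|].
  eapply approx_trans; [now apply approx_sub|]. apply approx_ctx, approx_sym, approx_beta.
Qed.

(** The argument becomes a replacement by dM, the replacement and then the [mu] cross [K], and dM
    read backwards restores the application. *)
Lemma approx_mu_app_linear (K : ctx Cm Cm) a c u :
  linear K ->
  approx (Nam a (App (Mu (plug (cren id_ S K) (ren id_ (rot (nnam K)) c))) u))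
         (plug K (Nam (nnam K + a) (App (Mu c) (under K u)))).
Proof.
  intro HK. set (m := nnam K).
  eapply approx_trans; [exact (approx_ctx _ _ (CNam a CTHole) _ _ (approx_dM _ _))|].
  pose proof (approx_rep (cren id_ S K) (ren id_ (up (upn m S)) c) 0 (One (ren id_ S u))
    (linear_cren _ _ _ _ _ HK)) as H1.
  apply (approx_ctx _ _ (CNam a (CMu CCHole))) in H1.
  pose proof (approx_mu K a (Rep (ren id_ (up S) c) 0 (One (ren id_ S (under K u)))) HK) as H2.
  cbn [plug] in *. eapply approx_trans; [|eapply approx_trans; [exact H1|eapply approx_trans]].
  - match goal with |- approx (Obj ?x) (Obj ?y) => replace y with x; [apply approx_refl|] end.
    rewrite ren_plug, !cren_cren, !nvar_cren, !nnam_cren, !ren_ren. fold m. do 4 f_equal.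
    apply ren_ext; intro; [now rewrite upn_id|apply upn_rot].
  - match type of H2 with approx (Obj ?x) _ =>
      match goal with |- approx (Obj ?y) _ => replace y with x; [exact H2|] end end.
    rewrite nnam_cren. fold m. cbn [ren rot]. rewrite !ren_ren, Nat.add_0_r. do 4 f_equal.
    + apply ren_ext; [reflexivity|]. intros [|i]; simpl; [reflexivity|]. now rewrite skip_upn.
    + unfold under. cbn [ren]. rewrite !ren_ren, nvar_cren, nnam_cren. fold m. f_equal.
      apply ren_ext; intro; [reflexivity|]. rewrite rot_S. apply upn_add.
  - apply approx_ctx. exact (approx_ctx _ _ (CNam _ CTHole) _ _ (approx_sym _ _ (approx_dM _ _))).
Qed.

Lemma swap_swap s (o : expr s) : ren id_ swap (ren id_ swap o) = o.
Proof. rewrite ren_ren. rewrite <- (ren_id _ o) at 2. apply ren_ext; intro i; [reflexivity|now destruct i as [|[|]]]. Qed.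
Lemma swap_swap' s (o : expr s) : ren swap id_ (ren swap id_ o) = o.
Proof. rewrite ren_ren. rewrite <- (ren_id _ o) at 2. apply ren_ext; intro i; [now destruct i as [|[|]]|reflexivity]. Qed.

Lemma approx_conv s (o p o' p' : expr s) : approx o' p' -> o = o' -> p = p' -> approx o p.
Proof. now intros ? -> ->. Qed.

Ltac linear_instance H :=
  eapply approx_conv; [exact (H I)| |];
  unfold under; cbn [plug cren ren nvar nnam];
  rewrite ?rot_1, ?rot_0, ?up_id, ?swap_swap, ?swap_swap', ?ren_id; reflexivity.

Lemma approx_tau_rule o p : tau_rule o p -> approx o p.
Proof.
  destruct 1 as [t v|t v u|b t u|a b c u v|a b c u|a b c|t|a b c|a b c|a b c v].
  (* The tau rules write the exchange of indices on the right, whereas [rot 1] puts it on the left;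
     the body is therefore instantiated by its own exchange, here and below. *)
  - pose proof (approx_lam_linear (CLam CTHole) (ren swap id_ t) v) as H. linear_instance H.
  - pose proof (approx_lam_linear (CAppL CTHole v) t u) as H. linear_instance H.
  - pose proof (approx_lam_linear (CMu (CNam b CTHole)) t u) as H. linear_instance H.
  - pose proof (approx_mu_app_linear (CNam b (CAppL (CMu CCHole) v)) a (ren id_ swap c) u) as H. linear_instance H.
  - pose proof (approx_mu_app_linear (CNam b (CLam (CMu CCHole))) a (ren id_ swap c) u) as H. linear_instance H.
  - apply approx_pop_pop.
  - apply approx_theta.
  - pose proof (approx_mu (CNam b (CMu CCHole)) a (ren id_ swap c)) as H. linear_instance H.
  - pose proof (approx_mu (CNam b (CLam (CMu CCHole))) a (ren id_ swap c)) as H. linear_instance H.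
  - pose proof (approx_mu (CNam b (CAppL (CMu CCHole) v)) a (ren id_ swap c)) as H. linear_instance H.
Qed.

Lemma approx_tau o p : tau_equiv o p -> approx o p.
Proof.
  induction 1; eauto using approx_tau_rule, approx_refl, approx_sym, approx_trans, approx_ctx.
Qed.

(** * Existence of plain normal forms *)

Lemma neutral_subst (L : ctx Tm Tm) t : subst_ctx L -> neutral (plug L t) = neutral t.
Proof. intro HL. pattern L. revert L HL. now apply subst_ctx_rect. Qed.

(** In N and C redexes the bound name has weight 1, against [lin0 c = false]; in dB and dM redexes
    the function part is not neutral. *)
Lemma plain_rule_redex o p : plain_rule o p -> ~ isplainO o.
Proof.
  destruct 1 as [L t u HL|L c u HL|K t a s HK|K c s' a s HK]; simpl; intros (H1 & H2 & H3).
  - now rewrite neutral_subst in H3.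
  - now rewrite neutral_subst in H3.
  - pose proof (lin0_plug_rot K id_ (Nam 0 (ren id_ S t)) HK) as E. cbn [ren] in E.
    rewrite ren_ren in E. apply (fun E => eq_trans (eq_sym E) H3) in E.
    unfold lin0 in E. now rewrite occ_Nam, occ_0_S in E.
  - pose proof (lin0_plug_rot K id_ (Rep (ren id_ (up S) c) 0 (ren id_ S s')) HK) as E. cbn [ren] in E.
    rewrite !ren_ren, up_comp in E. apply (fun E => eq_trans (eq_sym E) H3) in E.
    unfold lin0 in E. rewrite occ_Rep, occ_0_S in E.
    replace (occ 1 (ren id_ (up S) c)) with 0 in E; [discriminate E|].
    unfold occ. rewrite weight_ren. symmetry; apply weight_0; intros [|]; reflexivity.
Qed.

Lemma up_skip n : up (skip n) = skip (S n).
Proof.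
  apply functional_extensionality; intros [|i]; [reflexivity|]; unfold skip; cbn [up].
  destruct (Nat.ltb_spec i n), (Nat.ltb_spec (S i) (S n)); lia.
Qed.

Lemma skip_surj n a : a <> n -> exists b, a = skip n b.
Proof.
  intro H. unfold skip. destruct (Nat.lt_ge_cases a n).
  - exists a. destruct (Nat.ltb_spec a n); lia.
  - exists (a - 1). destruct (Nat.ltb_spec (a - 1) n); lia.
Qed.

Lemma delta_0 n a : delta n a = 0 -> a <> n.
Proof. unfold delta. destruct (Nat.eqb_spec a n); lia. Qed.

(** Turns the numerical test for freshness into the renaming by [skip] that expresses the side
    conditions of N and C. *)
Lemma strengthen n s (o : expr s) : occ n o = 0 -> exists o', o = ren id_ (skip n) o'.
Proof.
  revert n; induction o; intros m H;
    rewrite ?occ_App, ?occ_Lam, ?occ_Mu, ?occ_ESub, ?occ_Nam, ?occ_Rep, ?occ_One, ?occ_Push in H;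
    repeat match goal with
    | IH : forall n, occ n ?o = 0 -> _, H : _ |- _ =>
        (destruct (IH m) as [? ->]; [lia|]) || (destruct (IH (S m)) as [? ->]; [lia|]); clear IH
    end.
  - now exists (Var n).
  - now exists (App x0 x).
  - exists (Lam x). simpl. now rewrite up_id.
  - exists (Mu x). simpl. now rewrite up_skip.
  - exists (ESub x0 x). simpl. now rewrite up_id.
  - destruct (skip_surj m n) as [b ->]; [apply delta_0; lia|]. now exists (Nam b x).
  - destruct (skip_surj m n) as [b ->]; [apply delta_0; lia|].
    exists (Rep x0 b x). simpl. now rewrite up_skip.
  - now exists (One x).
  - now exists (Push x0 x).
Qed.

(** The body of an N or C redex, for an arbitrary name [n] instead of 0 so that induction can pass
    below name binders. *)
Definition linear_occ (n : nat) {r} (o : expr r) : Prop :=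
  exists K : ctx Cm r, linear K /\
  ((exists t, o = plug (cren id_ (skip n) K)
      (Nam (nnam K + n) (ren id_ (skip (nnam K + n)) t))) \/
   (exists c s, o = plug (cren id_ (skip n) K)
      (Rep (ren id_ (up (skip (nnam K + n))) c) (nnam K + n) (ren id_ (skip (nnam K + n)) s)))).

Lemma linear_occ_ctx n n' r r' (o : expr r) (F : ctx Cm r -> ctx Cm r') (G : expr r -> expr r') :
  (forall K, linear K -> linear (F K)) ->
  (forall K, nnam (F K) + n = nnam K + n') ->
  (forall K X, plug (cren id_ (skip n) (F K)) X = G (plug (cren id_ (skip n') K) X)) ->
  linear_occ n' o -> linear_occ n (G o).
Proof.
  intros HF Hn HG (K & HK & [(t & ->)|(c & s & ->)]); exists (F K); split; auto;
    rewrite Hn; [left; exists t|right; exists c, s]; now rewrite HG.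
Qed.

(** An occurrence in an argument would weigh at least 2, so the only one is found by following the
    spine; all side components have weight 0 and are strengthened. *)
Lemma occ_1_linear n r (o : expr r) : r <> St -> occ n o = 1 -> linear_occ n o.
Proof.
  revert n; induction o; intros m Hr H; try congruence;
    rewrite ?occ_App, ?occ_Lam, ?occ_Mu, ?occ_ESub, ?occ_Nam, ?occ_Rep in H.
  - discriminate H.
  - destruct (strengthen m _ o2) as [u ->]; [lia|].
    apply (linear_occ_ctx m m _ _ o1 (fun K => CAppL K u) (fun o => App o (ren id_ (skip m) u)));
      auto. apply IHo1; [discriminate|lia].
  - apply (linear_occ_ctx m m _ _ o (@CLam Cm) Lam); auto; try (now apply IHo).
    intros; simpl. now rewrite up_id.
  - apply (linear_occ_ctx m (S m) _ _ o (@CMu Cm) Mu); auto; try (now apply IHo).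
    intros; simpl. now rewrite up_skip.
  - destruct (strengthen m _ o2) as [u ->]; [lia|].
    apply (linear_occ_ctx m m _ _ o1 (fun K => CESubL K u) (fun o => ESub o (ren id_ (skip m) u)));
      auto.
    + intros; simpl. now rewrite up_id.
    + apply IHo1; [discriminate|lia].
  - destruct (Nat.eq_dec n m) as [->|Hn].
    + destruct (strengthen m _ o) as [t ->]; [unfold delta in H; rewrite Nat.eqb_refl in H; lia|].
      exists CCHole. split; [exact I|]. left. now exists t.
    + destruct (skip_surj m n Hn) as [b ->].
      apply (linear_occ_ctx m m _ _ o (CNam b) (Nam (skip m b))); auto.
      apply IHo; [discriminate|]. revert H. unfold delta.
      destruct (Nat.eqb_spec (skip m b) m); [congruence|lia].
  - destruct (strengthen m _ o2) as [u ->]; [lia|].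
    destruct (Nat.eq_dec n m) as [->|Hn].
    + destruct (strengthen (S m) _ o1) as [c ->]; [unfold delta in H; rewrite Nat.eqb_refl in H; lia|].
      exists CCHole. split; [exact I|]. right. exists c, u. simpl. now rewrite up_skip.
    + destruct (skip_surj m n Hn) as [b ->].
      apply (linear_occ_ctx m (S m) _ _ o1 (fun K => CRepL K b u)
        (fun o => Rep o (skip m b) (ren id_ (skip m) u))); auto.
      * intros; simpl. now rewrite up_skip.
      * apply IHo1; [discriminate|]. revert H. unfold delta at 1.
        destruct (Nat.eqb_spec (skip m b) m); [congruence|].
        unfold occ at 2; rewrite weight_ren. lia.
Qed.

Definition has_redex {s} (o : expr s) : Prop :=
  exists h (K : ctx h s) (l r : expr h), o = plug K l /\ plain_rule l r.

Lemma has_redex_ctx s s' (F : forall h, ctx h s -> ctx h s') (G : expr s -> expr s') (o : expr s) :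
  (forall h (K : ctx h s) l, plug (F h K) l = G (plug K l)) -> has_redex o -> has_redex (G o).
Proof. intros H (h & K & l & r & -> & Hr). exists h, (F h K), l, r. now rewrite H. Qed.

Lemma neutral_false s (o : expr s) :
  neutral o = false ->
  match s return expr s -> Prop with
  | Tm => fun o => exists L, subst_ctx L /\
      ((exists t, o = plug L (Lam t)) \/ (exists c, o = plug L (Mu c)))
  | _ => fun _ => True
  end o.
Proof.
  induction o; simpl; intro H; try discriminate H; auto.
  - exists CTHole; simpl; eauto.
  - exists CTHole; simpl; eauto.
  - destruct (IHo1 H) as (L & HL & [[t ->]|[c ->]]); exists (CESubL L o2); simpl; eauto.
Qed.

Lemma plain_or_redex s (o : expr s) : isplain o \/ has_redex o.
Proof.
  induction o; simpl; auto.
  - destruct IHo1 as [H1|H]; [|right; now apply (has_redex_ctx _ _ (fun h K => CAppL K o2) (fun o => App o o2))].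
    destruct IHo2 as [H2|H]; [|right; now apply (has_redex_ctx _ _ (fun h K => CAppR o1 K) (App o1))].
    destruct (neutral o1) eqn:E; auto. right. apply neutral_false in E.
    destruct E as (L & HL & [[t ->]|[c ->]]); exists Tm, CTHole.
    + exists (App (plug L (Lam t)) o2), (plug L (ESub t (under L o2))). split; auto. now constructor.
    + eexists (App (plug L (Mu c)) o2), _. split; auto. now constructor.
  - destruct IHo as [H1|H]; [auto|right; now apply (has_redex_ctx _ _ (@CLam) Lam)].
  - destruct IHo as [H1|H]; [auto|right; now apply (has_redex_ctx _ _ (@CMu) Mu)].
  - destruct IHo1 as [H1|H]; [|right; now apply (has_redex_ctx _ _ (fun h K => CESubL K o2) (fun o => ESub o o2))].
    destruct IHo2 as [H2|H]; [auto|right; now apply (has_redex_ctx _ _ (fun h K => CESubR o1 K) (ESub o1))].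
  - destruct IHo as [H1|H]; [auto|right; now apply (has_redex_ctx _ _ (fun h K => CNam n K) (Nam n))].
  - destruct IHo1 as [H1|H]; [|right; now apply (has_redex_ctx _ _ (fun h K => CRepL K n o2) (fun o => Rep o n o2))].
    destruct IHo2 as [H2|H]; [|right; now apply (has_redex_ctx _ _ (fun h K => CRepR o1 n K) (Rep o1 n))].
    destruct (lin0 o1) eqn:E; auto. right. apply Nat.eqb_eq, occ_1_linear in E; [|discriminate].
    assert (Hs : skip 0 = S) by reflexivity.
    destruct E as (K & HK & [(t & ->)|(c & s & ->)]); exists Cm, CCHole;
      rewrite Nat.add_0_r in *; rewrite Hs in *; eexists _, _; split; try reflexivity; now constructor.
  - destruct IHo as [H1|H]; [auto|right; now apply (has_redex_ctx _ _ (@COne) One)].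
  - destruct IHo1 as [H1|H]; [|right; now apply (has_redex_ctx _ _ (fun h K => CPushL K o2) (fun o => Push o o2))].
    destruct IHo2 as [H2|H]; [auto|right; now apply (has_redex_ctx _ _ (fun h K => CPushR o1 K) (Push o1))].
Qed.

Lemma plain_form_isplain o : plain_form o <-> isplainO o.
Proof.
  split.
  - destruct o as [s o]. intro H. destruct (plain_or_redex s o) as [|(h & K & l & r & -> & Hr)]; auto.
    now destruct (H (plug K r) (plain_step_ctx K Hr)).
  - intros H p Hs. destruct Hs as [h r K l l' Hl]. apply plain_rule_redex in Hl.
    apply Hl. now apply isplain_plug in H.
Qed.

(* Termination: an argument only moves down the spine, and each dM or N step
   takes it past a binder or a name, counted by [depth]. *)
Fixpoint depth {s} (o : expr s) : nat :=
  match o with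
  | App t _ | ESub t _ => depth t
  | Lam t | Nam _ t => S (depth t)
  | Mu c => S (depth c)
  | Rep c _ _ => depth c
  | _ => 0
  end.

(** In dM, the application contributes [3 * depth c + 3] and the new replacement [3 * depth c + 2]:
    the factor 3 pays for both summands 1 of a replacement and a strict decrease. In C, the merged
    replacement saves the last summand 1. *)
Fixpoint meas {s} (o : expr s) : nat :=
  match o with
  | Var _ => 0
  | App t u => 3 * depth t + meas t + meas u
  | Lam t | Nam _ t | One t => meas t
  | Mu c => meas c
  | ESub t u => meas t + meas u
  | Rep c _ s => length (stl s) * (3 * depth c + 1) + 1 + meas c + meas s
  | Push t s => meas t + meas s
  end.

Lemma depth_ren f g s (o : expr s) : depth (ren f g o) = depth o.
Proof. revert f g; induction o; intros; simpl; auto. Qed.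

Lemma meas_ren f g s (o : expr s) : meas (ren f g o) = meas o.
Proof.
  revert f g; induction o; intros; simpl; rewrite ?depth_ren, ?stl_ren, ?length_map; auto.
Qed.

Lemma length_stl_plug h r (K : ctx h r) f g X X' :
  r = St -> length (stl (plug K X)) = length (stl (plug (cren f g K) X')).
Proof. revert f g; induction K; intros f g E; try discriminate E; simpl; rewrite ?stl_ren, ?length_map; auto. Qed.

Lemma depth_plug h r (K : ctx h r) f g X X' :
  depth X' <= depth X -> depth (plug K X') <= depth (plug (cren f g K) X).
Proof. revert f g; induction K; intros; simpl; rewrite ?depth_ren; auto using le_n_S. Qed.

(** The offsets avoid subtraction: [b] is the mass brought in by arguments that enter the context,
    and [a = 1] makes the decrease strict. *)
Lemma meas_plug h r (K : ctx h r) f g X X' a b :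
  depth X' <= depth X -> meas X' + a <= meas X + b ->
  meas (plug K X') + a <= meas (plug (cren f g K) X) + b.
Proof.
  revert f g; induction K; intros f' g' HD HM; simpl; rewrite ?depth_ren, ?meas_ren, ?stl_ren, ?length_map;
    try (eapply IHK; eauto; fail); try (specialize (IHK X X' f' g' HD HM); lia);
    try (specialize (IHK X X' (up f') g' HD HM); lia); auto.
  - pose proof (depth_plug _ _ K f' g' X X' HD). specialize (IHK X X' f' g' HD HM). lia.
  - pose proof (depth_plug _ _ K f' (up g') X X' HD). specialize (IHK X X' f' (up g') HD HM).
    enough (length (stl e) * (3 * depth (plug K X') + 1) <=
      length (stl e) * (3 * depth (plug (cren f' (up g') K) X) + 1)) by lia.
    apply Nat.mul_le_mono_l. lia.
  - specialize (IHK X X' f' g' HD HM).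
    rewrite (length_stl_plug _ _ K f' g' X' X eq_refl).
    lia.
Qed.

Lemma depth_linear h r (K : ctx h r) X : linear K -> depth X <= depth (plug K X).
Proof. induction K; simpl; intros H; try contradiction H; auto using le_S. Qed.

Lemma apps_depth t l : depth (apps t l) = depth t.
Proof. revert t; induction l; intros; simpl; rewrite ?IHl; auto. Qed.

Lemma apps_meas t l :
  meas (apps t l) = meas t + length l * (3 * depth t) + list_sum (map meas l).
Proof. revert t; induction l; intros; simpl; rewrite ?IHl; simpl; lia. Qed.

Lemma meas_stl s (o : expr s) : s = St -> meas o = list_sum (map meas (stl o)).
Proof. induction o; intro E; try discriminate E; simpl; rewrite ?IHo2; auto. Qed.

Definition measO (o : object) : nat := match o with Obj e => meas e end.

Lemma map_meas_ren f g (l : list (expr Tm)) : map meas (map (ren f g) l) = map meas l.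
Proof. rewrite map_map. apply map_ext. intro; apply meas_ren. Qed.

Lemma depth_subst (L : ctx Tm Tm) t : subst_ctx L -> depth (plug L t) = depth t.
Proof. intro HL. pattern L. revert L HL. now apply subst_ctx_rect. Qed.

(** The bound on [depth] carries the decrease through enclosing applications and replacements, whose
    measures depend on the depth of their heads. *)
Lemma plain_rule_meas h (l r : expr h) :
  plain_rule l r -> depth r <= depth l /\ meas r < meas l.
Proof.
  enough (H : forall o p, plain_rule o p ->
    match o, p with Obj l, Obj r => depth r <= depth l /\ meas r < meas l end)
    by (intro Hr; exact (H _ _ Hr)).
  destruct 1 as [L t u HL|L c u HL|K t a s HK|K c s' a s HK].
  - simpl. rewrite !depth_subst by assumption. split; [simpl; lia|].
    pose proof (meas_plug _ _ L id_ id_ (Lam t) (ESub t (under L u)) 1 (3 * depth (Lam t) + meas u)) as H.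
    rewrite cren_id in H. unfold under in *. simpl in *. rewrite meas_ren in *. lia.
  - simpl. rewrite !depth_subst by assumption. split; [simpl; rewrite depth_ren; lia|].
    pose proof (meas_plug _ _ L id_ id_ (Mu c) (Mu (Rep (ren id_ (up S) c) 0 (One (ren id_ S (under L u))))) 1 (3 * depth (Mu c) + meas u)) as H.
    rewrite cren_id in H. unfold under in *. simpl in *. rewrite !meas_ren, !depth_ren in *. lia.
  - split.
    + simpl. apply depth_plug. simpl. now rewrite app_stack_apps, apps_depth, depth_ren.
    + simpl. set (X := Nam (nnam K) (ren id_ (skip (nnam K)) t)).
      pose proof (depth_linear _ _ (cren id_ S K) X (linear_cren _ _ _ _ _ HK)) as HD.
      pose proof (meas_plug _ _ K id_ S X (Nam (nnam K + a) (app_stack t (under K s))) 1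
        (length (stl s) * (3 * depth (plug (cren id_ S K) X) + 1) + 1 + meas s)) as H.
      revert H. unfold X at 1 2; simpl. unfold under.
      rewrite app_stack_apps, apps_depth, apps_meas, depth_ren, meas_ren, stl_ren, length_map, map_meas_ren.
      rewrite <- meas_stl by reflexivity. intro H.
      assert (HD' : S (depth t) <= depth (plug (cren id_ S K) X)).
      { revert HD. unfold X at 1. simpl. now rewrite depth_ren. }
      assert (length (stl s) * (3 * depth t) <= length (stl s) * (3 * depth (plug (cren id_ S K) X) + 1))
        by (apply Nat.mul_le_mono_l; lia).
      lia.
  - split.
    + simpl. apply depth_plug. simpl. now rewrite depth_ren.
    + simpl. set (X := Rep (ren id_ (up (skip (nnam K))) c) (nnam K) (ren id_ (skip (nnam K)) s')).
      pose proof (depth_linear _ _ (cren id_ S K) X (linear_cren _ _ _ _ _ HK)) as HD.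
      pose proof (meas_plug _ _ K id_ S X (Rep c (nnam K + a) (stack_cat s' (under K s))) 1
        (length (stl s) * (3 * depth (plug (cren id_ S K) X) + 1) + 1 + meas s)) as H.
      revert H. unfold X at 1 2; simpl. unfold under.
      rewrite (meas_stl _ (stack_cat _ _)) by reflexivity.
      rewrite stl_stack_cat, !stl_ren, length_app, map_app, list_sum_app, !length_map, map_meas_ren.
      rewrite <- !meas_stl by reflexivity. rewrite depth_ren, !meas_ren. intro H.
      assert (HD' : depth c <= depth (plug (cren id_ S K) X)).
      { revert HD. unfold X at 1. simpl. now rewrite depth_ren. }
      assert (length (stl s) * (3 * depth c + 1) <= length (stl s) * (3 * depth (plug (cren id_ S K) X) + 1))
        by (apply Nat.mul_le_mono_l; lia).
      lia.
Qed.

Lemma plain_step_meas o p : plain_step o p -> measO p < measO o.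
Proof.
  destruct 1 as [h r K l l' Hl]. apply plain_rule_meas in Hl. simpl.
  pose proof (meas_plug _ _ K id_ id_ l l' 1 0) as H. rewrite cren_id in H. lia.
Qed.

Lemma plain_nf_exists o : exists p, plain_nf_of o p.
Proof.
  induction o as [o IH] using (well_founded_induction (Wf_nat.well_founded_ltof _ measO)).
  destruct (classic (exists p, plain_step o p)) as [[p Hp]|Hn].
  - destruct (IH p (plain_step_meas _ _ Hp)) as (q & Hq & Hq').
    exists q. split; auto. eapply rt_trans; [apply rt_step|]; eauto.
  - exists o. split; [apply rt_refl|]. intros p Hp. eauto.
Qed.

Lemma plain_nf_spec o : plain_nf_of o (plain_nf o).
Proof. unfold plain_nf. apply epsilon_spec, plain_nf_exists. Qed.

(** * Tau-equivalence of expansions *)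

Fixpoint expand {s} (o : expr s) : expr s :=
  match o with
  | Var i => Var i
  | App t u => App (expand t) (expand u)
  | Lam t => Lam (expand t)
  | Mu c => Mu (expand c)
  | ESub t u => App (Lam (expand t)) (expand u)
  | Nam a t => Nam a (expand t)
  | Rep c a s => Nam a (apps (Mu (expand c)) (stl (expand s)))
  | One t => One (expand t)
  | Push t s => Push (expand t) (expand s)
  end.

Notation lm := lambda_mu_expr.

Lemma lm_ren f g s (o : expr s) : lm o -> lm (ren f g o).
Proof. revert f g; induction o; intros f' g' H; simpl in *; intuition. Qed.

Lemma lms_ren f g (l : list (expr Tm)) : Forall lm l -> Forall lm (map (ren f g) l).
Proof. induction 1; simpl; auto using lm_ren. Qed.

Lemma lm_apps t l : lm t -> Forall lm l -> lm (apps t l).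
Proof. intros Ht Hl; revert t Ht; induction Hl; intros; simpl; auto. apply IHHl; simpl; auto. Qed.

Lemma lm_expand_gen s (o : expr s) :
  match s with St => Forall lm (stl (expand o)) | _ => lm (expand o) end.
Proof. induction o; simpl in *; auto. apply lm_apps; auto. Qed.

Lemma lm_expand_t (t : expr Tm) : lm (expand t).
Proof. exact (lm_expand_gen _ t). Qed.
Lemma lm_expand_c (c : expr Cm) : lm (expand c).
Proof. exact (lm_expand_gen _ c). Qed.
Lemma lm_expand_s (s : expr St) : Forall lm (stl (expand s)).
Proof. exact (lm_expand_gen _ s). Qed.

Lemma expand_ren f g s (o : expr s) : expand (ren f g o) = ren f g (expand o).
Proof.
  revert f g; induction o; intros; simpl; rewrite ?IHo, ?IHo1, ?IHo2; auto.
  now rewrite ren_apps, stl_ren.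
Qed.

Lemma expand_lm s (o : expr s) : lm o -> expand o = o.
Proof. induction o; simpl; intros; f_equal; tauto. Qed.

Lemma expand_apps t l : expand (apps t l) = apps (expand t) (map expand l).
Proof. revert t; induction l; intros; simpl; rewrite ?IHl; auto. Qed.

Lemma stl_expand s (o : expr s) : s = St -> stl (expand o) = map expand (stl o).
Proof. induction o; intros E; try discriminate E; simpl; rewrite ?IHo2; auto. Qed.

Lemma lm_Nam a t : lm t -> lm (Nam a t).
Proof. auto. Qed.
Lemma lm_Mu c : lm c -> lm (Mu c).
Proof. auto. Qed.
Lemma lm_Lam t : lm t -> lm (Lam t).
Proof. auto. Qed.
Lemma lm_App t u : lm t -> lm u -> lm (App t u).
Proof. simpl; auto. Qed.

#[local] Hint Resolve lm_Nam lm_Mu lm_Lam lm_App lm_ren lms_ren lm_apps lm_expand_t lm_expand_c lm_expand_s : lm.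
Ltac lm_tac := simpl; repeat split; auto 8 with lm.

Definition teq (o p : object) : Prop := tau_equiv o p.

Lemma teq_lm o p : teq o p -> lambda_mu o /\ lambda_mu p.
Proof. induction 1; tauto. Qed.
Lemma teq_refl s (o : expr s) : lm o -> teq o o.
Proof. exact (@cong_refl lambda_mu tau_rule (Obj o)). Qed.
Lemma teq_sym o p : teq o p -> teq p o.
Proof. apply cong_sym. Qed.
Lemma teq_trans o p q : teq o p -> teq p q -> teq o q.
Proof. apply cong_trans. Qed.
Lemma teq_rule s (o p : expr s) : tau_rule o p -> lm o -> lm p -> teq o p.
Proof. intros; apply cong_rule; auto. Qed.

Lemma teq_ctx h r (K : ctx h r) (o p : expr h) :
  teq o p -> lm (plug K o) -> lm (plug K p) -> teq (plug K o) (plug K p).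
Proof. intros; apply cong_ctx; auto. Qed.

Lemma teq_Lam (t u : expr Tm) : teq t u -> teq (Lam t) (Lam u).
Proof. intro H; destruct (teq_lm _ _ H); now apply (teq_ctx _ _ (CLam CTHole)). Qed.
Lemma teq_Mu (t u : expr Cm) : teq t u -> teq (Mu t) (Mu u).
Proof. intro H; destruct (teq_lm _ _ H); now apply (teq_ctx _ _ (CMu CCHole)). Qed.
Lemma teq_Nam a (t u : expr Tm) : teq t u -> teq (Nam a t) (Nam a u).
Proof. intro H; destruct (teq_lm _ _ H); now apply (teq_ctx _ _ (CNam a CTHole)). Qed.
Lemma teq_App (t t' u u' : expr Tm) : teq t t' -> teq u u' -> teq (App t u) (App t' u').
Proof.
  intros H H'; destruct (teq_lm _ _ H), (teq_lm _ _ H'); apply teq_trans with (App t' u).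
  - now apply (teq_ctx _ _ (CAppL CTHole u)).
  - now apply (teq_ctx _ _ (CAppR t' CTHole)).
Qed.

Definition teql : list (expr Tm) -> list (expr Tm) -> Prop := Forall2 (fun t u : expr Tm => teq t u).

Lemma teql_refl l : Forall lm l -> teql l l.
Proof. induction 1; constructor; auto using teq_refl. Qed.
Lemma teql_sym l l' : teql l l' -> teql l' l.
Proof. induction 1; constructor; auto using teq_sym. Qed.
Lemma teql_trans l1 l2 l3 : teql l1 l2 -> teql l2 l3 -> teql l1 l3.
Proof.
  intro H; revert l3; induction H; intros l3 H'; inversion H'; subst; constructor; eauto using teq_trans.
  now apply IHForall2.
Qed.

Lemma teq_apps (t t' : expr Tm) l l' : teq t t' -> teql l l' -> teq (apps t l) (apps t' l').
Proof. intros Ht H; revert t t' Ht; induction H; intros; simpl; auto using teq_App. Qed.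

Lemma teq_theta t : lm t -> teq (Mu (Nam 0 (ren id_ S t))) t.
Proof. intro; apply teq_rule; [constructor| |]; lm_tac. Qed.

Lemma teq_conv s (o p o' p' : expr s) : teq o' p' -> o = o' -> p = p' -> teq o p.
Proof. now intros ? -> ->. Qed.

(** * Cuts and linear contexts *)

(** For empty [l] this is the command [[b]mu a.c] of [struct_mu], otherwise the expansion of a
    replacement; both rules are thus treated at once. *)
Definition cut (b : nat) (l : list (expr Tm)) (c : expr Cm) : expr Cm := Nam b (apps (Mu c) l).

Lemma ren_cut f g b l c :
  ren f g (cut b l c) = cut (g b) (map (ren f g) l) (ren f (up g) c).
Proof. unfold cut; simpl. now rewrite ren_apps. Qed.

Lemma teq_cut b l (c c' : expr Cm) : Forall lm l -> teq c c' -> teq (cut b l c) (cut b l c').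
Proof. intros. apply teq_Nam, teq_apps; auto using teq_Mu, teql_refl. Qed.

Lemma lm_cut b l c : Forall lm l -> lm c -> lm (cut b l c).
Proof. intros; lm_tac. Qed.
#[local] Hint Resolve lm_cut : lm.

(** The three positions of the inner [mu] in the tau rules that exchange two names. *)
Inductive frame := FMu | FLam | FApp (v : expr Tm).

Definition fill (X : frame) (c : expr Cm) : expr Tm :=
  match X with FMu => Mu c | FLam => Lam (Mu c) | FApp v => App (Mu c) v end.
Definition fren (g : nat -> nat) (X : frame) : frame :=
  match X with FApp v => FApp (ren id_ g v) | _ => X end.
Definition fvar (X : frame) : nat -> nat := match X with FLam => S | _ => id_ end.
Definition flm (X : frame) : Prop := match X with FApp v => lm v | _ => True end.

Lemma ren_fill g X c : ren id_ g (fill X c) = fill (fren g X) (ren id_ (up g) c).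
Proof. destruct X; simpl; rewrite ?up_id; reflexivity. Qed.

Lemma lm_fill X c : flm X -> lm c -> lm (fill X c).
Proof. destruct X; simpl; auto. Qed.
Lemma flm_fren g X : flm X -> flm (fren g X).
Proof. destruct X; simpl; auto using lm_ren. Qed.
#[local] Hint Resolve lm_fill flm_fren : lm.

Lemma teq_fill X (c c' : expr Cm) : flm X -> teq c c' -> teq (fill X c) (fill X c').
Proof. destruct X; simpl; auto using teq_Mu, teq_Lam, teq_App, teq_refl. Qed.

Lemma cut_fill_0 b b' X c :
  flm X -> lm c ->
  teq (cut b [] (Nam (S b') (fill (fren S X) c)))
      (Nam b' (fill X (cut (S b) [] (ren id_ swap c)))).
Proof.
  intros HX Hc. destruct X; simpl in *; apply teq_rule; try (lm_tac; fail); constructor.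
Qed.

(** The frames correspond to [tau_mu_app] read from right to left, [tau_app_pop] and
    [tau_app_app]. *)
Lemma cut_fill_1 b b' X u c :
  flm X -> lm u -> lm c ->
  teq (cut b [u] (Nam (S b') (fill (fren S X) c)))
      (Nam b' (fill X (cut (S b) [ren (fvar X) S u] (ren id_ swap c)))).
Proof.
  intros HX Hu Hc. destruct X; simpl in *.
  - apply teq_sym. eapply teq_conv; [apply teq_rule; [exact (tau_mu_app b' b (ren id_ swap c) u)| |]| |];
      lm_tac. now rewrite swap_swap.
  - apply teq_rule; [constructor| |]; lm_tac.
  - apply teq_rule; [constructor| |]; lm_tac.
Qed.

Lemma apps_app t l l' : apps t (l ++ l') = apps (apps t l) l'.
Proof. revert t; induction l; intros; simpl; auto. Qed.

(* The arguments of the cut are moved one by one: by theta, [t u] is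
   [(mu d.[d]t) u], which makes [t] the term of a cut with fewer arguments. *)
Lemma cut_fill b b' X l c :
  flm X -> Forall lm l -> lm c ->
  teq (cut b l (Nam (S b') (fill (fren S X) c)))
      (Nam b' (fill X (cut (S b) (map (ren (fvar X) S) l) (ren id_ swap c)))).
Proof.
  remember (length l) as n eqn:Hn. revert l Hn b b' X c.
  induction n as [|n IH]; intros l Hn b b' X c HX Hl Hc.
  { destruct l; [|discriminate]. now apply cut_fill_0. }
  destruct l as [|u l _] using rev_ind; [discriminate|].
  rewrite length_app, Nat.add_comm in Hn. injection Hn as Hn.
  apply Forall_app in Hl. destruct Hl as [Hl Hu]. inversion Hu; subst.
    unfold cut at 1. rewrite apps_app. cbn [apps].
    set (T := apps (Mu (Nam (S b') (fill (fren S X) c))) l).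
    assert (HT : lm T) by (unfold T; lm_tac).
    apply teq_trans with (cut b [u] (Nam 0 (ren id_ S T))).
    { apply teq_Nam, teq_App; [apply teq_sym, teq_theta|apply teq_refl]; auto. }
    set (c1 := ren id_ (up (up S)) c).
    assert (E : Nam 0 (ren id_ S T) = cut 0 (map (ren id_ S) l) (Nam (S (S b')) (fill (fren S (fren S X)) c1))).
    { unfold T, cut. rewrite ren_apps. cbn [ren]. rewrite ren_fill. unfold c1.
      do 4 f_equal. destruct X; simpl; rewrite ?ren_ren; reflexivity. }
    rewrite E. eapply teq_trans.
    { apply teq_cut; [auto|]. apply IH; unfold c1; rewrite ?length_map; auto with lm. }
    eapply teq_trans.
    { apply cut_fill_1; auto with lm. unfold c1. destruct X; lm_tac. }
    apply teq_Nam, teq_fill; auto.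
    rewrite ren_cut. unfold cut at 1. cbn [apps].
    replace (swap (S 0)) with 0 by reflexivity.
    unfold cut at 2. rewrite map_app, apps_app. cbn [map apps].
    apply teq_Nam, teq_App; [|apply teq_refl; auto with lm].
    eapply teq_conv; [apply (teq_theta (apps (Mu (ren id_ swap c)) (map (ren (fvar X) S) l)))| |reflexivity].
    + lm_tac.
    + rewrite ren_apps. unfold cut, c1. cbn [ren]. do 3 f_equal.
      * rewrite !ren_ren. f_equal. apply ren_ext; [reflexivity|]. intros [|[|i]]; reflexivity.
      * rewrite !map_ren_ren. apply map_ren_ext; [|reflexivity]. intro; destruct X; reflexivity.
Qed.

Definition fillT (X : frame) (t : expr Tm) : expr Tm :=
  match X with FMu => t | FLam => Lam t | FApp v => App t v end.

Lemma fill_fillT X c : fill X c = fillT X (Mu c).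
Proof. now destruct X. Qed.
Lemma ren_fillT g X t : ren id_ g (fillT X t) = fillT (fren g X) (ren id_ g t).
Proof. destruct X; simpl; rewrite ?up_id; reflexivity. Qed.
Lemma lm_fillT X t : flm X -> lm t -> lm (fillT X t).
Proof. destruct X; simpl; auto. Qed.
#[local] Hint Resolve lm_fillT : lm.
Lemma teq_fillT X (t t' : expr Tm) : flm X -> teq t t' -> teq (fillT X t) (fillT X t').
Proof. destruct X; simpl; auto using teq_Lam, teq_App, teq_refl. Qed.

(* The cut by [l] commutes with the linear context leading from [t1] (or [c1])
   to [t2] (or [c2]).  All renamings are included because moving the cut below
   an application or an abstraction first introduces a name, by theta. *)
Definition commT (b : nat) (l : list (expr Tm)) (t1 t2 : expr Tm) : Prop :=
  lm t1 /\ lm t2 /\ forall q b',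
  teq (cut (q b) (map (ren id_ q) l) (Nam (S b') (ren id_ (up q) t1))) (Nam b' (ren id_ q t2)).
Definition commC (b : nat) (l : list (expr Tm)) (c1 c2 : expr Cm) : Prop :=
  lm c1 /\ lm c2 /\ forall q,
  teq (cut (q b) (map (ren id_ q) l) (ren id_ (up q) c1)) (ren id_ q c2).

Lemma commT_Mu b l c1 c2 :
  Forall lm l -> lm c1 ->
  commC (S b) (map (ren id_ S) l) (ren id_ swap c1) c2 -> commT b l (Mu c1) (Mu c2).
Proof.
  intros Hl Hc (_ & H2 & H). split; [|split]; auto. intros q b'.
  eapply teq_trans; [apply (cut_fill (q b) b' FMu (map (ren id_ q) l) (ren id_ (up (up q)) c1)); auto with lm; exact I|].
  apply teq_Nam, teq_Mu. eapply teq_conv; [apply (H (up q))| |reflexivity].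
  unfold cut. cbn [up fvar]. do 2 f_equal.
  - f_equal. rewrite !ren_ren. apply ren_ext; [reflexivity|]. intros [|[|i]]; reflexivity.
  - rewrite !map_ren_ren. reflexivity.
Qed.

(** Theta puts a [mu] in the frame, so that [cut_fill] applies; once the cut has moved inside, theta
    erases the auxiliary name. *)
Lemma commT_fillT X b l t1 t2 :
  flm X -> Forall lm l ->
  commT b (map (ren (fvar X) id_) l) t1 t2 -> commT b l (fillT (fren S X) t1) (fillT X t2).
Proof.
  intros HX Hl (H1 & H2 & H). split; [|split]; auto with lm. intros q b'.
  set (t1' := ren id_ (up q) t1).
  assert (Ht1 : lm t1') by (unfold t1'; auto with lm).
  apply teq_trans with (cut (q b) (map (ren id_ q) l)
    (Nam (S b') (fill (fren S (fren q X)) (Nam 0 (ren id_ S t1'))))).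
  { apply teq_cut; auto with lm. apply teq_Nam. rewrite ren_fillT, fill_fillT.
    replace (fren (up q) (fren S X)) with (fren S (fren q X))
      by (destruct X; simpl; rewrite ?ren_ren; reflexivity).
    apply teq_fillT; auto with lm. now apply teq_sym, teq_theta. }
  eapply teq_trans; [apply cut_fill; auto with lm|].
  apply teq_trans with (Nam b' (fill (fren q X) (Nam 0 (ren id_ S (ren id_ q t2))))).
  - apply teq_Nam, teq_fill; auto with lm.
    eapply teq_conv; [apply (H (fun i => S (q i)) 0)| |].
    + unfold cut, t1'. cbn [ren]. do 2 f_equal.
      * rewrite !ren_ren. do 2 f_equal. apply ren_ext; [reflexivity|]. intros [|[|i]]; reflexivity.
      * rewrite !map_ren_ren. apply map_ren_ext; intro; [|reflexivity]. now destruct X.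
    + now rewrite ren_ren.
  - apply teq_Nam. rewrite ren_fillT, fill_fillT. apply teq_fillT; auto with lm.
    apply teq_theta; auto with lm.
Qed.

Lemma commT_apps b l l' t1 t2 :
  Forall lm l -> Forall lm l' ->
  commT b l t1 t2 -> commT b l (apps t1 (map (ren id_ S) l')) (apps t2 l').
Proof.
  intros Hl Hl'; revert t1 t2; induction Hl' as [|v l' Hv Hl' IH]; intros; simpl; auto.
  apply IH. apply (commT_fillT (FApp v)); auto. simpl. now rewrite map_ren_id.
Qed.

Lemma commC_Nam b b' l t1 t2 : commT b l t1 t2 -> commC b l (Nam (S b') t1) (Nam b' t2).
Proof. intros (H1 & H2 & H). split; [|split]; auto. intro q. apply (H q (q b')). Qed.

(** Recovers the mutual induction of the grammars of linear contexts from the single indexed type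
    [ctx]. *)
Lemma linear_rect h (PT : ctx h Tm -> Prop) (PC : ctx h Cm -> Prop) :
  match h return (ctx h Tm -> Prop) -> (ctx h Cm -> Prop) -> Prop with
  | Tm => fun PT _ => PT CTHole | Cm => fun _ PC => PC CCHole | St => fun _ _ => True
  end PT PC ->
  (forall K u, PT K -> PT (CAppL K u)) -> (forall K, PT K -> PT (CLam K)) ->
  (forall K, PC K -> PT (CMu K)) -> (forall K u, PT K -> PT (CESubL K u)) ->
  (forall a K, PT K -> PC (CNam a K)) -> (forall K a s, PC K -> PC (CRepL K a s)) ->
  forall r (K : ctx h r), linear K ->
  match r return ctx h r -> Prop with Tm => PT | Cm => PC | St => fun _ => True end K.
Proof.
  intros H0 H1 H2 H3 H4 H5 H6 r K; revert PT PC H0 H1 H2 H3 H4 H5 H6.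
  induction K; intros PT PC H0 H1 H2 H3 H4 H5 H6 HK; try contradiction HK; auto.
  - apply H1. exact (IHK PT PC H0 H1 H2 H3 H4 H5 H6 HK).
  - apply H2. exact (IHK PT PC H0 H1 H2 H3 H4 H5 H6 HK).
  - apply H3. exact (IHK PT PC H0 H1 H2 H3 H4 H5 H6 HK).
  - apply H4. exact (IHK PT PC H0 H1 H2 H3 H4 H5 H6 HK).
  - apply H5. exact (IHK PT PC H0 H1 H2 H3 H4 H5 H6 HK).
  - apply H6. exact (IHK PT PC H0 H1 H2 H3 H4 H5 H6 HK).
Qed.

(** Induction step for [rot]: crossing [S n] binders is crossing one, by [swap], and then [n]. *)
Lemma ren_swap_plug h r (K : ctx h r) (c : expr h) :
  ren id_ swap (plug (cren id_ (up S) K) (ren id_ (rot (S (nnam K))) c)) =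
  plug (cren id_ S K) (ren id_ (rot (nnam K)) c).
Proof.
  rewrite ren_plug, cren_cren, nvar_cren, nnam_cren, ren_ren. f_equal.
  - apply cren_ext; [reflexivity|]; intros [|]; reflexivity.
  - apply ren_ext; [intro; now rewrite upn_id|]. intros [|i].
    + cbn [rot]. rewrite <- (Nat.add_1_r (nnam K)), upn_add. simpl. lia.
    + rewrite !rot_S, upn_S, upn_upn. f_equal. fext.
Qed.

Lemma ren_swap_plug_var h r (K : ctx h r) (c : expr h) :
  ren swap id_ (plug (cren (up S) id_ K) (ren (rot (S (nvar K))) id_ c)) =
  plug (cren S id_ K) (ren (rot (nvar K)) id_ c).
Proof.
  rewrite ren_plug, cren_cren, nvar_cren, nnam_cren, ren_ren. f_equal.
  - apply cren_ext; [|reflexivity]; intros [|]; reflexivity.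
  - apply ren_ext; [|intro; now rewrite upn_id]. intros [|i].
    + cbn [rot]. rewrite <- (Nat.add_1_r (nvar K)), upn_add. simpl. lia.
    + rewrite !rot_S, upn_S, upn_upn. f_equal. fext.
Qed.

(** Only the expansion of [X] is prescribed, so that [X] may be a replacement as well as [[b]mu
    a.c]. *)
Definition moved {r} (K : ctx Cm r) (b : nat) (l : list (expr Tm)) (c X : expr Cm) : Prop :=
  Forall lm l /\
  expand X = cut (nnam K + b) (map (ren (Nat.add (nvar K)) (Nat.add (nnam K))) l) (expand c).

(** Each layer of [K] expands to frames already known to commute with cuts: a substitution to an
    application of an abstraction, a replacement to a name, applications and a [mu]. *)
Lemma expand_cut (K : ctx Cm Cm) b l c X :
  linear K -> moved K b l c X ->
  commC b l (expand (plug (cren id_ S K) (ren id_ (rot (nnam K)) c))) (expand (plug K X)).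
Proof.
  intro HK. revert b l c X.
  pattern K. revert HK. revert K.
  apply (linear_rect Cm
    (fun K => forall b l c X, moved K b l c X ->
      commT b l (expand (plug (cren id_ S K) (ren id_ (rot (nnam K)) c))) (expand (plug K X)))
    (fun K => forall b l c X, moved K b l c X ->
      commC b l (expand (plug (cren id_ S K) (ren id_ (rot (nnam K)) c))) (expand (plug K X)))) with (r := Cm).
  - intros b l c X [Hl HX]. cbn [plug cren nnam nvar] in *. split; [|split]; auto with lm.
    intro q. rewrite rot_0, ren_id, HX, ren_cut.
    replace (map (ren (Nat.add 0) (Nat.add 0)) l) with l by (symmetry; apply map_ren_id).
    apply teq_refl. auto with lm.
  - intros K u IH b l c X [Hl HX]. cbn [plug cren nnam nvar expand] in *. rewrite expand_ren.
    apply (commT_fillT (FApp (expand u))); simpl; auto with lm. rewrite map_ren_id. apply IH. now split.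
  - intros K IH b l c X [Hl HX]. cbn [plug cren nnam nvar expand] in *. rewrite up_id.
    apply (commT_fillT FLam); simpl; auto. apply IH. split; auto with lm.
    rewrite map_ren_ren, HX. f_equal. apply map_ren_ext; intro; unfold id_; lia.
  - intros K IH b l c X [Hl HX]. cbn [plug cren nnam nvar expand] in *.
    apply commT_Mu; auto with lm. rewrite <- expand_ren, ren_swap_plug.
    apply IH. split; auto with lm. rewrite map_ren_ren, HX. f_equal; [lia|].
    apply map_ren_ext; intro; unfold id_; lia.
  - intros K u IH b l c X [Hl HX]. cbn [plug cren nnam nvar expand] in *. rewrite expand_ren, up_id.
    apply (commT_fillT (FApp (expand u))); simpl; auto with lm. rewrite map_ren_id.
    apply (commT_fillT FLam); simpl; auto. apply IH. split; auto with lm.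
    rewrite map_ren_ren, HX. f_equal. apply map_ren_ext; intro; unfold id_; lia.
  - intros a K IH b l c X [Hl HX]. cbn [plug cren nnam nvar expand] in *.
    apply commC_Nam, IH. now split.
  - intros K a s IH b l c X [Hl HX]. cbn [plug cren nnam nvar expand] in *.
    rewrite expand_ren, stl_ren. apply commC_Nam, commT_apps; auto with lm.
    apply commT_Mu; auto with lm. rewrite <- expand_ren, ren_swap_plug.
    apply IH. split; auto with lm. rewrite map_ren_ren, HX. f_equal; [lia|].
    apply map_ren_ext; intro; unfold id_; lia.
Qed.

Lemma teq_app_lam t v u :
  lm t -> lm v -> lm u -> teq (App (Lam (App t (ren S id_ v))) u) (App (App (Lam t) u) v).
Proof. intros; apply teq_rule; [constructor| |]; lm_tac. Qed.

Lemma teq_lam_lam t v :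
  lm t -> lm v -> teq (App (Lam (Lam t)) v) (Lam (App (Lam (ren swap id_ t)) (ren S id_ v))).
Proof. intros; apply teq_rule; [constructor| |]; lm_tac. Qed.

Lemma teq_lam_mu b t u :
  lm t -> lm u -> teq (App (Lam (Mu (Nam b t))) u) (Mu (Nam b (App (Lam t) (ren id_ S u)))).
Proof. intros; apply teq_rule; [constructor| |]; lm_tac. Qed.

Lemma teq_apps_lam t l u :
  lm t -> Forall lm l -> lm u ->
  teq (App (Lam (apps t (map (ren S id_) l))) u) (apps (App (Lam t) u) l).
Proof.
  intros Ht Hl Hu; revert t Ht; induction Hl as [|v l Hv Hl IH]; intros; simpl.
  - apply teq_refl; lm_tac.
  - eapply teq_trans; [apply IH; lm_tac|].
    apply teq_apps; auto using teql_refl, teq_app_lam.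
Qed.

Lemma expand_sub (K : ctx Tm Tm) t u :
  linear K ->
  teq (expand (ESub (plug (cren S id_ K) (ren (rot (nvar K)) id_ t)) u))
      (expand (plug K (ESub t (under K u)))).
Proof.
  intro HK. cbn [expand]. revert t u. pattern K. revert HK. revert K.
  apply (linear_rect Tm
    (fun K => forall t u,
      teq (App (Lam (expand (plug (cren S id_ K) (ren (rot (nvar K)) id_ t)))) (expand u))
          (expand (plug K (ESub t (under K u)))))
    (* [tau_lam_mu] moves an argument through a [mu] together with the name below it, so the claim
       for command contexts is stated below a [Mu]. *)
    (fun K => forall t u,
      teq (App (Lam (Mu (expand (plug (cren S id_ K) (ren (rot (nvar K)) id_ t))))) (expand u))
          (Mu (expand (plug K (ESub t (under K (ren id_ S u)))))))) with (r := Tm).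
  - intros t u. cbn [plug cren nvar expand]. rewrite rot_0, ren_id, under_0 by reflexivity.
    apply teq_refl; lm_tac.
  - intros K v IH t u. cbn [plug cren nvar expand]. rewrite expand_ren.
    eapply teq_trans; [apply teq_app_lam; auto with lm|]. apply teq_App; [|apply teq_refl; auto with lm].
    apply IH.
  - intros K IH t u. cbn [plug cren nvar expand].
    eapply teq_trans; [apply teq_lam_lam; auto with lm|]. apply teq_Lam.
    rewrite <- !expand_ren, ren_swap_plug_var.
    replace (under (CLam K) u) with (under K (ren S id_ u)); [apply IH|].
    unfold under. rewrite ren_ren. apply ren_ext; intro; simpl; unfold id_; lia.
  - intros K IH t u. cbn [plug cren nvar expand]. rewrite up_id.
    replace (under (CMu K) u) with (under K (ren id_ S u)); [apply IH|].
    unfold under. rewrite ren_ren. apply ren_ext; intro; simpl; unfold id_; lia.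
  - intros K v IH t u. cbn [plug cren nvar expand]. rewrite expand_ren.
    eapply teq_trans; [apply teq_app_lam; auto with lm|]. apply teq_App; [|apply teq_refl; auto with lm].
    eapply teq_trans; [apply teq_lam_lam; auto with lm|]. apply teq_Lam.
    rewrite <- !expand_ren, ren_swap_plug_var.
    replace (under (CESubL K v) u) with (under K (ren S id_ u)); [apply IH|].
    unfold under. rewrite ren_ren. apply ren_ext; intro; simpl; unfold id_; lia.
  - intros a K IH t u. cbn [plug cren nvar expand].
    eapply teq_trans; [apply teq_lam_mu; auto with lm|]. apply teq_Mu, teq_Nam.
    rewrite <- expand_ren. apply IH.
  - intros K a s IH t u. cbn [plug cren nvar expand]. rewrite expand_ren, stl_ren, up_id.
    eapply teq_trans; [apply teq_lam_mu; auto with lm|]. apply teq_Mu, teq_Nam.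
    eapply teq_trans; [apply teq_apps_lam; auto with lm|].
    apply teq_apps; [|apply teql_refl; auto with lm]. rewrite <- expand_ren.
    replace (under (CRepL K a s) (ren id_ S u)) with (under K (ren id_ S (ren id_ S u))); [apply IH|].
    unfold under. rewrite !ren_ren. apply ren_ext; intro; simpl; unfold id_; lia.
Qed.

Lemma commC_teq b l c1 c2 : commC b l c1 c2 -> teq (cut b l c1) c2.
Proof.
  intros (_ & _ & H). specialize (H id_). now rewrite map_ren_id, up_id, !ren_id in H.
Qed.

Lemma expand_mu (K : ctx Cm Cm) b c :
  linear K ->
  teq (expand (Nam b (Mu (plug (cren id_ S K) (ren id_ (rot (nnam K)) c)))))
      (expand (plug K (Nam (nnam K + b) (Mu c)))).
Proof. intro HK. apply (commC_teq b []), expand_cut; auto. split; auto. Qed.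

Lemma expand_rep (K : ctx Cm Cm) c a s :
  linear K ->
  teq (expand (Rep (plug (cren id_ S K) (ren id_ (rot (nnam K)) c)) a s))
      (expand (plug K (Rep c (nnam K + a) (under K s)))).
Proof.
  intro HK. apply (commC_teq a (stl (expand s))), expand_cut; auto. split; auto with lm.
  unfold under. cbn [expand]. now rewrite expand_ren, stl_ren.
Qed.

(** Stacks are not lambda-mu objects, so they are compared term by term. *)
Definition teqE (o p : object) : Prop :=
  match o, p with
  | @Obj s a, @Obj s' b =>
      s = s' /\
      match s with St => teql (stl (expand a)) (stl (expand b)) | _ => teq (expand a) (expand b) end
  end.

Lemma teqE_refl o : teqE o o.
Proof.
  destruct o as [s o]; split; auto.
  destruct s; [apply teq_refl|apply teq_refl|apply teql_refl]; auto with lm.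
Qed.
Lemma teqE_sym o p : teqE o p -> teqE p o.
Proof.
  destruct o as [s o], p as [s' p]; intros [<- H]; split; auto.
  destruct s; auto using teq_sym, teql_sym.
Qed.
Lemma teqE_trans o p q : teqE o p -> teqE p q -> teqE o q.
Proof.
  destruct o as [s o], p as [s' p], q as [s'' q]; intros [<- H] [<- H']; split; auto.
  destruct s; eauto using teq_trans, teql_trans.
Qed.

Lemma teqE_ctx h r (K : ctx h r) (o p : expr h) : teqE o p -> teqE (plug K o) (plug K p).
Proof.
  intro H; induction K; try exact H; destruct (IHK _ _ H) as [_ H']; clear IHK H;
    cbn [plug]; split; try reflexivity; cbn [expand stl].
  - apply teq_App; auto. apply teq_refl; auto with lm.
  - apply teq_App; auto. apply teq_refl; auto with lm.
  - now apply teq_Lam.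
  - now apply teq_Mu.
  - apply teq_App; [now apply teq_Lam|]. apply teq_refl; auto with lm.
  - apply teq_App; auto. apply teq_refl; auto with lm.
  - now apply teq_Nam.
  - apply teq_Nam, teq_apps; [now apply teq_Mu|]. apply teql_refl; auto with lm.
  - apply teq_Nam, teq_apps; auto. apply teq_refl; auto with lm.
  - constructor; auto.
  - constructor; auto. apply teql_refl; auto with lm.
  - constructor; auto. apply teq_refl; auto with lm.
Qed.

Lemma teqE_struct_rule o p : struct_rule o p -> teqE o p.
Proof.
  destruct 1; split; try reflexivity.
  - now apply expand_sub.
  - now apply expand_rep.
  - now apply expand_mu.
  - simpl. rewrite expand_ren. apply teq_rule; [constructor| |]; lm_tac.
  - simpl. rewrite expand_ren. apply teq_theta; auto with lm.
Qed.

Lemma teqE_struct o p : struct_equiv o p -> teqE o p.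
Proof.
  induction 1; eauto using teqE_struct_rule, teqE_refl, teqE_sym, teqE_trans, teqE_ctx.
Qed.

Lemma teqE_L (L : ctx Tm Tm) t u :
  subst_ctx L -> teqE (App (plug L t) u) (plug L (App t (under L u))).
Proof.
  intro HL; revert u; pattern L; revert L HL; apply subst_ctx_rect.
  - intro u. rewrite under_0 by reflexivity. apply teqE_refl.
  - intros L v HL IH u. cbn [plug].
    eapply teqE_trans; [apply teqE_sym|].
    + pose proof (teqE_struct_rule _ _ (@struct_sub (CAppL CTHole u) (plug L t) v I)) as H.
      cbn [plug cren nvar] in H. rewrite rot_0, ren_id, under_0 in H by reflexivity. exact H.
    + specialize (IH (ren S id_ u)).
      replace (under (CESubL L v) u) with (under L (ren S id_ u)).
      * exact (teqE_ctx _ _ (CESubL CTHole v) _ _ IH).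
      * unfold under. rewrite ren_ren. apply ren_ext; intro; simpl; unfold id_; lia.
Qed.

(** Once the context is crossed by structural rules, the sides of dB have the same expansion, and
    those of dM, N and C differ by one theta. *)
Lemma teqE_plain_rule o p : plain_rule o p -> teqE o p.
Proof.
  destruct 1 as [L t u HL|L c u HL|K t a s HK|K c s' a s HK].
  - eapply teqE_trans; [now apply teqE_L|]. apply teqE_ctx. split; [reflexivity|].
    apply teq_refl; lm_tac.
  - eapply teqE_trans; [now apply teqE_L|]. apply teqE_ctx. split; [reflexivity|].
    simpl. rewrite !expand_ren.
    apply teq_sym, (teq_theta (App (Mu (expand c)) (expand (under L u)))); lm_tac.
  - pose proof (teqE_struct_rule _ _ (@struct_rep K (Nam 0 (ren id_ S t)) a s HK)) as H. cbn [ren] in H.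
    rewrite ren_ren in H. eapply teqE_trans; [exact H|]. apply teqE_ctx. split; [reflexivity|].
    rewrite app_stack_apps. cbn [expand]. rewrite expand_apps, <- stl_expand, expand_ren by reflexivity.
    apply teq_Nam, teq_apps; [apply teq_theta|apply teql_refl]; auto with lm.
  - pose proof (teqE_struct_rule _ _ (@struct_rep K (Rep (ren id_ (up S) c) 0 (ren id_ S s')) a s HK)) as H. cbn [ren] in H.
    rewrite !ren_ren, up_comp in H. eapply teqE_trans; [exact H|]. apply teqE_ctx. split; [reflexivity|].
    cbn [expand]. rewrite !stl_expand, stl_stack_cat, map_app, apps_app by reflexivity.
    rewrite <- !stl_expand, !expand_ren, !stl_ren by reflexivity.
    apply teq_Nam, teq_apps; [|apply teql_refl; auto with lm].
    eapply teq_conv; [apply (teq_theta (apps (Mu (expand c)) (stl (expand s')))); lm_tac| |reflexivity].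
    now rewrite ren_apps.
Qed.

Lemma teqE_plain_steps o p : clos_refl_trans object plain_step o p -> teqE o p.
Proof.
  induction 1 as [? ? []| |]; eauto using teqE_refl, teqE_trans.
  now apply teqE_ctx, teqE_plain_rule.
Qed.

(** * Comparison of normal forms *)

Lemma congruence_on_weaken (D D' : object -> Prop) R o p :
  (forall o, D o -> D' o) -> congruence_on D R o p -> congruence_on D' R o p.
Proof.
  intros HD; induction 1.
  - now apply cong_rule; auto.
  - apply cong_refl; auto.
  - now apply cong_sym.
  - eapply cong_trans; eauto.
  - apply cong_ctx; auto.
Qed.

(** In the identity environment the two values are equivalent, and each plain form is equivalent to
    its own value. *)
Lemma beq_plain_forms s s' (o : expr s) (p : expr s') :
  isplain o -> isplain p -> approx o p -> beq o p.
Proof.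
  intros Ho Hp [_ H].
  specialize (H id_ env_id [] plain_env_id (Forall_nil _)).
  assert (HE : forall s (o : expr s), isplain o -> beq (eval o id_ env_id []) o).
  { intros k q Hq. pose proof (eval_plain _ q [] Hq (Forall_nil _) (or_intror eq_refl)) as E.
    now destruct k. }
  eapply beq_trans; [apply beq_sym, HE|eapply beq_trans; [exact H|apply HE]]; auto.
Qed.

Lemma lm_sort s (o : expr s) : lm o -> s <> St.
Proof. destruct o; simpl; intros; (discriminate || contradiction). Qed.

Theorem theorem6p9 (o p : object) (ho : lambda_mu o) (hp : lambda_mu p) :
  tau_equiv o p <-> struct_equiv (plain_nf o) (plain_nf p).
Proof.
  destruct (plain_nf_spec o) as [Ho Hfo], (plain_nf_spec p) as [Hp Hfp].
  split; intro H.
  - assert (Ha : approx (plain_nf o) (plain_nf p)).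
    { eapply approx_trans; [apply approx_sym, approx_plain_step, Ho|].
      eapply approx_trans; [exact (approx_tau _ _ H)|]. apply approx_plain_step, Hp. }
    pose proof (teqE_plain_steps _ _ Ho) as Hso.
    apply plain_form_isplain in Hfo, Hfp.
    destruct (plain_nf o) as [s qo], (plain_nf p) as [s' qp].
    apply (congruence_on_weaken isplainO); [intros; now apply plain_form_isplain|].
    destruct (beq_plain_forms _ _ qo qp Hfo Hfp Ha) as [_ Hb].
    (* On stacks [beq] compares only term by term; this sort is excluded because reduction preserves
       sorts and [o] is a lambda-mu object. *)
    destruct s; auto. destruct o as [so o]. destruct Hso as [Hs _]. now destruct (lm_sort _ _ ho).
  - assert (HE : teqE o p).
    { eapply teqE_trans; [apply teqE_plain_steps, Ho|].
      eapply teqE_trans; [apply teqE_struct, H|]. apply teqE_sym, teqE_plain_steps, Hp. }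
    destruct o as [s o], p as [s' p]. destruct HE as [<- HE].
    rewrite !expand_lm in HE by assumption. destruct s; try exact HE. now destruct (lm_sort _ _ ho).
Qed.
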